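(* Let $T>0$, let $(\Omega,\mathcal F,(\mathcal F_t)_{0\le t\le T},\mathbb P)$ be a filtered probability space satisfying the usual conditions, let $P=(P_t)_{0\le t\le T}$ be a real progressively measurable process with $\mathbb E[\int_0^T P_s^2\,ds]<\infty$, let $q>0$, let $h_0:[0,T]\to\mathbb R$ be a square-integrable deterministic function, let $G\in\mathcal G$, and let $\lambda>0$, $\varrho\ge 0$, $\phi\ge 0$. Then there exists $u^*\in\mathcal A$ such that, for all $t\in[0,T]$, $$u^*_t=\frac{1}{2\lambda}\Big(\mathbb E[P_t-P_T\mid\mathcal F_t]-Y^{u^*}_t+\langle\Theta_t,K_t\rangle_{L^2}+\langle\Gamma_t^{-1}K_t,\,g^{u^*}_t\rangle_{L^2}\Big),$$ and $u^*$ is optimal in the following sense: for every $t\in[0,T]$, $$V^{u^*}_t=\operatorname*{ess\,sup}_{u\in\mathcal A_t(u^* )}\mathbb E\Big[\int_t^T\big((P_s-Y^u_s)u_s-\lambda u_s^2-\phi(Q^u_s)^2\big)ds+P_TQ^u_T\,\Big|\,\mathcal F_t\Big]-\varrho q^2,$$ where $\mathcal A_t(u^* )=\{u\in\mathcal A:\ u_s=u^*_s \text{ for } s\le t\}$ and the optimal value process is $$V^{u^*}_t=\tfrac12\Big(\langle g^{u^*}_t,\Gamma_t^{-1}g^{u^*}_t\rangle_{L^2}+2\langle\Theta_t,g^{u^*}_t\rangle_{L^2}+2\,\mathbb E[P_T\mid\mathcal F_t]\,Q^{u^*}_t+\chi_t\Big).$$ In particular $V^{u^*}_0=\sup_{u\in\mathcal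 A}J(u)$ with $J(u)=\mathbb E\big[\int_0^T(P_t-Z^u_t)u_t\,dt-\lambda\int_0^Tu_t^2dt+Q^u_TP_T-\phi\int_0^T(Q^u_t)^2dt-\varrho(Q^u_T)^2\big]$.
   Context: Admissible strategies: $\mathcal A$ is the set of progressively measurable real processes $u$ with $\mathbb E[\int_0^Tu_s^2ds]<\infty$; $Q^u_t=q-\int_0^tu_sds$. A kernel $G:[0,T]^2\to[0,\infty)$ is Volterra if $G(t,s)=0$ for $s\ge t$, and nonnegative definite if $\int_0^T\int_0^T(G(t,s)+G(s,t))f(s)f(t)\,ds\,dt\ge0$ for all $f\in L^2([0,T],\mathbb R)$. The class $\mathcal G$ consists of nonnegative definite Volterra kernels with $\sup_{t\le T}\int_0^T|G(t,s)|^2ds+\sup_{s\le T}\int_0^T|G(t,s)|^2dt<\infty$ and $\lim_{h\to0}\int_0^T|G(t+h,s)-G(t,s)|^2ds=0$ for every $t\le T$. State variables: $Z^u_t=h_0(t)+\int_0^tG(t,s)u_sds$, $Y^u_t=Z^u_t-2\varrho Q^u_t$. Set $\tilde h_0(t)=h_0(t)-2\varrho q$, $\tilde G(t,s)=2\varrho\mathbb 1_{\{s<t\}}+G(t,s)$ (so $Y^u_t=\tilde h_0(t)+\int_0^t\tilde G(t,s)u_sds$), $K(t,s)=(\tilde G(t,s),-\mathbb 1_{\{s\le t\}})^\top\in\mathbb R^2$, $K_t(s):=K(s,t)$, and $g^u_t(s)=\mathbb 1_{\{s\ge t\}}\big(\tilde h_0(s)+\int_0^t\tilde G(s,r)u_rdr,\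 Q^u_t\big)^\top$. Operators: $\langle f,g\rangle_{L^2}=\int_0^Tf(s)^\top g(s)ds$; ${\rm id}$ is the identity; $\mathbb 1_t(s)=\mathbb 1_{\{s\ge t\}}$; $e_1=(1,0)^\top$. On $L^2([0,T],\mathbb R)$ let $\tilde{\mathbf G}_t$ be the integral operator with kernel $\tilde G(s,u)\mathbb 1_{\{u\ge t\}}$, $\mathbf 1_t$ the integral operator with kernel $(u,s)\mapsto\mathbb 1_{\{u\ge s\}}\mathbb 1_{\{s\ge t\}}$, ${}^*$ denotes adjoint, and $\mathbf D_t=2\lambda\,{\rm id}+\tilde{\mathbf G}_t+\tilde{\mathbf G}_t^*+2\phi\,\mathbf 1_t^*\mathbf 1_t$, which is invertible. $\Gamma_t^{-1}$ is the operator on $L^2([0,T],\mathbb R^2)$ given in block form by $\begin{pmatrix}\mathbf D_t^{-1}&-2\phi\mathbf D_t^{-1}\mathbf 1_t^*\\-2\phi\mathbf 1_t\mathbf D_t^{-1}&-2\phi\,{\rm id}+4\phi^2\mathbf 1_t\mathbf D_t^{-1}\mathbf 1_t^*\end{pmatrix}$. Processes: $\Theta_t(s)=-\big(\Gamma_t^{-1}[\mathbb 1_t(\cdot)\,\mathbb E[P_\cdot-P_T\mid\mathcal F_t]\,e_1]\big)(s)$ for $0\le t\le s\le T$; $M_t=\mathbb E[P_T\mid\mathcal F_t]$; $\chi_t=-2\varrho q^2+\int_t^T\frac1{2\lambda}\mathbb E\big[(P_s-M_s+\langle\Theta_s,K_s\rangle_{L^2})^2\mid\mathcal F_t\big]d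s$.
   Formalization: Adds E[P_T^2]<∞ (else E[P_T|F_t] and J may be undefined); the feedback formula holds for almost every t, almost surely (P_t may fail to be integrable at some t); as V_0 is random unless F_0 is trivial, the last claim is E[V_0]=sup J(u). *)

(* Defs.v *)
From mathcomp Require Import all_boot all_order all_algebra.
From mathcomp Require Import all_classical all_reals all_analysis.
From Stdlib Require Import ClassicalEpsilon.
Set Implicit Arguments.
Unset Strict Implicit.
Unset Printing Implicit Defensive.
Import Order.TTheory GRing.Theory Num.Theory.
Local Open Scope classical_set_scope.
Local Open Scope ring_scope.

Section Defs.
Context {R : realType} {d : measure_display} {Omega : measurableType d}.

Definition leb := @lebesgue_measure R.

Definition Icc (a b : R) : set R := [set s | a <= s <= b].

Definition RInt (a b : R) (f : R -> R) : R := Rintegral leb (Icc a b) f.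

Definition ind (b : bool) : R := if b then 1 else 0.

Definition sq_int (T : R) (f : R -> R) : Prop :=
  measurable_fun (Icc 0 T) f /\
  (\int[leb]_(s in Icc 0 T) ((f s) ^+ 2)%:E < +oo)%E.

Definition kernel_class (T : R) (G : R -> R -> R) : Prop :=
  measurable_fun setT (fun p : R * R => G p.1 p.2) /\
  (forall t s, Icc 0 T t -> Icc 0 T s -> 0 <= G t s) /\
  (forall t s, Icc 0 T t -> Icc 0 T s -> t <= s -> G t s = 0) /\
  (forall f, sq_int T f ->
     0 <= RInt 0 T (fun t => RInt 0 T (fun s => (G t s + G s t) * f s * f t))) /\
  (exists C : R,
     (forall t, Icc 0 T t -> (\int[leb]_(s in Icc 0 T) ((G t s) ^+ 2)%:E <= C%:E)%E) /\
     (forall s, Icc 0 T s -> (\int[leb]_(t in Icc 0 T) ((G t s) ^+ 2)%:E <= C%:E)%E)) /\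
  (forall t, Icc 0 T t -> forall eps : R, 0 < eps -> exists delta : R, 0 < delta /\
     forall h, `|h| < delta -> Icc 0 T (t + h) ->
       (\int[leb]_(s in Icc 0 T) ((G (t + h) s - G t s) ^+ 2)%:E < eps%:E)%E).

Section Operators.
Variables (T : R) (G : R -> R -> R) (rho lam phi : R).

Definition Gt (t s : R) : R := 2 * rho * ind (s < t) + G t s.

Definition one_op (t : R) (f : R -> R) : R -> R :=
  fun u => RInt 0 T (fun s => ind (s <= u) * ind (t <= s) * f s).
Definition one_adj (t : R) (f : R -> R) : R -> R :=
  fun s => RInt 0 T (fun u => ind (s <= u) * ind (t <= s) * f u).
Definition Gt_op (t : R) (f : R -> R) : R -> R :=
  fun s => RInt 0 T (fun u => Gt s u * ind (t <= u) * f u).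
Definition Gt_adj (t : R) (f : R -> R) : R -> R :=
  fun s => RInt 0 T (fun u => Gt u s * ind (t <= s) * f u).

Definition D_op (t : R) (f : R -> R) : R -> R :=
  fun s => 2 * lam * f s + Gt_op t f s + Gt_adj t f s
           + 2 * phi * one_adj t (one_op t f) s.

Definition D_inv (t : R) (f : R -> R) : R -> R :=
  epsilon (inhabits (fun _ : R => 0))
    (fun g => sq_int T g /\ {ae leb, forall s, Icc 0 T s -> D_op t g s = f s}).

(* \Gamma_t^{-1} acting on a pair (f1,f2) of functions, block form *)
Definition Ginv1 (t : R) (f1 f2 : R -> R) : R -> R :=
  fun s => D_inv t f1 s - 2 * phi * D_inv t (one_adj t f2) s.
Definition Ginv2 (t : R) (f1 f2 : R -> R) : R -> R :=
  fun s => - 2 * phi * one_op t (D_inv t f1) s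
           + (- 2 * phi * f2 s + 4 * phi ^+ 2 * one_op t (D_inv t (one_adj t f2)) s).

Definition ip2 (f1 f2 g1 g2 : R -> R) : R :=
  RInt 0 T (fun s => f1 s * g1 s + f2 s * g2 s).

Definition K1 (t : R) : R -> R := fun s => Gt s t.
Definition K2 (t : R) : R -> R := fun s => - ind (t <= s).

(* Theta_t(s) = -(Gamma_t^{-1}[1_t(.) c(.) e_1])(s), where c(s) stands for
   E[P_s - P_T | F_t] (omega fixed) *)
Definition Theta1 (t : R) (c : R -> R) : R -> R :=
  fun s => - Ginv1 t (fun r => ind (t <= r) * c r) (fun _ => 0) s.
Definition Theta2 (t : R) (c : R -> R) : R -> R :=
  fun s => - Ginv2 t (fun r => ind (t <= r) * c r) (fun _ => 0) s.

Definition ThetaK (t : R) (c : R -> R) : R :=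
  ip2 (Theta1 t c) (Theta2 t c) (K1 t) (K2 t).

End Operators.

Definition usual_filtration (Pr : probability Omega R) (T : R)
  (F : R -> set (set Omega)) : Prop :=
  (forall t, Icc 0 T t -> sigma_algebra setT (F t) /\ F t `<=` measurable) /\
  (forall s t, Icc 0 T s -> Icc 0 T t -> s <= t -> F s `<=` F t) /\
  (forall N, measurable N -> Pr N = 0%E -> forall A, A `<=` N -> F 0 A) /\
  (forall t, 0 <= t < T -> forall A, (forall s, t < s <= T -> F s A) -> F t A).

Definition progressive (T : R) (F : R -> set (set Omega)) (X : R -> Omega -> R)
  : Prop :=
  forall t, Icc 0 T t -> forall B : set R, measurable B ->
    <<s [set p : R * Omega | Icc 0 t p.1],
        [set Z | exists (A : set R) (C : set Omega),
                   [/\ measurable A, A `<=` Icc 0 t, F t C & Z = A `*` C]] >>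
      [set p : R * Omega | Icc 0 t p.1 /\ B (X p.1 p.2)].

Definition sq_int_proc (Pr : probability Omega R) (T : R) (X : R -> Omega -> R)
  : Prop :=
  (\int[Pr]_w \int[leb]_(s in Icc 0 T) ((X s w) ^+ 2)%:E < +oo)%E.

Definition admissible (Pr : probability Omega R) (T : R)
  (F : R -> set (set Omega)) (u : R -> Omega -> R) : Prop :=
  progressive T F u /\ sq_int_proc Pr T u.

Definition is_condexp (Pr : probability Omega R) (G : set (set Omega))
  (X Y : Omega -> R) : Prop :=
  Pr.-integrable setT (EFin \o X) /\
  (forall B : set R, measurable B -> G (Y @^-1` B)) /\
  Pr.-integrable setT (EFin \o Y) /\
  (forall A, G A -> (\int[Pr]_(w in A) (Y w)%:E = \int[Pr]_(w in A) (X w)%:E)%E).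

Definition condexp_family (Pr : probability Omega R) (T : R)
  (F : R -> set (set Omega)) (X : R -> Omega -> R) (C : R -> R -> Omega -> R)
  : Prop :=
  forall t, Icc 0 T t ->
    measurable_fun setT (fun p : R * Omega => C t p.1 p.2) /\
    {ae leb, forall s, Icc t T s -> is_condexp Pr (F t) (X s) (C t s)}.

Definition is_esssup (Pr : probability Omega R) (S : set (Omega -> R))
  (Y : Omega -> R) : Prop :=
  measurable_fun setT Y /\
  (forall X, S X -> {ae Pr, forall w, X w <= Y w}) /\
  (forall Z : Omega -> R, measurable_fun setT Z ->
     (forall X, S X -> {ae Pr, forall w, X w <= Z w}) ->
     {ae Pr, forall w, Y w <= Z w}).

Section State.
Variables (T q rho : R) (h0 : R -> R) (G : R -> R -> R) (u : R -> Omega -> R).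

Definition Qu (t : R) (w : Omega) : R := q - RInt 0 t (fun s => u s w).
Definition Zu (t : R) (w : Omega) : R :=
  h0 t + RInt 0 t (fun s => G t s * u s w).
Definition Yu (t : R) (w : Omega) : R := Zu t w - 2 * rho * Qu t w.

Definition g1u (t : R) (w : Omega) : R -> R :=
  fun s => ind (t <= s) *
    ((h0 s - 2 * rho * q) + RInt 0 t (fun r => Gt G rho s r * u r w)).
Definition g2u (t : R) (w : Omega) : R -> R :=
  fun s => ind (t <= s) * Qu t w.
End State.

Section Objective.
Variables (T q lam rho phi : R) (P : R -> Omega -> R) (h0 : R -> R)
  (G : R -> R -> R).

Definition Jt (u : R -> Omega -> R) (t : R) (w : Omega) : R :=
  RInt t T (fun s => (P s w - Yu q rho h0 G u s w) * u s w
                     - lam * (u s w) ^+ 2 - phi * (Qu q u s w) ^+ 2)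
  + P T w * Qu q u T w.

Definition Jtot (Pr : probability Omega R) (u : R -> Omega -> R) : \bar R :=
  (\int[Pr]_w
     (RInt 0 T (fun t => (P t w - Zu h0 G u t w) * u t w)
      - lam * RInt 0 T (fun t => (u t w) ^+ 2)
      + Qu q u T w * P T w
      - phi * RInt 0 T (fun t => (Qu q u t w) ^+ 2)
      - rho * (Qu q u T w) ^+ 2)%:E)%E.

(* the value process V^u_t, given versions
   M t = E[P_T | F_t], C t s = E[P_s - P_T | F_t],
   Dc t s = E[(P_s - M_s + <Theta_s,K_s>)^2 | F_t] *)
Definition Vu (M : R -> Omega -> R) (C Dc : R -> R -> Omega -> R)
  (u : R -> Omega -> R) (t : R) (w : Omega) : R :=
  let g1 := g1u q rho h0 G u t w in
  let g2 := g2u q u t w in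
  let c := fun r => C t r w in
  let chi := - 2 * rho * q ^+ 2 + RInt t T (fun s => (2 * lam)^-1 * Dc t s w) in
  2^-1 * (ip2 T g1 g2 (Ginv1 T G rho lam phi t g1 g2) (Ginv2 T G rho lam phi t g1 g2)
          + 2 * ip2 T (Theta1 T G rho lam phi t c) (Theta2 T G rho lam phi t c) g1 g2
          + 2 * M t w * Qu q u t w
          + chi).

Definition feedback (E0 : R -> Omega -> R) (C : R -> R -> Omega -> R)
  (u : R -> Omega -> R) (t : R) (w : Omega) : R :=
  let K1t := K1 G rho t in
  let K2t := K2 t in
  (2 * lam)^-1 *
    (E0 t w - Yu q rho h0 G u t w
     + ThetaK T G rho lam phi t (fun r => C t r w)
     + ip2 T (Ginv1 T G rho lam phi t K1t K2t) (Ginv2 T G rho lam phi t K1t K2t)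
             (g1u q rho h0 G u t w) (g2u q u t w)).
End Objective.

End Defs.

(* Main.v *)
(* With [D = 2 lam + kap] the symmetric operator of the quadratic criterion, a resolvent
   kernel [r] supported above the diagonal gives [A = id - r] with [A D A^* = 2 lam].
   Hence [D_t^-1 = (2 lam)^-1 A^* 1_t A] for every [t] at once. The control is
   [u = (2 lam)^-1 A^* xi], where [xi_s = E[(A beta0)_s | F_s]] and [beta0] is the gradient
   of the criterion at zero. Then [D u - beta0] is an upper triangular transform of
   [xi - A beta0], hence orthogonal to adapted processes: this is the first-order
   condition, sufficient because [D] is positive. Restarting the computation at time [t]
   yields [2 lam u_t = (A (b - g_t))_t] in conditional expectation, which is the feedback
   form, and the value as a conditional expectation of a square. *)

From HB Require Import structures.
Require Import Defs.
From mathcomp Require Import all_boot all_order all_algebra.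
From mathcomp Require Import all_classical all_reals all_analysis.
From mathcomp Require Import measurable_realfun ring lra.
Set Implicit Arguments.
Unset Strict Implicit.
Unset Printing Implicit Defensive.
Import Order.TTheory GRing.Theory Num.Theory.
Import numFieldNormedType.Exports.
Local Open Scope classical_set_scope.
Local Open Scope ring_scope.

(** * Square-integrable functions *)

Section L2.
Context d (X : measurableType d) (R : realType).
Variable mu : {measure set X -> \bar R}.
Implicit Types f g h : X -> R.

(** Solving [D_s (r s) = kap s] separately for each [s] would leave [r] without measurability in
    [s]; a Richardson iteration is run for all [s] at once, and its limit is jointly measurable.
    Rows and columns of the kernels are bounded in [L2] at every point, not at almost every point,
    so [Op k f] is defined everywhere and the operator identities hold pointwise. The inverse
    [D_inv] of the statement is an [epsilon]-choice known only through its equation; coercivity of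
    [D] identifies it a.e. on [[t, T]] with the explicit [Dinv], after which only triangular kernels
    remain. The other obstacle is [xi]: the conditional expectations given [F s] must be
    progressively measurable in [s], and arbitrary versions at each [s] have no joint measurability
    at all. For the indicator of an event the martingale is sampled on dyadic grids; its squared
    norm is monotone in time, which forces convergence at almost every time without any path
    regularity. Monotone classes then extend the choice to integrable fields. *)

Definition L2 f := measurable_fun setT f /\
  mu.-integrable setT (EFin \o (fun x => f x ^+ 2)).

Definition ip f g : R := \int[mu]_x (f x * g x).

Lemma integrable_fin_le f g : measurable_fun setT f ->
  (forall x, `|f x| <= g x) ->
  mu.-integrable setT (EFin \o g) -> mu.-integrable setT (EFin \o f).
Proof.
move=> mf fg ig; apply: (le_integrable measurableT _ _ ig).
  exact/measurable_EFinP.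
by move=> x _ /=; rewrite lee_fin (le_trans (fg x))// ler_norm.
Qed.

Lemma integrable_finD f g : mu.-integrable setT (EFin \o f) ->
  mu.-integrable setT (EFin \o g) ->
  mu.-integrable setT (EFin \o (fun x => f x + g x)).
Proof.
move=> i1 i2; have := integrableD measurableT i1 i2.
by apply: eq_integrable => // x _ /=; rewrite EFinD.
Qed.

Lemma integrable_finZ c f : mu.-integrable setT (EFin \o f) ->
  mu.-integrable setT (EFin \o (fun x => c * f x)).
Proof.
move=> i1; have := integrableZl measurableT c i1.
by apply: eq_integrable => // x _ /=; rewrite EFinM.
Qed.

Lemma integrable_finB f g : mu.-integrable setT (EFin \o f) ->
  mu.-integrable setT (EFin \o g) ->
  mu.-integrable setT (EFin \o (fun x => f x - g x)).
Proof.
move=> i1 /(integrable_finZ (-1)) i2; have := integrable_finD i1 i2.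
by apply: eq_integrable => // x _ /=; rewrite mulN1r.
Qed.

Lemma L2_mul f g : L2 f -> L2 g ->
  mu.-integrable setT (EFin \o (fun x => f x * g x)).
Proof.
move=> [mf i1] [mg i2].
apply: (integrable_fin_le _ _ (integrable_finD i1 i2)).
  exact: measurable_funM.
move=> x; rewrite ler_norml; apply/andP; split; nra.
Qed.

Lemma L2_measurable f : L2 f -> measurable_fun setT f.
Proof. by case. Qed.

Lemma L2D f g : L2 f -> L2 g -> L2 (fun x => f x + g x).
Proof.
move=> Lf Lg; split; first by apply: measurable_funD; [case: Lf|case: Lg].
have := integrable_finD (integrable_finD Lf.2 Lg.2)
  (integrable_finZ 2 (L2_mul Lf Lg)).
by apply: eq_integrable => // x _ /=; congr EFin; ring.
Qed.

Lemma L2Z c f : L2 f -> L2 (fun x => c * f x).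
Proof.
move=> Lf; split; first by apply: measurable_funM => //; case: Lf.
have := integrable_finZ (c ^+ 2) Lf.2.
by apply: eq_integrable => // x _ /=; congr EFin; ring.
Qed.

Lemma L2N f : L2 f -> L2 (fun x => - f x).
Proof. by move=> /(L2Z (-1)); under eq_fun do rewrite mulN1r. Qed.

Lemma L2B f g : L2 f -> L2 g -> L2 (fun x => f x - g x).
Proof. by move=> Lf /L2N; exact: L2D. Qed.

Lemma L2_0 : L2 (fun=> 0).
Proof.
split => //; have := @integrable0 _ _ _ mu setT.
by apply: eq_integrable => // x _ /=; rewrite expr0n.
Qed.

Lemma L2_bndM M f g : measurable_fun setT f -> (forall x, `|f x| <= M) ->
  L2 g -> L2 (fun x => f x * g x).
Proof.
move=> mf fM Lg; split; first by apply: measurable_funM => //; case: Lg.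
apply: (integrable_fin_le _ _ (integrable_finZ (M ^+ 2) Lg.2)).
  by apply: measurable_funX; apply: measurable_funM => //; case: Lg.
move=> x; rewrite ger0_norm ?sqr_ge0// exprMn ler_wpM2r ?sqr_ge0//.
by rewrite -real_normK ?num_real// lerXn2r ?nnegrE// (le_trans _ (fM x)).
Qed.

Lemma ipC f g : ip f g = ip g f.
Proof. by apply: eq_Rintegral => x _; rewrite mulrC. Qed.

Lemma eq_ip f f' g g' : f =1 f' -> g =1 g' -> ip f g = ip f' g'.
Proof. by move=> e1 e2; apply: eq_Rintegral => x _; rewrite e1 e2. Qed.

Lemma ipDl f g h : L2 f -> L2 g -> L2 h ->
  ip (fun x => f x + g x) h = ip f h + ip g h.
Proof.
move=> Lf Lg Lh; rewrite /ip -RintegralD//; [|exact: L2_mul..].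
by apply: eq_Rintegral => x _; rewrite mulrDl.
Qed.

Lemma ipZl c f h : L2 f -> L2 h -> ip (fun x => c * f x) h = c * ip f h.
Proof.
move=> Lf Lh; rewrite /ip -RintegralZl//; [|exact: L2_mul..].
by apply: eq_Rintegral => x _; rewrite mulrA.
Qed.

Lemma ipBl f g h : L2 f -> L2 g -> L2 h ->
  ip (fun x => f x - g x) h = ip f h - ip g h.
Proof.
move=> Lf Lg Lh; rewrite /ip -RintegralB//; [|exact: L2_mul..].
by apply: eq_Rintegral => x _; rewrite mulrBl.
Qed.

Lemma ipDr f g h : L2 f -> L2 g -> L2 h ->
  ip h (fun x => f x + g x) = ip h f + ip h g.
Proof. by move=> Lf Lg Lh; rewrite ipC ipDl// !(ipC h). Qed.

Lemma ipZr c f h : L2 f -> L2 h -> ip h (fun x => c * f x) = c * ip h f.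
Proof. by move=> Lf Lh; rewrite ipC ipZl// ipC. Qed.

Lemma ipBr f g h : L2 f -> L2 g -> L2 h ->
  ip h (fun x => f x - g x) = ip h f - ip h g.
Proof. by move=> Lf Lg Lh; rewrite ipC ipBl// !(ipC h). Qed.

Lemma ip0l g : ip (fun=> 0) g = 0.
Proof.
rewrite /ip (@eq_Rintegral _ _ _ _ _ (fun=> 0)); last by move=> x _; rewrite mul0r.
by rewrite Rintegral_cst// mul0r.
Qed.

Lemma ip0r g : ip g (fun=> 0) = 0.
Proof. by rewrite ipC ip0l. Qed.

Lemma ip_ge0 f : 0 <= ip f f.
Proof. by apply: Rintegral_ge0 => x _; rewrite -expr2 sqr_ge0. Qed.

Lemma ip_sqr f : ip f f = \int[mu]_x (f x ^+ 2).
Proof. by apply: eq_Rintegral => x _; rewrite expr2. Qed.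

Lemma cauchy_schwarz f g : L2 f -> L2 g -> ip f g ^+ 2 <= ip f f * ip g g.
Proof.
move=> Lf Lg.
have P a : 0 <= ip f f + 2 * a * ip f g + a ^+ 2 * ip g g.
  have := ip_ge0 (fun x => f x + a * g x).
  have La := L2Z a Lg; have Lfa := L2D Lf La.
  rewrite ipDl// !ipDr// !ipZl// !ipZr// (ipC g f).
  by move=> h; apply: le_trans h _; rewrite -subr_ge0; nra.
have [g0|g0] := eqVneq (ip g g) 0.
  have [->|fg0] := eqVneq (ip f g) 0; first by rewrite g0 mulr0 expr0n.
  (* With [ip g g = 0] the quadratic polynomial in [a] is affine with nonzero slope; at this [a] it
     takes the value -1. *)
  have := P (- (ip f f + 1) / (2 * ip f g)).
  rewrite g0 mulr0 addr0.
  have -> : 2 * (- (ip f f + 1) / (2 * ip f g)) * ip f g = - (ip f f + 1).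
    by field.
  by lra.
have gp : 0 < ip g g by rewrite lt_def g0 ip_ge0.
have := P (- ip f g / ip g g).
have -> : ip f f + 2 * (- ip f g / ip g g) * ip f g + (- ip f g / ip g g) ^+ 2 * ip g g
  = (ip f f * ip g g - ip f g ^+ 2) / ip g g by field.
by rewrite pmulr_lge0 ?invr_gt0// subr_ge0.
Qed.

Lemma ae_Rintegral f g : measurable_fun setT f -> measurable_fun setT g ->
  {ae mu, forall x, f x = g x} -> \int[mu]_x f x = \int[mu]_x g x.
Proof.
move=> mf mg fg; congr fine; apply: ae_eq_integral => //;
  [exact/measurable_EFinP..|].
by apply: filterS fg => x /= ->.
Qed.

Lemma ip_ae0 f : L2 f -> ip f f = 0 -> {ae mu, forall x, f x = 0}.
Proof.
move=> [mf i2] f0.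
have m2 : measurable_fun setT (EFin \o (fun x => f x ^+ 2)) by case/integrableP: i2.
have h : (\int[mu]_x `|(EFin \o (fun x => (f x ^+ 2)%R)) x| = 0)%E.
  under eq_integral => x _ do rewrite /= ger0_norm ?sqr_ge0//.
  have /fineK <- := integrable_fin_num measurableT i2.
  by congr EFin; rewrite -f0 ip_sqr.
move/(ae_eq_integral_abs mu measurableT m2) : h.
apply: filterS => x /(_ I) /= [] /eqP; rewrite sqrf_eq0 => /eqP; exact.
Qed.

Lemma ip_ae f f' g : measurable_fun setT f -> measurable_fun setT f' ->
  measurable_fun setT g ->
  {ae mu, forall x, f x = f' x} -> ip f g = ip f' g.
Proof.
move=> mf mf' mg ff'; apply: ae_Rintegral; [exact: measurable_funM..|].
by apply: filterS ff' => x ->.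
Qed.

(** The bounds in the statement are on extended integrals, while [ip] is real and returns 0 on an
    infinite integral; this is the passage between the two. *)
Lemma L2_norm_leP f M : measurable_fun setT f ->
  (\int[mu]_x ((f x ^+ 2)%R)%:E <= M%:E)%E <-> L2 f /\ ip f f <= M.
Proof.
move=> mf; split.
  move=> fM; have L : L2 f.
    split=> //; apply/integrableP; split.
      by apply/measurable_EFinP; exact: measurable_funX.
    under eq_integral do rewrite /= ger0_norm ?sqr_ge0//.
    by rewrite (le_lt_trans fM)// ltry.
  split => //; rewrite ip_sqr -lee_fin fineK//.
  exact: integrable_fin_num L.2.
move=> [[_ i2]]; rewrite ip_sqr -lee_fin fineK//.
exact: integrable_fin_num i2.
Qed.

End L2.

Section L2_finite.
Context d (X : measurableType d) (R : realType).
Variable mu : {finite_measure set X -> \bar R}.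
Implicit Types f g h : X -> R.

Lemma L2_cst c : L2 mu (fun=> c).
Proof.
by split=> //; apply: finite_measure_integrable_cst.
Qed.

Lemma L2_bnd M f : measurable_fun setT f -> (forall x, `|f x| <= M) -> L2 mu f.
Proof.
move=> mf fM; have := L2_bndM mf fM (L2_cst 1).
by under eq_fun do rewrite mulr1.
Qed.

Lemma L2_integrable f : L2 mu f -> mu.-integrable setT (EFin \o f).
Proof.
move=> Lf; have := L2_mul Lf (L2_cst 1).
by apply: eq_integrable => // x _ /=; rewrite mulr1.
Qed.

Lemma ip_bnd_le f M : L2 mu f -> (forall x, f x ^+ 2 <= M) ->
  ip mu f f <= M * fine (mu setT).
Proof.
move=> Lf fM; rewrite ip_sqr -Rintegral_cst//; apply: le_Rintegral => //.
- by case: Lf.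
- exact: finite_measure_integrable_cst.
Qed.
End L2_finite.

Section fubini_real.
Context d1 d2 (X : measurableType d1) (Y : measurableType d2) (R : realType).

(** Integrability is not assumed: positive and negative parts have measurable extended integrals by
    Tonelli, and [fine] of their difference is measurable whatever its value. *)
Lemma measurable_Rint (nu : {sigma_finite_measure set Y -> \bar R})
    (f : X * Y -> R) : measurable_fun setT f ->
  measurable_fun setT (fun x => \int[nu]_y f (x, y)).
Proof.
move=> mf; apply: measurableT_comp => //.
have mF : measurable_fun setT (EFin \o f) by exact/measurable_EFinP.
rewrite [X in measurable_fun _ X](_ : _ = (fun x =>
  fubini_F nu ((EFin \o f)^\+)%E x - fubini_F nu ((EFin \o f)^\-)%E x)%E); last first.
  apply/funext => x; rewrite integralE /fubini_F; congr (_ - _)%E;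
  by apply: eq_integral => y _; rewrite ?funeposE ?funenegE.
apply: emeasurable_funB; apply: measurable_fun_fubini_tonelli_F => //.
- exact: measurable_funepos.
- exact: measurable_funeneg.
Qed.

Variables (mu : {sigma_finite_measure set X -> \bar R}).
Variables (nu : {sigma_finite_measure set Y -> \bar R}).
Implicit Types f : X * Y -> R.

Lemma Rfubini12 f : (mu \x nu)%E.-integrable setT (EFin \o f) ->
  \int[(mu \x nu)%E]_z f z = \int[mu]_x \int[nu]_y f (x, y).
Proof.
move=> fi; rewrite /Rintegral -integral12_prod_meas1// ; congr fine.
apply: ae_eq_integral => //.
- by case/integrableP: (integrable_fubini_F fi).
- apply/measurable_EFinP; apply: measurable_Rint.
  by apply/measurable_EFinP; case/integrableP: fi.
- apply: filterS (ae_integrable1 fi) => x ix _ /=.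
  by rewrite fineK//; exact: integrable_fin_num ix.
Qed.

Lemma Rfubini_integrable f : (mu \x nu)%E.-integrable setT (EFin \o f) ->
  mu.-integrable setT (EFin \o (fun x => \int[nu]_y f (x, y))).
Proof.
move=> fi; have /integrableP[mF iF] := integrable_fubini_F fi.
apply/integrableP; split.
  apply/measurable_EFinP; apply: measurable_Rint.
  by apply/measurable_EFinP; case/integrableP: fi.
apply: le_lt_trans iF; rewrite le_eqVlt; apply/orP; left; apply/eqP.
apply: ae_eq_integral => //.
- apply: measurableT_comp => //; apply/measurable_EFinP; apply: measurable_Rint.
  by apply/measurable_EFinP; case/integrableP: fi.
- exact: measurableT_comp.
- apply: filterS (ae_integrable1 fi) => x ix _.
  congr (`|_|)%E; exact: (fineK (integrable_fin_num measurableT ix)).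
Qed.

End fubini_real.

Section fubini_swap.
Context d1 d2 (X : measurableType d1) (Y : measurableType d2) (R : realType).
Variables (mu : {sigma_finite_measure set X -> \bar R}).
Variables (nu : {sigma_finite_measure set Y -> \bar R}).
Implicit Types f : X * Y -> R.

Lemma integrable_swap f : (mu \x nu)%E.-integrable setT (EFin \o f) ->
  (nu \x mu)%E.-integrable setT (EFin \o (fun z => f (z.2, z.1))).
Proof.
move=> fi; have mf : measurable_fun setT (EFin \o f) by case/integrableP: fi.
have ms : measurable_fun setT (EFin \o (fun z : Y * X => f (z.2, z.1))).
  apply: (measurableT_comp mf).
  by apply: measurable_fun_pair; [exact: measurable_snd|exact: measurable_fst].
apply/integrable12ltyP => //.
by move/integrable21ltyP : fi; apply.
Qed.

Lemma Rfubini f : (mu \x nu)%E.-integrable setT (EFin \o f) ->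
  \int[mu]_x \int[nu]_y f (x, y) = \int[nu]_y \int[mu]_x f (x, y).
Proof.
move=> fi; rewrite -Rfubini12//.
transitivity (\int[(nu \x mu)%E]_z f (z.2, z.1)).
  rewrite /Rintegral -integral21_prod_meas1// -integral12_prod_meas1//.
  exact: integrable_swap.
by rewrite Rfubini12//; exact: integrable_swap.
Qed.

Lemma L2_section f : L2 (mu \x nu)%E f ->
  {ae mu, forall x, L2 nu (fun y => f (x, y))}.
Proof.
move=> [mf f2]; apply: filterS (ae_integrable1 f2) => x ix; split=> //.
exact: measurable_fun_pair2.
Qed.

Lemma L2_section2 f : L2 (mu \x nu)%E f ->
  {ae nu, forall y, L2 mu (fun x => f (x, y))}.
Proof.
move=> [mf f2]; apply: filterS (ae_integrable2 f2) => x ix; split=> //.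
exact: measurable_fun_pair1.
Qed.

Lemma L2_prod_le f (g : X -> R) : measurable_fun setT f ->
  (forall x, L2 nu (fun y => f (x, y))) ->
  (forall x, ip nu (fun y => f (x, y)) (fun y => f (x, y)) <= g x) ->
  mu.-integrable setT (EFin \o g) ->
  L2 (mu \x nu)%E f.
Proof.
move=> mf Lf fg gi; split=> //.
have m2 : measurable_fun setT (EFin \o (fun z => f z ^+ 2)).
  by apply/measurable_EFinP; exact: measurable_funX.
apply/integrable12ltyP => //.
have /integrableP[mg ig] := gi; apply: le_lt_trans ig.
apply: ge0_le_integral => //.
- by move=> x _; exact: integral_ge0.
- apply: (@measurable_fun_fubini_tonelli_F _ _ _ _ _ nu
    (fun z => `|(EFin \o (fun z => f z ^+ 2)%R) z|)%E) => //.
  exact: measurableT_comp.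
- exact: measurableT_comp.
- move=> x _; apply: le_trans (_ :
    (ip nu (fun y => f (x, y)) (fun y => f (x, y)))%:E <= _)%E; last first.
    by rewrite lee_fin (le_trans (fg x))// ler_norm.
  rewrite ip_sqr fineK; last exact: integrable_fin_num (Lf x).2.
  rewrite le_eqVlt; apply/orP; left; apply/eqP; apply: eq_integral => y _.
  by rewrite gee0_abs ?lee_fin ?sqr_ge0.
Qed.

End fubini_swap.

Section indicator.
Context (R : realType).

Lemma measurable_ind d (X : measurableType d) (b : X -> bool) :
  measurable_fun setT b -> measurable_fun setT (fun x => ind (b x) : R).
Proof. by move=> mb; rewrite /ind; apply: measurable_fun_ifT. Qed.

Lemma norm_ind (b : bool) : `|ind b : R| <= 1.
Proof. by case: b; rewrite /ind ?normr1 ?normr0. Qed.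

Lemma ind_idem (b : bool) : ind b * ind b = ind b :> R.
Proof. by case: b; rewrite /ind ?mulr1 ?mulr0. Qed.

End indicator.

Section tensor.
Context d1 d2 (X : measurableType d1) (Y : measurableType d2) (R : realType).
Variables (mu : {sigma_finite_measure set X -> \bar R}).
Variables (nu : {sigma_finite_measure set Y -> \bar R}).

Lemma L2_tensor (f : X -> R) (g : Y -> R) : L2 mu f -> L2 nu g ->
  L2 (mu \x nu)%E (fun z => f z.1 * g z.2).
Proof.
move=> Lf Lg; apply: (L2_prod_le (g := fun x => f x ^+ 2 * ip nu g g)).
- apply: measurable_funM.
    exact: (measurableT_comp (L2_measurable Lf) measurable_fst).
  exact: (measurableT_comp (L2_measurable Lg) measurable_snd).
- by move=> x /=; exact: L2Z.
- move=> x /=; rewrite ipZl ?ipZr//; last exact: L2Z.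
  by rewrite mulrA expr2.
- have := integrable_finZ (ip nu g g) Lf.2.
  by apply: eq_integrable => // x _ /=; rewrite mulrC.
Qed.

End tensor.

(** * Kernel operators *)

Section kernel_operators.
Context d (X : measurableType d) (R : realType).
Variable mu : {finite_measure set X -> \bar R}.
Implicit Types (k l : X -> X -> R) (f g : X -> R).

(** The bounds concern every row and every column, so that [Op k f] is defined and bounded at each
    point and transposition preserves the class. *)
Definition kern_le C k :=
  [/\ measurable_fun setT (fun p : X * X => k p.1 p.2),
      forall x, L2 mu (k x) /\ ip mu (k x) (k x) <= C &
      forall y, L2 mu (k^~ y) /\ ip mu (k^~ y) (k^~ y) <= C].

Definition kern k := exists C, kern_le C k.

Definition Op k f : X -> R := fun x => ip mu (k x) f.

Lemma kernT k : kern k -> kern (fun x y => k y x).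
Proof.
case=> C [mk k1 k2]; exists C; split=> //.
apply: (measurableT_comp mk (g := fun p : X * X => (p.2, p.1))).
by apply: measurable_fun_pair; [exact: measurable_snd|exact: measurable_fst].
Qed.

Lemma kern_row k (x : X) : kern k -> L2 mu (k x).
Proof. by case=> C [_ /(_ x)[]]. Qed.

Lemma kern_col k (y : X) : kern k -> L2 mu (k^~ y).
Proof. by case=> C [_ _ /(_ y)[]]. Qed.

Lemma kern_measurable k : kern k -> measurable_fun setT (fun p : X * X => k p.1 p.2).
Proof. by case=> C []. Qed.

Lemma kern_le_ge0 C k (x : X) : kern_le C k -> 0 <= C.
Proof. by move=> [_ /(_ x)[_ h] _]; apply: le_trans h; exact: ip_ge0. Qed.

Lemma kern_bnd M k : measurable_fun setT (fun p : X * X => k p.1 p.2) ->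
  (forall x y, `|k x y| <= M) -> kern k.
Proof.
move=> mk kM; exists (M ^+ 2 * fine (mu setT)).
have k2 x y : k x y ^+ 2 <= M ^+ 2.
  rewrite -real_normK ?num_real// lerXn2r ?nnegrE//.
  by rewrite (le_trans _ (kM x y)).
split=> // [x|y].
- have L : L2 mu (k x) by apply: (@L2_bnd _ _ _ _ M) => //; exact: (measurable_fun_pair2 x mk).
  by split=> //; exact: ip_bnd_le.
- have L : L2 mu (k^~ y) by apply: (@L2_bnd _ _ _ _ M) => //; exact: (measurable_fun_pair1 y mk).
  by split=> //; exact: ip_bnd_le.
Qed.

Lemma ip_sum_le f g : L2 mu f -> L2 mu g ->
  ip mu (fun x => f x + g x) (fun x => f x + g x) <= 2 * ip mu f f + 2 * ip mu g g.
Proof.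
move=> Lf Lg; have LD := L2D Lf Lg.
have LB := L2B Lf Lg; have := ip_ge0 mu (fun x => f x - g x).
rewrite ipBl// !ipBr// ipDl// !ipDr// (ipC mu g f); lra.
Qed.

Lemma kernD k l : kern k -> kern l -> kern (fun x y => k x y + l x y).
Proof.
case=> C1 [mk k1 k2] [C2 [ml l1 l2]]; exists (2 * C1 + 2 * C2); split.
- exact: measurable_funD.
- move=> x; have [Lk hk] := k1 x; have [Ll hl] := l1 x; split; first exact: L2D.
  by apply: (le_trans (ip_sum_le Lk Ll)); lra.
- move=> x; have [Lk hk] := k2 x; have [Ll hl] := l2 x; split; first exact: L2D.
  by apply: (le_trans (ip_sum_le Lk Ll)); lra.
Qed.

Lemma kernM_bnd M (e : X -> X -> R) k :
  measurable_fun setT (fun p : X * X => e p.1 p.2) ->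
  (forall x y, `|e x y| <= M) -> kern k -> kern (fun x y => e x y * k x y).
Proof.
move=> me eM [C [mk k1 k2]]; exists (M ^+ 2 * C).
have e2 x y z : (e x y * z) ^+ 2 <= M ^+ 2 * z ^+ 2.
  rewrite exprMn ler_wpM2r ?sqr_ge0//.
  rewrite -real_normK ?num_real// lerXn2r ?nnegrE//.
  by rewrite (le_trans _ (eM x y)).
split; first exact: measurable_funM.
- move=> x; have [Lk hk] := k1 x.
  have L : L2 mu (fun y => e x y * k x y).
    by apply: (@L2_bndM _ _ _ _ M) => //; exact: (measurable_fun_pair2 x me).
  split=> //; apply: (@le_trans _ _ (M ^+ 2 * ip mu (k x) (k x))); last first.
    by rewrite ler_wpM2l ?sqr_ge0.
  rewrite !ip_sqr -RintegralZl//; last by case: Lk.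
  by apply: le_Rintegral => //; [case: L|apply: integrable_finZ; case: Lk].
- move=> y; have [Lk hk] := k2 y.
  have L : L2 mu (fun x => e x y * k x y).
    by apply: (@L2_bndM _ _ _ _ M) => //; exact: (measurable_fun_pair1 y me).
  split=> //; apply: (@le_trans _ _ (M ^+ 2 * ip mu (k^~ y) (k^~ y))); last first.
    by rewrite ler_wpM2l ?sqr_ge0.
  rewrite !ip_sqr -RintegralZl//; last by case: Lk.
  by apply: le_Rintegral => //; [case: L|apply: integrable_finZ; case: Lk].
Qed.

Lemma kernZ c k : kern k -> kern (fun x y => c * k x y).
Proof. exact: (@kernM_bnd `|c| (fun _ _ => c)). Qed.

Lemma kern_prod k : kern k -> L2 (mu \x mu)%E (fun z => k z.1 z.2).
Proof.
case=> C [mk k1 k2]; apply: (L2_prod_le (g := fun=> C)) => //=.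
- by move=> x; case: (k1 x).
- by move=> x; case: (k1 x).
- exact: finite_measure_integrable_cst.
Qed.

Lemma measurable_ip_row d' (S : measurableType d') k (f : S -> X -> R) :
  measurable_fun setT (fun p : X * X => k p.1 p.2) ->
  measurable_fun setT (fun p : S * X => f p.1 p.2) ->
  measurable_fun setT (fun p : X * S => ip mu (k p.1) (f p.2)).
Proof.
move=> mk mf.
apply: (@measurable_Rint _ _ _ _ _ mu
  (fun z : (X * S) * X => k z.1.1 z.2 * f z.1.2 z.2)).
apply: measurable_funM.
- apply: (measurableT_comp mk (g := fun z : (X * S) * X => (z.1.1, z.2))).
  apply: measurable_fun_pair; last exact: measurable_snd.
  exact: (measurableT_comp measurable_fst measurable_fst).
- apply: (measurableT_comp mf (g := fun z : (X * S) * X => (z.1.2, z.2))).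
  apply: measurable_fun_pair; last exact: measurable_snd.
  exact: (measurableT_comp measurable_snd measurable_fst).
Qed.

Lemma Op_measurable k f : kern k -> measurable_fun setT f ->
  measurable_fun setT (Op k f).
Proof.
move=> kk mf; apply: (@measurable_Rint _ _ _ _ _ mu (fun z => k z.1 z.2 * f z.2)).
apply: measurable_funM; first exact: kern_measurable.
exact: (measurableT_comp mf measurable_snd).
Qed.

Lemma Op_sqr_le C k f (x : X) : kern_le C k -> L2 mu f ->
  Op k f x ^+ 2 <= C * ip mu f f.
Proof.
move=> [_ k1 _] Lf; have [Lk hk] := k1 x.
by apply: (le_trans (cauchy_schwarz Lk Lf)); rewrite ler_wpM2r ?ip_ge0.
Qed.

Lemma L2_Op k f : kern k -> L2 mu f -> L2 mu (Op k f).
Proof.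
move=> kk Lf; have [C kC] := kk.
have m := Op_measurable kk (L2_measurable Lf).
split=> //; apply: (@integrable_fin_le _ _ _ _ _ (fun=> C * ip mu f f)).
- exact: measurable_funX.
- by move=> x; rewrite ger0_norm ?sqr_ge0//; exact: Op_sqr_le.
- exact: finite_measure_integrable_cst.
Qed.

Lemma ip_Op_le C k f : kern_le C k -> L2 mu f ->
  ip mu (Op k f) (Op k f) <= C * ip mu f f * fine (mu setT).
Proof.
move=> kC Lf; apply: ip_bnd_le; first by apply: L2_Op => //; exists C.
by move=> x; exact: Op_sqr_le.
Qed.

(** Fubini applies because [k] and the tensor product of [g] and [f] are both square-integrable on
    the product space. *)
Lemma Op_adj k f g : kern k -> L2 mu f -> L2 mu g ->
  ip mu g (Op k f) = ip mu (Op (fun x y => k y x) g) f.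
Proof.
move=> kk Lf Lg.
have h := L2_mul (kern_prod kk) (L2_tensor Lg Lf).
transitivity (\int[mu]_x \int[mu]_y (k x y * (g x * f y))).
  apply: eq_Rintegral => x _; rewrite /Op /ip -RintegralZl//; last first.
    exact: L2_mul (kern_row x kk) Lf.
  by apply: eq_Rintegral => y _; ring.
rewrite (Rfubini h); apply: eq_Rintegral => y _ /=.
rewrite /Op /ip -RintegralZr//; last exact: L2_mul (kern_col y kk) Lg.
by apply: eq_Rintegral => x _; ring.
Qed.

(** The kernel of [Op k] composed with the transpose of [Op l]. Cauchy-Schwarz between rows makes it
    bounded, and [C1 * C2 + 1] is a bound because [|a| <= a ^+ 2 + 1]. *)
Lemma kern_comp k l : kern k -> kern l -> kern (fun s x => ip mu (k s) (l x)).
Proof.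
move=> kk kl; have [C1 [mk k1 _]] := kk; have [C2 [ml l1 _]] := kl.
apply: (@kern_bnd (C1 * C2 + 1)); first exact: measurable_ip_row.
move=> x y; have [Lk hk] := k1 x; have [Ll hl] := l1 y.
have h : ip mu (k x) (l y) ^+ 2 <= C1 * C2.
  by apply: (le_trans (cauchy_schwarz Lk Ll)); rewrite ler_pM ?ip_ge0.
by rewrite ler_norml; apply/andP; split; nra.
Qed.

End kernel_operators.

(** * Geometric bounds and almost everywhere convergence *)

Section geometric.
Context (R : realType).

Lemma geom_sum_le (q : R) n : 0 <= q < 1 ->
  \sum_(0 <= i < n) q ^+ i <= (1 - q)^-1.
Proof.
move=> /andP[q0 q1]; have d0 : 0 < 1 - q by lra.
rewrite -[leRHS]mul1r ler_pdivlMr// big_mkord.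
have := subrX1 q n; rewrite -opprB -[in X in _ = X](opprB 1 q) mulNr => /oppr_inj.
by rewrite mulrC => <-; rewrite gerBl exprn_ge0.
Qed.

Lemma geom_cauchy (a : nat -> R) (z h : R) : 0 <= z < 1 ->
  (forall n, `|a n.+1 - a n| <= z ^+ n * h) ->
  exists l, (a n @[n --> \oo] --> l) /\
    forall n, `|l - a n| <= z ^+ n * h / (1 - z).
Proof.
move=> /andP[z0 z1] ah.
have h0 : 0 <= h by have := ah 0%N; rewrite expr0 mul1r; apply: le_trans.
have : cvgn (series (telescope a)).
  apply: normed_cvg.
  apply: (@series_le_cvg _ _ (geometric h z)) => [n|n|n|] //=.
  - by rewrite mulr_ge0// exprn_ge0.
  - by rewrite /geometric mulrC; exact: ah.
  - by apply: is_cvg_geometric_series; rewrite ger0_norm.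
move=> ct.
have al : cvgn a.
  rewrite (_ : a = (fun n => a 0%N + series (telescope a) n)); last first.
    by apply/funext => n; exact: eq_sum_telescope.
  by apply: is_cvgD => //; exact: is_cvg_cst.
exists (limn a); split=> // n.
have bnd m : `|a (n + m)%N - a n| <= z ^+ n * h / (1 - z).
  rewrite -(telescope_sumr a (leq_addr m n)).
  apply: (le_trans (ler_norm_sum _ _ _)).
  apply: (@le_trans _ _ (\sum_(n <= k < n + m) z ^+ k * h)).
    exact: ler_sum.
  rewrite -{1}(add0n n) (addnC n m) big_addn addnK.
  under eq_bigr do rewrite exprD -mulrA.
  rewrite -mulr_suml mulrC ler_wpM2l ?mulr_ge0 ?exprn_ge0//.
  by apply: geom_sum_le; rewrite z0.
have cm : (fun m => `|a (n + m)%N - a n|) @ \oo --> `|limn a - a n|.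
  apply: cvg_norm; apply: cvgB; last exact: cvg_cst.
  have := al; rewrite -(cvg_shiftn n).
  by under eq_fun do rewrite addnC.
by apply: (cvgr_to_le cm); apply: nearW.
Qed.

Context d (X : measurableType d).
Variable mu : {measure set X -> \bar R}.

(** A quantitative Borel-Cantelli argument: [H] is the sum of the [dlt k ^+ 2 / z ^+ (2 * k)],
    integrable by a geometric series of ratio [theta / z ^+ 2], and each term is below the sum.
    Mean-square decay thus becomes pointwise decay with an integrable constant. *)
Lemma ae_geom (dlt : nat -> X -> R) (B theta z : R) :
  0 <= theta -> theta < z ^+ 2 -> 0 < z ->
  (forall k, L2 mu (dlt k)) ->
  (forall k, ip mu (dlt k) (dlt k) <= B * theta ^+ k) ->
  exists H : X -> R, [/\ mu.-integrable setT (EFin \o H),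
    forall x, 0 <= H x,
    {ae mu, forall x, forall k, dlt k x ^+ 2 <= (z ^+ k) ^+ 2 * H x} &
    \int[mu]_x H x <= B / (1 - theta / z ^+ 2)].
Proof.
move=> t0 tz z0 Ld db.
have B0 : 0 <= B by have := db 0%N; rewrite expr0 mulr1; apply: le_trans; exact: ip_ge0.
have z2 : 0 < z ^+ 2 by rewrite exprn_gt0.
have q01 : 0 <= theta / z ^+ 2 < 1.
  by rewrite divr_ge0 ?(ltW z2)//= ltr_pdivrMr// mul1r.
pose w k x := (((z ^+ k) ^+ 2)^-1 * dlt k x ^+ 2)%:E.
have mw k : measurable_fun setT (w k).
  apply/measurable_EFinP; apply: measurable_funM => //; apply: measurable_funX.
  by case: (Ld k).
have w0 k x : (0 <= w k x)%E.
  by rewrite lee_fin mulr_ge0 ?invr_ge0 ?sqr_ge0.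
pose HE x := (\sum_(0 <= k <oo) w k x)%E.
have HE0 x : (0 <= HE x)%E by apply: nneseries_ge0.
have mHE : measurable_fun setT HE by apply: ge0_emeasurable_sum.
have iw k : (\int[mu]_x w k x <= (B * (theta / z ^+ 2) ^+ k)%:E)%E.
  rewrite /w; under eq_integral do rewrite EFinM.
  rewrite ge0_integralZl//; last 3 first.
  - by apply/measurable_EFinP; apply: measurable_funX; case: (Ld k).
  - by move=> x _; rewrite lee_fin sqr_ge0.
  - by rewrite lee_fin invr_ge0 sqr_ge0.
  have i2 := integrable_fin_num measurableT (Ld k).2.
  rewrite -(fineK i2) -EFinM lee_fin.
  have -> : fine (\int[mu]_x (EFin \o (fun x => (dlt k x ^+ 2)%R)) x)%E = ip mu (dlt k) (dlt k).
    by rewrite ip_sqr.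
  rewrite mulrC ler_pdivrMr ?exprn_gt0// (le_trans (db k))//.
  rewrite expr_div_n -mulrA [X in _ <= B * X](_ : _ = theta ^+ k)//.
  by rewrite -!exprM mulnC mulfVK// expf_neq0// gt_eqF.
pose K := B / (1 - theta / z ^+ 2).
have iHE : (\int[mu]_x HE x <= K%:E)%E.
  rewrite /HE integral_nneseries//.
  apply: lime_le; first by apply: is_cvg_nneseries => k _ _; exact: integral_ge0.
  apply: nearW => n; apply: (@le_trans _ _ (\sum_(0 <= k < n) (B * (theta / z ^+ 2) ^+ k)%:E)%E).
    exact: lee_sum.
  by rewrite sumEFin lee_fin -mulr_sumr ler_wpM2l// geom_sum_le.
have HEi : mu.-integrable setT HE.
  apply/integrableP; split=> //.
  under eq_integral do rewrite gee0_abs//.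
  by rewrite (le_lt_trans iHE)// ltry.
exists (fine \o HE); split.
- have := HEi; apply: le_integrable => //.
    by apply/measurable_EFinP; apply: measurableT_comp.
  move=> x _ /=; rewrite (gee0_abs (HE0 x)) ger0_norm ?fine_ge0//.
  case: (HE x) (HE0 x) => [r|//|//] _ /=; rewrite ?lexx// leey//.
- by move=> x; rewrite /= fine_ge0.
- have := integrable_ae measurableT HEi; apply: filterS => x /(_ I) fx k /=.
  rewrite mulrC -ler_pdivrMr ?exprn_gt0// mulrC -lee_fin fineK//.
  apply: le_trans (nneseries_lim_ge k.+1 _) => //=.
  by rewrite big_nat_recr//= leeDr// sume_ge0.
- rewrite -lee_fin /Rintegral fineK.
    apply: le_trans iHE; apply: ge0_le_integral => //.
    + by move=> x _; rewrite lee_fin fine_ge0.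
    + by apply/measurable_EFinP; apply: measurableT_comp.
    + move=> x _ /=; case: (HE x) (HE0 x) => [r|//|//] _ /=; rewrite ?lexx// leey//.
  rewrite ge0_fin_numE ?integral_ge0//; last by move=> x _; rewrite lee_fin fine_ge0.
  apply: le_lt_trans (ltry K); apply: le_trans iHE; apply: ge0_le_integral => //.
  + by move=> x _; rewrite lee_fin fine_ge0.
  + by apply/measurable_EFinP; apply: measurableT_comp.
  + move=> x _ /=; case: (HE x) (HE0 x) => [r|//|//] _ /=; rewrite ?lexx// leey//.
Qed.

End geometric.

Section complete.
Context (R : realType) dS (S : measurableType dS) d (X : measurableType d).
Variable mu : {measure set X -> \bar R}.

(** Completeness with a parameter [s]: the limit is taken pointwise rather than among classes of
    functions, which gives joint measurability in [s] and [x], and the rate is uniform in [s]. *)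
Lemma L2_complete (f : nat -> S -> X -> R) (B theta : R) :
  0 <= theta < 1 ->
  (forall n, measurable_fun setT (fun p : S * X => f n p.1 p.2)) ->
  (forall n s, L2 mu (f n s)) ->
  (forall n s, ip mu (fun x => f n.+1 s x - f n s x) (fun x => f n.+1 s x - f n s x)
     <= B * theta ^+ n) ->
  exists (F : S -> X -> R) (K z : R),
   [/\ measurable_fun setT (fun p : S * X => F p.1 p.2),
     0 <= z < 1,
     forall s, L2 mu (F s) &
     forall n s, ip mu (fun x => F s x - f n s x) (fun x => F s x - f n s x)
       <= K * z ^+ n].
Proof.
move=> /andP[t0 t1] mf Lf df.
(* Strictly between the square root of [theta] and 1, since
   [z ^+ 2 - theta = ((1 - theta) / 2) ^+ 2]. *)
pose z := (1 + theta) / 2.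
have z01 : 0 <= z < 1 by rewrite /z; lra.
have zp : 0 < z by rewrite /z; lra.
have tz : theta < z ^+ 2.
  rewrite -subr_gt0 (_ : _ - _ = ((1 - theta) / 2) ^+ 2); last by rewrite /z; field.
  by rewrite exprn_gt0//; lra.
(* An upper limit is measurable whether or not the sequence converges, and equals the limit where it
   does. *)
pose F s x := fine (limn_esup (fun n => (f n s x)%:E)).
pose K := (1 - z)^-1 ^+ 2 * (B / (1 - theta / z ^+ 2)).
have mF : measurable_fun setT (fun p : S * X => F p.1 p.2).
  apply: measurableT_comp => //.
  by apply: measurable_fun_limn_esup => n; exact/measurable_EFinP.
have key s : exists H : X -> R, [/\ mu.-integrable setT (EFin \o H),
    forall x, 0 <= H x,
    {ae mu, forall x, forall n, (F s x - f n s x) ^+ 2 <= (z ^+ n) ^+ 2 * (1 - z)^-1 ^+ 2 * H x} &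
    \int[mu]_x H x <= B / (1 - theta / z ^+ 2)].
  have [H [iH H0 aH IH]] := ae_geom t0 tz zp (fun k => L2B (Lf k.+1 s) (Lf k s))
     (fun k => df k s).
  exists H; split=> //; apply: filterS aH => x hx n.
  have [|l [cl bl]] := @geom_cauchy _ (fun n => f n s x) z (Num.sqrt (H x)) z01.
    move=> k; rewrite -(@ler_pXn2r _ 2)// ?nnegrE// ?mulr_ge0 ?exprn_ge0 ?(ltW zp)//.
    by rewrite real_normK ?num_real// exprMn sqr_sqrtr.
  have -> : F s x = l.
    rewrite /F (_ : limn_esup _ = l%:E)//.
    by apply: (cvg_limn_einf_sup (l := l%:E) _).2; apply/fine_cvgP; split => //; exact: nearW.
  apply: (@le_trans _ _ ((z ^+ n * Num.sqrt (H x) / (1 - z)) ^+ 2)).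
    rewrite -real_normK ?num_real//; apply: lerXn2r (bl n); rewrite ?nnegrE//.
    by rewrite !mulr_ge0 ?exprn_ge0 ?(ltW zp) ?invr_ge0//; lra.
  by rewrite !exprMn sqr_sqrtr// mulrAC.
have LF s : L2 mu (fun x => F s x - f 0%N s x).
  have [H [iH H0 aH IH]] := key s; split.
    by apply: measurable_funB; [exact: (measurable_fun_pair2 s mF)|case: (Lf 0%N s)].
  have m2 : measurable_fun setT (fun x => (F s x - f 0%N s x) ^+ 2).
    apply: measurable_funX; apply: measurable_funB; [exact: (measurable_fun_pair2 s mF)|by case: (Lf 0%N s)].
  have iH2 := integrable_finZ ((1 - z)^-1 ^+ 2) iH.
  apply/integrableP; split; first exact/measurable_EFinP.
  case/integrableP: iH2 => mH2; apply: le_lt_trans.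
  apply: ae_ge0_le_integral => //.
  - by apply: measurableT_comp => //; exact/measurable_EFinP.
  - by apply: measurableT_comp.
  - apply: filterS aH => x /(_ 0%N) h _ /=.
    rewrite lee_fin ger0_norm ?sqr_ge0// (le_trans h)// expr0 expr1n mul1r.
    by rewrite ler_norm.
have LFs s : L2 mu (F s).
  have := L2D (LF s) (Lf 0%N s); congr (L2 _ _).
  by apply/funext => x; rewrite subrK.
exists F, K, (z ^+ 2); split=> //.
  by have [z0 z1] := andP z01; rewrite sqr_ge0/=; nra.
move=> n s; have [H [iH H0 aH IH]] := key s.
have LL := L2B (LFs s) (Lf n s).
apply: (@le_trans _ _ (\int[mu]_x ((z ^+ n) ^+ 2 * (1 - z)^-1 ^+ 2 * H x))).
  have iH2 := integrable_finZ ((z ^+ n) ^+ 2 * (1 - z)^-1 ^+ 2) iH.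
  rewrite ip_sqr -lee_fin /Rintegral !fineK; last 2 first.
  - exact: integrable_fin_num iH2.
  - exact: integrable_fin_num LL.2.
  apply: ae_ge0_le_integral => //.
  - by move=> x _; rewrite lee_fin sqr_ge0.
  - by case/integrableP: LL.2.
  - by move=> x _; rewrite lee_fin; apply: mulr_ge0 => //; rewrite mulr_ge0 ?sqr_ge0.
  - by case/integrableP: iH2.
  - by apply: filterS aH => x /(_ n) h _; rewrite lee_fin.
rewrite RintegralZl// /K [leRHS]mulrC -mulrA -!exprM mulnC ler_wpM2l ?exprn_ge0 ?(ltW zp)//.
by rewrite ler_wpM2l ?sqr_ge0.
Qed.
End complete.

(** * Existence of the resolvent kernel *)

Section resolvent.
Context (R : realType) (mu : {finite_measure set R -> \bar R}).
Variables (kap : R -> R -> R) (lam : R).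
Hypothesis kkap : kern mu kap.
Hypothesis lam0 : 0 < lam.
Hypothesis kap_ge0 : forall f, L2 mu f -> 0 <= ip mu f (Op mu kap f).

Definition Dop (f : R -> R) : R -> R := fun x => 2 * lam * f x + Op mu kap f x.

Lemma L2_Dop f : L2 mu f -> L2 mu (Dop f).
Proof. by move=> Lf; apply: L2D; [exact: L2Z|exact: L2_Op]. Qed.

Lemma DopB f g x : L2 mu f -> L2 mu g ->
  Dop (fun x => f x - g x) x = Dop f x - Dop g x.
Proof.
by move=> Lf Lg; rewrite /Dop /Op ipBr//; [ring|exact: kern_row].
Qed.

Lemma Dop_coercive f : L2 mu f -> 2 * lam * ip mu f f <= ip mu f (Dop f).
Proof.
move=> Lf; have LO := L2_Op kkap Lf.
by rewrite ipDr// ?ipZr// ?lerDl ?kap_ge0//; exact: L2Z.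
Qed.

Lemma Dop_le C f : kern_le mu C kap -> L2 mu f ->
  ip mu (Dop f) (Dop f) <= (8 * lam ^+ 2 + 2 * C * fine (mu setT)) * ip mu f f.
Proof.
move=> kC Lf; have LO := L2_Op kkap Lf; have LZ := L2Z (2 * lam) Lf.
apply: (le_trans (ip_sum_le LZ LO)).
rewrite ipZl// ipZr//; have := ip_Op_le kC Lf.
by move=> h; nra.
Qed.

Lemma L2_ind_le s f : L2 mu f -> L2 mu (fun x => ind (s <= x) * f x).
Proof.
move=> Lf; apply: (@L2_bndM _ _ _ _ 1) => // [|x]; last exact: norm_ind.
by apply: measurable_ind; exact: measurable_fun_ler.
Qed.

Lemma ip_ind_le s f : L2 mu f ->
  ip mu (fun x => ind (s <= x) * f x) (fun x => ind (s <= x) * f x) <= ip mu f f.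
Proof.
move=> Lf; have Li := L2_ind_le s Lf.
rewrite !ip_sqr; apply: le_Rintegral => //; [by case: Li|by case: Lf|].
move=> x _; rewrite /ind; case: ifP => _; rewrite ?mul1r// mul0r expr0n/=.
exact: sqr_ge0.
Qed.

(** A gradient step for the compression of [D] to the half-line [s <= x]. As [f] lives there, the
    cutoff drops out of the cross terms, which coercivity bounds by [- 4 a lam] times the squared
    norm of [f]. *)
Lemma Dop_contraction C s f : kern_le mu C kap -> L2 mu f ->
  (forall x, f x = ind (s <= x) * f x) -> forall a, 0 <= a ->
  let g := fun x => f x - a * (ind (s <= x) * Dop f x) in
  ip mu g g <= (1 - 4 * a * lam
     + a ^+ 2 * (8 * lam ^+ 2 + 2 * C * fine (mu setT))) * ip mu f f.
Proof.
move=> kC Lf fs a a0 /=.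
have LD := L2_Dop Lf; have Li := L2_ind_le s LD; have LZ := L2Z a Li.
rewrite ipBl//; last exact: L2B.
rewrite !ipBr// !ipZl// !ipZr//.
have -> : ip mu (fun x => ind (s <= x) * Dop f x) f = ip mu f (Dop f).
  rewrite ipC; apply: eq_Rintegral => x _.
  by rewrite mulrA (mulrC (f x)) -fs.
have -> : ip mu f (fun x => ind (s <= x) * Dop f x) = ip mu f (Dop f).
  apply: eq_Rintegral => x _; by rewrite mulrA (mulrC (f x)) -fs.
have h1 := Dop_coercive Lf; have h2 := Dop_le kC Lf; have h3 := ip_ind_le s LD.
set L := 8 * lam ^+ 2 + _ in h2 *; nra.
Qed.

End resolvent.

Section resolvent_exists.
Context (R : realType) (mu : {finite_measure set R -> \bar R}).
Variables (kap : R -> R -> R) (lam : R).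
Hypothesis kkap : kern mu kap.
Hypothesis lam0 : 0 < lam.
Hypothesis kap_ge0 : forall f, L2 mu f -> 0 <= ip mu f (Op mu kap f).

Let D := Dop mu kap lam.

(** Gradient iteration from 0 for the equation [D F = kap s] compressed to [s <= x]; the start and
    every correction vanish for [x < s]. *)
Fixpoint richardson (a : R) (n : nat) (s x : R) : R :=
  if n is n'.+1 then
    richardson a n' s x
      - a * (ind (s <= x) * (D (richardson a n' s) x - kap s x))
  else 0.

Lemma measurable_ind_le : measurable_fun setT (fun p : R * R => ind (p.1 <= p.2) : R).
Proof.
apply: measurable_ind; apply: measurable_fun_ler.
  exact: measurable_fst.
exact: measurable_snd.
Qed.

Lemma measurable_Dop_param (f : R -> R -> R) :
  measurable_fun setT (fun p : R * R => f p.1 p.2) ->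
  measurable_fun setT (fun p : R * R => D (f p.1) p.2).
Proof.
move=> mf; apply: measurable_funD; first exact: measurable_funM.
apply: (measurableT_comp (measurable_ip_row mu (kern_measurable kkap) mf)
  (g := fun p : R * R => (p.2, p.1))).
by apply: measurable_fun_pair; [exact: measurable_snd|exact: measurable_fst].
Qed.

Lemma richardson_measurable a n :
  measurable_fun setT (fun p : R * R => richardson a n p.1 p.2).
Proof.
elim: n => [|n ih] //=; apply: measurable_funB => //.
apply: measurable_funM => //; apply: measurable_funM; first exact: measurable_ind_le.
by apply: measurable_funB; [exact: measurable_Dop_param|exact: kern_measurable kkap].
Qed.

Lemma richardson_L2 a n s : L2 mu (richardson a n s).
Proof.
elim: n => [|n ih] /=; first exact: L2_0.
apply: L2B => //; apply: L2Z; apply: L2_ind_le.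
by apply: L2B; [exact: L2_Dop|exact: kern_row].
Qed.

Lemma richardson_supp a n s x : richardson a n s x = ind (s <= x) * richardson a n s x.
Proof.
elim: n => [|n ih] /=; first by rewrite mulr0.
rewrite [in RHS]mulrBr -ih; congr (_ - _).
by rewrite -[in LHS]ind_idem; ring.
Qed.

Lemma richardson_dlt a n s x :
  let dl n x := richardson a n.+1 s x - richardson a n s x in
  dl n.+1 x = dl n x - a * (ind (s <= x) * D (dl n) x).
Proof.
move=> dl; rewrite /dl.
have -> : D (fun x => richardson a n.+1 s x - richardson a n s x) x =
  D (richardson a n.+1 s) x - D (richardson a n s) x.
  by apply: DopB => //; exact: richardson_L2.
have E m : richardson a m.+1 s x = richardson a m s x
  - a * (ind (s <= x) * (D (richardson a m s) x - kap s x)) by [].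
by rewrite (E n.+1) (E n); ring.
Qed.

Lemma resolvent_exists : exists r : R -> R -> R, [/\ kern mu r,
  forall s x, x < s -> r s x = 0 &
  forall s x, s <= x -> 2 * lam * r s x + ip mu (kap x) (r s) = kap s x].
Proof.
have [C kC] := kkap.
have C0 : 0 <= C by have := kern_le_ge0 (0 : R) kC.
have m0 : 0 <= fine (mu setT) by exact: fine_ge0.
pose L := 8 * lam ^+ 2 + 2 * C * fine (mu setT).
have lam2 : 0 < lam ^+ 2 by rewrite exprn_gt0.
have Cm : 0 <= C * fine (mu setT) by rewrite mulr_ge0.
have L0 : 8 * lam ^+ 2 <= L by rewrite /L; lra.
have Lp : 0 < L by lra.
(* The minimizer of [1 - 4 a lam + a ^+ 2 L]. The minimum is [1 - 4 lam ^+ 2 / L], and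
   [8 lam ^+ 2 <= L] keeps it at least 1/2. *)
pose a := 2 * lam / L.
have a0 : 0 < a by rewrite divr_gt0// mulr_gt0.
pose theta := 1 - 4 * a * lam + a ^+ 2 * L.
have thE : theta = 1 - 4 * lam ^+ 2 / L by rewrite /theta /a; field; lra.
have qL : 0 < 4 * lam ^+ 2 / L <= 2^-1.
  by rewrite divr_gt0//= ?ler_pdivrMr//; lra.
have th01 : 0 <= theta < 1 by rewrite thE; lra.
pose f n := richardson a n.
pose dl n s x := f n.+1 s x - f n s x.
have Ld n s : L2 mu (dl n s) by apply: L2B; exact: richardson_L2.
have dsupp n s x : dl n s x = ind (s <= x) * dl n s x.
  by rewrite /dl /f mulrBr -!richardson_supp.
(* Started from 0, the first increment is [a] times the row [kap s] cut to [s <= x]. *)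
pose B := a ^+ 2 * C.
have dB n s : ip mu (dl n s) (dl n s) <= B * theta ^+ n.
  elim: n => [|n ih].
    rewrite expr0 mulr1 /B.
    have -> : ip mu (dl 0%N s) (dl 0%N s) = a ^+ 2 * ip mu
        (fun x => ind (s <= x) * kap s x) (fun x => ind (s <= x) * kap s x).
      have Lk := L2_ind_le s (kern_row s kkap).
      rewrite expr2 -mulrA -ipZr// -ipZl//; last exact: L2Z.
      apply: eq_ip => x; rewrite /dl /f /= /D /Dop /Op ip0r; ring.
    rewrite ler_wpM2l ?sqr_ge0// (le_trans (ip_ind_le s (kern_row s kkap)))//.
    by case: kC => _ /(_ s)[].
  have /= h := Dop_contraction lam kkap kap_ge0 kC (Ld n s) (dsupp n s) (ltW a0).
  have -> : ip mu (dl n.+1 s) (dl n.+1 s) = ip mu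
     (fun x => dl n s x - a * (ind (s <= x) * Dop mu kap lam (dl n s) x))
     (fun x => dl n s x - a * (ind (s <= x) * Dop mu kap lam (dl n s) x)).
    by apply: eq_ip => x; exact: richardson_dlt.
  apply: (le_trans h); rewrite -/L -/theta exprS mulrCA ler_wpM2l//.
  by case/andP: th01.
have [F [K [z [mF z01 LF FK]]]] := L2_complete th01
  (fun n => richardson_measurable a n) (fun n s => richardson_L2 a n s) dB.
have FK0 s : ip mu (F s) (F s) <= K.
  have := FK 0%N s; rewrite expr0 mulr1; apply: le_trans.
  by rewrite le_eqVlt; apply/orP; left; apply/eqP; apply: eq_ip => x; rewrite subr0.
pose res s x := ind (s <= x) * (D (F s) x - kap s x).
have Lres s : L2 mu (res s).
  by apply: L2_ind_le; apply: L2B; [exact: L2_Dop|exact: kern_row].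
have res0 s : ip mu (res s) (res s) = 0.
  apply/eqP; rewrite eq_le ip_ge0 andbT.
  (* The residual of [F] is the cut [D (F - f n)] plus the residual of [f n], and the latter is
     [- dl n / a] by the recursion. Both decay geometrically. *)
  have bound n : ip mu (res s) (res s) <= 2 * L * K * z ^+ n + 2 * a^-1 ^+ 2 * B * theta ^+ n.
    have E1 x : res s x = ind (s <= x) * D (fun y => F s y - f n s y) x + (- a^-1) * dl n s x.
      have -> : D (fun y => F s y - f n s y) x = D (F s) x - D (f n s) x.
        by apply: DopB => //; exact: richardson_L2.
      have -> : dl n s x = - (a * (ind (s <= x) * (D (f n s) x - kap s x))).
        by rewrite /dl /f /=; ring.
      by rewrite /res; field; rewrite gt_eqF.
    have LFn : L2 mu (fun y => F s y - f n s y) by apply: L2B => //; exact: richardson_L2.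
    have LDF : L2 mu (D (fun y => F s y - f n s y)) by exact: L2_Dop.
    rewrite (eq_ip mu E1 E1).
    apply: (le_trans (ip_sum_le (L2_ind_le s LDF) (L2Z (- a^-1) (Ld n s)))).
    rewrite ipZl// ?ipZr//; last exact: L2Z.
    have h1 := ip_ind_le s LDF; have h2 := Dop_le lam kkap kC LFn; rewrite -/L in h2.
    have h3 := FK n s; have h4 := dB n s.
    rewrite [X in _ + X <= _](_ : _ = 2 * a^-1 ^+ 2 * ip mu (dl n s) (dl n s)); last ring.
    apply: lerD.
      rewrite -!mulrA ler_wpM2l//; apply: (le_trans h1); apply: (le_trans h2).
      by rewrite ler_wpM2l// ltW.
    by rewrite -[leRHS]mulrA; apply: ler_wpM2l => //; rewrite mulr_ge0 ?sqr_ge0.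
  have cv : (fun n => 2 * L * K * z ^+ n + 2 * a^-1 ^+ 2 * B * theta ^+ n) @ \oo --> (0 : R).
    rewrite -[X in _ --> X]addr0; apply: cvgD.
      rewrite -[X in _ --> X](mulr0 (2 * L * K)); apply: cvgMr; apply: cvg_expr.
      by rewrite ger0_norm; case/andP: z01.
    rewrite -[X in _ --> X](mulr0 (2 * a^-1 ^+ 2 * B)); apply: cvgMr; apply: cvg_expr.
    by rewrite ger0_norm; case/andP: th01.
  by apply: (cvgr_to_ge cv); apply: nearW => n; exact: bound.
(* The equation is solved once more for its first term, with [F s] inserted in the integral: [r s]
   agrees with [F s] almost everywhere, and since the integral does not see null sets, [r] solves
   the equation at every [x >= s]. Its rows and columns are then bounded at every point as well. *)
pose r s x := ind (s <= x) * ((2 * lam)^-1 * (kap s x - ip mu (kap x) (F s))).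
pose F' s x := ind (s <= x) * F s x.
have mipF : measurable_fun setT (fun p : R * R => ip mu (kap p.2) (F p.1)).
  apply: (measurableT_comp (measurable_ip_row mu (kern_measurable kkap) mF)
    (g := fun p : R * R => (p.2, p.1))).
  by apply: measurable_fun_pair; [exact: measurable_snd|exact: measurable_fst].
have kr : kern mu r.
  have h := @kernM_bnd _ R R mu 1 (fun s x => ind (s <= x))
    (fun s x => (2 * lam)^-1 * (kap s x - ip mu (kap x) (F s))).
  apply: h.
  - exact: measurable_ind_le.
  - by move=> ? ?; exact: norm_ind.
  apply: kernZ; apply: kernD => //.
  apply: (@kern_bnd _ _ _ _ (C * K + 1)).
    exact: measurableT_comp.
  move=> s x; rewrite normrN.
  have h : ip mu (kap x) (F s) ^+ 2 <= C * K.
    apply: (le_trans (Op_sqr_le x kC (LF s))).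
    by rewrite ler_wpM2l.
  by rewrite ler_norml; apply/andP; split; nra.
exists r; split=> //.
  by move=> s x xs; rewrite /r leNgt xs /ind mul0r.
have Fsupp s : {ae mu, forall x, F s x = ind (s <= x) * F s x}.
  pose G x := F s x - ind (s <= x) * F s x.
  have LG : L2 mu G by apply: L2B => //; exact: L2_ind_le.
  suff : ip mu G G = 0.
    by move/(ip_ae0 LG); apply: filterS => x /eqP; rewrite subr_eq0 => /eqP.
  apply/eqP; rewrite eq_le ip_ge0 andbT.
  have bound n : ip mu G G <= K * z ^+ n.
    have LFn : L2 mu (fun y => F s y - f n s y) by apply: L2B => //; exact: richardson_L2.
    apply: le_trans (FK n s); rewrite !ip_sqr; apply: le_Rintegral => //.
    - by case: LG.
    - by case: LFn.
    - move=> x _; rewrite /G (richardson_supp a n s x).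
      rewrite /ind; case: ifP => _; last by rewrite !mul0r.
      by rewrite !mul1r subrr expr0n/= sqr_ge0.
  have cv : (fun n => K * z ^+ n) @ \oo --> (0 : R).
    rewrite -[X in _ --> X](mulr0 K); apply: cvgMr; apply: cvg_expr.
    by rewrite ger0_norm; case/andP: z01.
  by apply: (cvgr_to_ge cv); apply: nearW => n; exact: bound.
have rF s : {ae mu, forall x, r s x = F s x}.
  have := ip_ae0 (Lres s) (res0 s); apply: filterS2 (Fsupp s) => x -> h.
  move: h; rewrite /res /r /D /Dop /Op /ind; case: ifP => _; rewrite ?mul0r// !mul1r => h.
  have -> : kap s x - ip mu (kap x) (F s) = 2 * lam * F s x by lra.
  by rewrite mulKf// mulf_neq0// gt_eqF.
move=> s x sx; rewrite ipC (@ip_ae _ _ _ _ _ (F s)).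
- rewrite ipC /r sx /ind mul1r mulVKf ?subrK//.
  by rewrite mulf_neq0// gt_eqF.
- exact: L2_measurable (kern_row s kr).
- exact: L2_measurable (LF s).
- exact: L2_measurable (kern_row x kkap).
- exact: rF.
Qed.

End resolvent_exists.

(** * Triangular factorization *)

Section factorization.
Context (R : realType) (mu : {finite_measure set R -> \bar R}).
Variables (kap r : R -> R -> R) (lam : R).
Hypothesis kkap : kern mu kap.
Hypothesis kap_sym : forall x y, kap x y = kap y x.
Hypothesis lam0 : 0 < lam.
Hypothesis kap_ge0 : forall f, L2 mu f -> 0 <= ip mu f (Op mu kap f).
Hypothesis mu1 : forall x : R, mu [set x] = 0%E.
Hypothesis weight : forall K : R, 0 < K -> exists (w : R -> R) (M : R),
  [/\ measurable_fun setT w, forall x, 0 < w x <= M &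
      forall x, K * ip mu (fun s => ind (s <= x)) w <= w x].
Hypothesis kr : kern mu r.
Hypothesis r_supp : forall s x, x < s -> r s x = 0.
Hypothesis r_eq : forall s x, s <= x ->
  2 * lam * r s x + ip mu (kap x) (r s) = kap s x.

Let D := Dop mu kap lam.

(* [r s] solves [D_s (r s) = kap s] on [[s, T]], so that [A = id - r] and its adjoint
   diagonalize [D]: [A D A^* = 2 lam]. *)
Definition Aop (f : R -> R) : R -> R := fun s => f s - ip mu (r s) f.
Definition Aadj (v : R -> R) : R -> R := fun x => v x - ip mu (r^~ x) v.
(** The kernel of [D A^* - 2 lam]. The resolvent equation says exactly that it vanishes for
    [s <= x]. *)
Definition Xk (x s : R) : R := kap x s - 2 * lam * r s x - ip mu (r s) (kap x).

Lemma L2_Aop f : L2 mu f -> L2 mu (Aop f).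
Proof. by move=> Lf; apply: L2B => //; exact: (L2_Op kr Lf). Qed.

Lemma L2_Aadj f : L2 mu f -> L2 mu (Aadj f).
Proof. by move=> Lf; apply: L2B => //; exact: (L2_Op (kernT kr) Lf). Qed.

Lemma AopB f g s : L2 mu f -> L2 mu g ->
  Aop (fun x => f x - g x) s = Aop f s - Aop g s.
Proof. by move=> Lf Lg; rewrite /Aop ipBr//; [ring|exact: kern_row]. Qed.

Lemma AopD f g s : L2 mu f -> L2 mu g ->
  Aop (fun x => f x + g x) s = Aop f s + Aop g s.
Proof. by move=> Lf Lg; rewrite /Aop ipDr//; [ring|exact: kern_row]. Qed.

Lemma AopZ c f s : L2 mu f -> Aop (fun x => c * f x) s = c * Aop f s.
Proof. by move=> Lf; rewrite /Aop ipZr//; [ring|exact: kern_row]. Qed.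

Lemma Aadj_ip f g : L2 mu f -> L2 mu g -> ip mu g (Aadj f) = ip mu (Aop g) f.
Proof.
move=> Lf Lg; have LO := L2_Op kr Lg; have LT := L2_Op (kernT kr) Lf.
by rewrite /Aadj ipBr// /Aop ipBl//; congr (_ - _); exact: (Op_adj (kernT kr)).
Qed.

Lemma kern_Xk : kern mu Xk.
Proof.
apply: kernD; first apply: kernD => //.
  have := kernZ (- (2 * lam)) (kernT kr).
  by under eq_fun => x do under eq_fun => y do rewrite mulNr.
have := kernZ (- 1) (kern_comp kkap kr).
by under eq_fun => x do under eq_fun => y do rewrite mulN1r ipC.
Qed.

Lemma Xk_causal x s : s <= x -> Xk x s = 0.
Proof. by move=> sx; rewrite /Xk kap_sym -(r_eq sx) (ipC mu (r s)); ring. Qed.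

Lemma Dop_Aadj v x : L2 mu v -> D (Aadj v) x = 2 * lam * v x + ip mu (Xk x) v.
Proof.
move=> Lv; rewrite /D /Dop /Aadj.
have Lk := kern_row x kkap; have Lr := kern_col x kr.
have LT := L2_Op (kernT kr) Lv; have LO := L2_Op kr Lk.
rewrite [Op mu kap _ x]/Op ipBr//.
have -> : ip mu (kap x) (fun y => ip mu (r^~ y) v) = ip mu (Op mu r (kap x)) v.
  exact: (Op_adj (kernT kr)).
rewrite /Xk ipBl// ?ipBl// ?ipZl//; [by rewrite /Op; ring|exact: L2Z..|].
by apply: L2B => //; exact: L2Z.
Qed.

(** By the symmetry of [kap] this is the adjoint of [Dop_Aadj]: the same kernel, transposed. *)
Lemma Aop_Dop f s : L2 mu f -> Aop (D f) s = 2 * lam * f s + ip mu (Xk^~ s) f.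
Proof.
move=> Lf; rewrite /D /Aop.
have Lk := kern_row s kkap; have Lr := kern_row s kr.
have LO := L2_Op kkap Lf; have LOr := L2_Op kkap Lr.
rewrite {2}/Dop ipDr//; last exact: L2Z.
rewrite ipZr// (Op_adj kkap)//.
have -> : ip mu (Xk^~ s) f =
   ip mu (fun x => kap s x - 2 * lam * r s x - Op mu kap (r s) x) f.
  by apply: eq_ip => // x; rewrite /Xk kap_sym (ipC mu (r s)).
have -> : ip mu (Op mu (fun x y => kap y x) (r s)) f = ip mu (Op mu kap (r s)) f.
  apply: eq_ip => // x; rewrite /Op; apply: eq_ip => // y; exact: kap_sym.
rewrite ipBl// ?ipBl// ?ipZl//; [by rewrite /Dop /Op; ring|exact: L2Z..|].
by apply: L2B => //; exact: L2Z.
Qed.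

Lemma ip_r_Xk0 s z : z < s -> ip mu (r s) (Xk^~ z) = 0.
Proof.
move=> zs; rewrite /ip (@eq_Rintegral _ _ _ _ _ (fun=> 0)).
  by rewrite Rintegral_cst// mul0r.
move=> x _; have [xs|sx] := ltP x s; first by rewrite r_supp// mul0r.
by rewrite Xk_causal ?mulr0// ltW// (lt_le_trans zs).
Qed.

Lemma ip_r_XkE z s : ip mu (r z) (Xk^~ s) =
  ip mu (r z) (kap s) - 2 * lam * ip mu (r z) (r s) - ip mu (r z) (Op mu kap (r s)).
Proof.
have -> : ip mu (r z) (Xk^~ s) =
   ip mu (r z) (fun x => kap s x - 2 * lam * r s x - Op mu kap (r s) x).
  by apply: eq_ip => // x; rewrite /Xk kap_sym (ipC mu (r s)).
have Lk := kern_row s kkap; have Lr := kern_row s kr; have Lz := kern_row z kr.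
have LOr := L2_Op kkap Lr.
rewrite ipBr// ?ipBr// ?ipZr//; first exact: L2Z.
by apply: L2B => //; exact: L2Z.
Qed.

(* Both [A D] and [D A^*] are triangular, in opposite senses; on the overlap
   the resolvent equation cancels the kernel of [A D A^*]. *)
Lemma ADA_kernel s z : z != s ->
  Xk z s - 2 * lam * r z s - ip mu (r z) (Xk^~ s) = 0.
Proof.
rewrite neq_lt => /orP[zs|sz]; last first.
  by rewrite Xk_causal ?(ltW sz)// (r_supp sz) ip_r_Xk0// mulr0 !subr0.
have h0 := Xk_causal (ltW zs); have h1 := ip_r_Xk0 zs.
move: h0 h1; rewrite !ip_r_XkE /Xk (r_supp zs) (kap_sym z s) mulr0 subr0.
rewrite (ipC mu (r z) (r s)).
have -> : ip mu (r s) (Op mu kap (r z)) = ip mu (r z) (Op mu kap (r s)).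
  rewrite (Op_adj kkap); [|exact: kern_row|exact: kern_row].
  rewrite ipC.
  apply: eq_ip => // x; apply: eq_ip => // y; exact: kap_sym.
lra.
Qed.

(** At a given [s], the kernel of [A D A^* - 2 lam] vanishes at every [z != s] by [ADA_kernel], and
    the remaining point is negligible by [mu1]. *)
Lemma Aop_Dop_Aadj v s : L2 mu v -> Aop (D (Aadj v)) s = 2 * lam * v s.
Proof.
move=> Lv; rewrite Aop_Dop; last exact: L2_Aadj.
have LX := kern_col s kern_Xk; have Lr := kern_col s kr.
have LT := L2_Op (kernT kr) Lv; have LO := L2_Op kr LX.
rewrite {2}/Aadj ipBr//.
have -> : ip mu (Xk^~ s) (fun y => ip mu (r^~ y) v) = ip mu (Op mu r (Xk^~ s)) v.
  exact: (Op_adj (kernT kr)).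
have LXr := L2B LX (L2Z (2 * lam) Lr).
have E : ip mu (fun z => Xk z s - 2 * lam * r z s - Op mu r (Xk^~ s) z) v = 0.
  rewrite (@ip_ae _ _ _ _ _ (fun=> 0)) ?ip0l//.
  - exact: (L2_measurable (L2B LXr LO)).
  - exact: L2_measurable Lv.
  - exists [set s]; split; [exact: measurable_set1|exact: mu1|move=> z /= zs]; apply: contrapT => /eqP zs'; apply: zs.
    exact: ADA_kernel.
move: E; rewrite ipBl// ipBl//; last exact: L2Z.
rewrite ipZl// /Aadj; lra.
Qed.

(** A Gronwall argument with an exponential-type weight. As [r s] lives on [s <= x], Cauchy-Schwarz
    bounds [h s ^+ 2] by [C] times the integral of [h ^+ 2] over [x >= s]. Integrated against [w],
    and with the order of integration exchanged, this gives [I <= C * W] and [(2 * C + 1) * W <= I]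
    for the same [W], hence [I = 0]. Vanishing almost everywhere becomes vanishing everywhere
    through the equation for [h]. *)
Lemma volterra_inj h : L2 mu h -> (forall s, h s = ip mu (r s) h) ->
  forall s, h s = 0.
Proof.
move=> Lh hr; have [C kC] := kr.
have C0 : 0 <= C by exact: (kern_le_ge0 (0 : R) kC).
suff h0 : ip mu h h = 0.
  move=> s; rewrite hr ipC (@ip_ae _ _ _ _ _ (fun=> 0)) ?ip0l//.
  - exact: L2_measurable Lh.
  - exact: L2_measurable (kern_row s kr).
  - exact: ip_ae0.
have K0 : 0 < 2 * C + 1 by lra.
have [w [M [mw wM wK]]] := weight K0.
have h2b s : h s ^+ 2 <= C * ip mu h h.
  by rewrite (hr s); exact: Op_sqr_le kC Lh.
have mh := L2_measurable Lh.
have Lh2 : L2 mu (fun s => h s ^+ 2).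
  apply: (@L2_bnd _ _ _ _ (C * ip mu h h)); first exact: measurable_funX.
  by move=> s; rewrite ger0_norm ?sqr_ge0.
have Lw : L2 mu w.
  apply: (@L2_bnd _ _ _ _ M) => // s; have /andP[w0 wm] := wM s.
  by rewrite gtr0_norm.
have ke : kern mu (fun s x : R => ind (s <= x) : R).
  apply: (@kern_bnd _ _ _ _ 1); first exact: measurable_ind_le.
  by move=> ? ?; exact: norm_ind.
pose e := (fun s x : R => ind (s <= x) : R).
have hs s : h s ^+ 2 <= C * Op mu e (fun s => h s ^+ 2) s.
  rewrite hr.
  have -> : ip mu (r s) h = ip mu (r s) (fun x => ind (s <= x) * h x).
    apply: eq_Rintegral => x _; rewrite /ind; case: ltP => [xs|_].
      by rewrite r_supp// !mul0r.
    by rewrite mul1r.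
  have Li := L2_ind_le s Lh.
  apply: (le_trans (cauchy_schwarz (kern_row s kr) Li)).
  have -> : Op mu e (fun s => h s ^+ 2) s =
    ip mu (fun x => ind (s <= x) * h x) (fun x => ind (s <= x) * h x).
    by apply: eq_Rintegral => x _; rewrite /e -[in LHS]ind_idem; ring.
  by rewrite ler_wpM2r ?ip_ge0//; case: kC => _ /(_ s)[].
pose I := ip mu w (fun s => h s ^+ 2).
have LOe := L2_Op ke Lh2.
have I0 : I <= C * ip mu w (Op mu e (fun s => h s ^+ 2)).
  rewrite -ipZr//; apply: le_Rintegral => //.
  - exact: L2_mul.
  - by apply: L2_mul => //; exact: L2Z.
  - by move=> x _; rewrite ler_wpM2l//; have /andP[/ltW] := wM x.
have LOt := L2_Op (kernT ke) Lw.
have I1 : (2 * C + 1) * ip mu w (Op mu e (fun s => h s ^+ 2)) <= I.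
  rewrite (Op_adj ke)// -ipZl//; apply: le_Rintegral => //.
  - by apply: L2_mul => //; exact: L2Z.
  - exact: L2_mul.
  - by move=> x _; rewrite ler_wpM2r ?sqr_ge0//; exact: wK.
have I2 : 0 <= I.
  by apply: Rintegral_ge0 => x _; rewrite mulr_ge0 ?sqr_ge0//; have /andP[/ltW] := wM x.
have I3 : I = 0 by nra.
(* [I] is the squared norm of [v], and positivity of [w] transfers the vanishing of [v] to [h]. *)
pose v s := Num.sqrt (w s) * h s.
have Lv : L2 mu v.
  apply: (@L2_bndM _ _ _ _ (Num.sqrt M)) => //.
    exact: (measurableT_comp (continuous_measurable_fun (@sqrt_continuous R)) mw).
  move=> x; rewrite ger0_norm ?sqrtr_ge0// ler_wsqrtr//.
  by have /andP[] := wM x.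
have v0 : ip mu v v = 0.
  rewrite -I3; apply: eq_Rintegral => x _; rewrite /v mulrACA -expr2 sqr_sqrtr//.
  by have /andP[/ltW] := wM x.
have aeh : {ae mu, forall x, h x = 0}.
  apply: filterS (ip_ae0 Lv v0) => x /eqP; rewrite mulf_eq0 => /orP[|/eqP//].
  by rewrite sqrtr_eq0 leNgt; have /andP[->] := wM x.
by rewrite (@ip_ae _ _ _ _ _ (fun=> 0)) ?ip0l.
Qed.

(** [A] sends the defect [D A^* A f - 2 lam f] to 0 because [A D A^* = 2 lam], and [volterra_inj] is
    the injectivity of [A]. The factors are thus reordered without inverting [A]. *)
Lemma Dop_Aadj_Aop f x : L2 mu f -> D (Aadj (Aop f)) x = 2 * lam * f x.
Proof.
move=> Lf; have LA := L2_Aop Lf.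
pose h x := D (Aadj (Aop f)) x - 2 * lam * f x.
have LD : L2 mu (D (Aadj (Aop f))) by apply: L2_Dop => //; exact: L2_Aadj.
have Lz := L2Z (2 * lam) Lf.
have Lh : L2 mu h by exact: L2B.
suff /(_ x) : forall x, h x = 0 by move=> /eqP; rewrite subr_eq0 => /eqP.
apply: volterra_inj => // s.
have := AopB s LD Lz; rewrite Aop_Dop_Aadj// AopZ// subrr => /eqP.
by rewrite subr_eq0 => /eqP.
Qed.

Definition Dinv t f : R -> R :=
  fun x => (2 * lam)^-1 * Aadj (fun s => ind (t <= s) * Aop f s) x.

Lemma L2_Dinv t f : L2 mu f -> L2 mu (Dinv t f).
Proof. by move=> Lf; apply: L2Z; apply: L2_Aadj; apply: L2_ind_le; exact: L2_Aop. Qed.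

Lemma Dinv_supp t f x : x < t -> Dinv t f x = 0.
Proof.
move=> xt; rewrite /Dinv /Aadj leNgt xt /= mul0r sub0r /ip.
rewrite (@eq_Rintegral _ _ _ _ _ (fun=> 0)).
  by rewrite Rintegral_cst// mul0r oppr0 mulr0.
move=> s _; have [xs|sx] := ltP x s; first by rewrite r_supp// mul0r.
by rewrite leNgt (le_lt_trans sx xt) /= mul0r mulr0.
Qed.

(** The row [Xk x] lives on [s > x], so for [x >= t] the operator [D A^*] does not notice the cutoff
    at [t]. This is why a single factorization inverts all the compressions of [D]. *)
Lemma Dop_Dinv t f x : L2 mu f -> t <= x -> D (Dinv t f) x = f x.
Proof.
move=> Lf tx; have LA := L2_Aop Lf; have Li := L2_ind_le t LA.
have l2 : 2 * lam != 0 by rewrite mulf_neq0// gt_eqF.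
have -> : D (Dinv t f) x =
    (2 * lam)^-1 * D (Aadj (fun s => ind (t <= s) * Aop f s)) x.
  rewrite /D /Dop /Op /Dinv ipZr//; [ring|exact: L2_Aadj|exact: kern_row].
rewrite Dop_Aadj// tx /= mul1r.
rewrite (_ : ip mu (Xk x) _ = ip mu (Xk x) (Aop f)); last first.
  apply: eq_Rintegral => s _; have [xs|sx] := ltP s t.
    by rewrite /= mul0r Xk_causal ?mul0r// ltW// (lt_le_trans xs).
  by rewrite mul1r.
by rewrite -Dop_Aadj// Dop_Aadj_Aop// mulrA mulVf// mul1r.
Qed.

Lemma ip_Dinv t f g : L2 mu f -> L2 mu g ->
  ip mu g (Dinv t f) = (2 * lam)^-1 * ip mu (Aop g) (fun s => ind (t <= s) * Aop f s).
Proof.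
move=> Lf Lg; have LA := L2_Aop Lf; have Li := L2_ind_le t LA.
by rewrite /Dinv ipZr ?Aadj_ip//; exact: L2_Aadj.
Qed.

(** The difference [h] of two solutions vanishes left of [t] and [D h] vanishes right of it; hence
    [ip mu h (D h) = 0], and coercivity concludes. *)
Lemma Dinv_unique t f p : L2 mu f -> L2 mu p ->
  {ae mu, forall x, x < t -> p x = 0} ->
  {ae mu, forall x, t <= x -> D p x = f x} ->
  {ae mu, forall x, p x = Dinv t f x}.
Proof.
move=> Lf Lp p0 pf; pose h x := p x - Dinv t f x.
have LD := L2_Dinv t Lf; have Lh : L2 mu h by exact: L2B.
suff : ip mu h h = 0.
  by move=> /(ip_ae0 Lh); apply: filterS => x /eqP; rewrite subr_eq0 => /eqP.
have hD0 : ip mu h (D h) = 0.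
  rewrite -(ip0l mu (fun=> 0)); apply: ae_Rintegral.
  - apply: measurable_funM; first exact: L2_measurable Lh.
    exact: (L2_measurable (L2_Dop lam kkap Lh)).
  - exact: measurable_funM.
  - apply: filterS2 p0 pf => x h1 h2; rewrite mul0r.
    have [xt|tx] := ltP x t; first by rewrite /h (h1 xt) Dinv_supp// subrr mul0r.
    by rewrite /h /D DopB// -/D (h2 tx) Dop_Dinv// subrr mulr0.
have := Dop_coercive lam kkap kap_ge0 Lh; rewrite -/D hD0 pmulr_rle0 ?mulr_gt0// => h0.
by apply/eqP; rewrite eq_le h0 ip_ge0.
Qed.

End factorization.

(** * Restriction of a measure to a sub-sigma-algebra *)

Section sub_measure.
Context d (Omega : measurableType d) (R : realType) (G : set (set Omega)).
Hypothesis GM : <<s G>> `<=` measurable.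

Lemma measurable_to_sub : measurable_fun setT (id : Omega -> g_sigma_algebraType G).
Proof. by move=> _ B mB; rewrite setTI; exact: GM. Qed.

Lemma measurable_from_sub d' (Y : measurableType d') (f : Omega -> Y) :
  measurable_fun setT (f : g_sigma_algebraType G -> Y) -> measurable_fun setT f.
Proof. by move=> mf; exact: (measurableT_comp mf measurable_to_sub). Qed.

Variable m : {finite_measure set Omega -> \bar R}.

(** The inclusion is carried as an argument so that the measure instances declared below can recover
    it from the term [subm GM]. *)
Definition subm (_ : <<s G>> `<=` measurable) : set (g_sigma_algebraType G) -> \bar R := m.

Let subm0 : subm GM set0 = 0%E. Proof. exact: measure0. Qed.
Let subm_ge0 A : (0 <= subm GM A)%E. Proof. exact: measure_ge0. Qed.
Let subm_sigma_additive : semi_sigma_additive (subm GM).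
Proof.
move=> F mF tF mUF; apply: (measure_semi_sigma_additive (s := m)) => //.
- by move=> i; exact: GM (mF i).
- exact: GM mUF.
Qed.
HB.instance Definition _ := isMeasure.Build _ _ _ (subm GM)
  subm0 subm_ge0 subm_sigma_additive.

Let subm_fin : fin_num_fun (subm GM).
Proof. by move=> A mA; apply: fin_num_measure; exact: GM. Qed.

HB.instance Definition _ := Measure_isFinite.Build _ _ _ (subm GM) subm_fin.

Lemma integral_subm (A : set Omega) (f : Omega -> \bar R) :
  measurable (A : set (g_sigma_algebraType G)) ->
  measurable_fun setT (f : g_sigma_algebraType G -> \bar R) ->
  m.-integrable A f ->
  (\int[subm GM]_(x in A) f x = \int[m]_(x in A) f x)%E.
Proof.
move=> mA mf fi; exact: (integral_pushforward measurable_to_sub mf fi mA).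
Qed.

Lemma integrable_subm (f : Omega -> \bar R) :
  (subm GM).-integrable setT f -> m.-integrable setT f.
Proof.
move=> /integrableP[mf fi]; have mf' := measurable_from_sub mf.
apply/integrableP; split=> //; apply: le_lt_trans fi.
rewrite -(preimage_setT (id : Omega -> g_sigma_algebraType G)).
rewrite -(@ge0_integral_pushforward _ _ _ _ _ _ measurable_to_sub m setT
  (fun x => `|f x|)%E)//.
exact: measurableT_comp.
Qed.

End sub_measure.

Section ae_Rintegral.
Context d (X : measurableType d) (R : realType) (mu : {measure set X -> \bar R}).
Implicit Types f g : X -> R.

Lemma ae_le_Rintegral f g : mu.-integrable setT (EFin \o f) ->
  mu.-integrable setT (EFin \o g) -> {ae mu, forall x, f x <= g x} ->
  \int[mu]_x f x <= \int[mu]_x g x.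
Proof.
move=> fi gi fg.
have mf : measurable_fun setT f by case/integrableP: fi => /measurable_EFinP.
have mg : measurable_fun setT g by case/integrableP: gi => /measurable_EFinP.
pose h x := Num.min (f x) (g x).
have mh : measurable_fun setT h by exact: measurable_minr.
have hi : mu.-integrable setT (EFin \o h).
  apply: (integrable_fin_le mh _
    (integrable_finD (integrable_norm fi) (integrable_norm gi))).
  by move=> x; rewrite /h minEle; case: ifP => _ /=; rewrite (lerDl, lerDr) normr_ge0.
rewrite (ae_Rintegral mf mh).
  by apply: le_Rintegral => // x _; rewrite /h ge_min lexx orbT.
by apply: filterS fg => x xfg; rewrite /h min_l.
Qed.

Lemma Rintegral_le0_ae0 f : mu.-integrable setT (EFin \o f) ->
  (forall x, 0 <= f x) -> \int[mu]_x f x <= 0 -> {ae mu, forall x, f x = 0}.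
Proof.
move=> fi f0 If.
have mf : measurable_fun setT (EFin \o f) by case/integrableP: fi.
have h : (\int[mu]_x `|(EFin \o f) x| = 0)%E.
  rewrite (eq_integral (EFin \o f)); last by move=> x _ /=; rewrite ger0_norm.
  have /fineK <- := integrable_fin_num measurableT fi.
  by congr EFin; apply/eqP; rewrite eq_le If; exact: Rintegral_ge0.
move/(ae_eq_integral_abs mu measurableT mf) : h.
by apply: filterS => x /(_ I) /= [].
Qed.

End ae_Rintegral.

(** * Conditional expectation *)

Section conditional_expectation.
Context (R : realType) d (Omega : measurableType d) (Pr : probability Omega R).
Variable G : set (set Omega).
Hypothesis sG : sigma_algebra setT G.
Hypothesis GM : G `<=` measurable.

Lemma sub_sigma_measurable : <<s G>> `<=` (measurable : set (set Omega)).
Proof. by rewrite sigma_algebra_id. Qed.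

Lemma sub_measurableE (A : set Omega) :
  measurable (A : set (g_sigma_algebraType G)) <-> G A.
Proof. by rewrite /measurable/= sigma_algebra_id. Qed.

Lemma sub_measurable_funP (Y : Omega -> R) :
  (forall B : set R, measurable B -> G (Y @^-1` B)) <->
  measurable_fun setT (Y : g_sigma_algebraType G -> R).
Proof.
split=> [h _ B mB|h B mB]; first by rewrite setTI; apply/sub_measurableE; exact: h.
by apply/sub_measurableE; rewrite -[X in _ X]setTI; exact: h.
Qed.

Lemma sub_measurable_fun (Y : Omega -> R) :
  measurable_fun setT (Y : g_sigma_algebraType G -> R) -> measurable_fun setT Y.
Proof. exact: (measurable_from_sub sub_sigma_measurable). Qed.

Lemma integral_ind_itv (z : R) : 0 <= z ->
  (\int[@lebesgue_measure R]_c (ind ((0 <= c) && (c <= z)))%:E = z%:E)%E.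
Proof.
move=> z0; have -> : (fun c : R => (ind ((0 <= c) && (c <= z)))%:E) =
    (fun c => (\1_(`[0, z]%classic : set R) c)%:E) :> (R -> \bar R).
  apply/funext => c; rewrite indicE /ind; congr EFin.
  case: ifP => h.
    by rewrite mem_set//= in_itv/= h.
  by rewrite memNset//= in_itv/= h.
rewrite integral_indic//= setIT lebesgue_measure_itv/= lte_fin.
by case: ltP => [|z0']; rewrite ?sube0//; congr EFin; apply/eqP; rewrite eq_le z0.
Qed.

Lemma integrable_layer (X Z : Omega -> R) : measurable_fun setT X ->
  measurable_fun setT Z -> (forall w, 0 <= Z w) ->
  Pr.-integrable setT (EFin \o (fun w => X w * Z w)) ->
  (Pr \x @lebesgue_measure R)%E.-integrable setT
    (EFin \o (fun p : Omega * R => X p.1 * ind ((0 <= p.2) && (p.2 <= Z p.1)))).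
Proof.
move=> mX mZ Z0 XZ; apply/integrable12ltyP.
  apply/measurable_EFinP; apply: measurable_funM.
    exact: (measurableT_comp mX measurable_fst).
  apply: measurable_ind; apply: measurable_and; apply: measurable_fun_ler => //.
  exact: (measurableT_comp mZ measurable_fst).
case/integrableP: XZ => _; apply: le_lt_trans.
rewrite le_eqVlt; apply/orP; left; apply/eqP; apply: eq_integral => w _ /=.
transitivity (\int[@lebesgue_measure R]_c
    ((`|X w|)%:E * (ind ((0 <= c) && (c <= Z w)))%:E))%E; last first.
  rewrite ge0_integralZl//.
  - by rewrite integral_ind_itv// -EFinM normrM (ger0_norm (Z0 w)).
  - apply/measurable_EFinP; apply: measurable_ind; apply: measurable_and => //;
      exact: measurable_fun_ler.
  - by move=> c _; rewrite lee_fin /ind; case: ifP.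
apply: eq_integral => c _; rewrite -EFinM normrM; congr (_ * _)%:E.
by rewrite ger0_norm// /ind; case: ifP.
Qed.

(** Layer-cake formula: [Z w] is the integral over [c] of the indicator of [0 <= c <= Z w], and each
    set [c <= Z] lies in [G]. Fubini reduces the test against [Z] to the defining property on these
    sets. *)
Lemma condexp_test_ge0 (X Y Z : Omega -> R) : is_condexp Pr G X Y ->
  measurable_fun setT (Z : g_sigma_algebraType G -> R) ->
  (forall w, 0 <= Z w) ->
  Pr.-integrable setT (EFin \o (fun w => X w * Z w)) ->
  Pr.-integrable setT (EFin \o (fun w => Y w * Z w)) ->
  \int[Pr]_w (X w * Z w) = \int[Pr]_w (Y w * Z w).
Proof.
move=> [iX [mY [iY XY]]] mZG Z0 iXZ iYZ.
have mZ := sub_measurable_fun mZG.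
have layer (U : Omega -> R) : Pr.-integrable setT (EFin \o U) ->
    Pr.-integrable setT (EFin \o (fun w => U w * Z w)) ->
    \int[Pr]_w (U w * Z w) = \int[@lebesgue_measure R]_c
      \int[Pr]_w (U w * ind ((0 <= c) && (c <= Z w))).
  move=> iU iUZ; have mU : measurable_fun setT U by case/integrableP: iU => /measurable_EFinP.
  rewrite -(Rfubini (integrable_layer mU mZ Z0 iUZ)); apply: eq_Rintegral => w _ /=.
  rewrite RintegralZl//.
    by rewrite /Rintegral integral_ind_itv.
  apply/integrableP; split.
    apply/measurable_EFinP; apply: measurable_ind; apply: measurable_and => //;
      exact: measurable_fun_ler.
  apply: le_lt_trans (ltry (Z w)); rewrite -(integral_ind_itv (Z0 w)).
  rewrite le_eqVlt; apply/orP; left; apply/eqP; apply: eq_integral => c _ /=.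
  by rewrite ger0_norm// /ind; case: ifP.
rewrite !layer//; apply: eq_Rintegral => c _.
have [c0|c0] := boolP (0 <= c); last first.
  by apply: eq_Rintegral => w _; rewrite !mulr0.
pose A := [set w | c <= Z w].
have GA : G A.
  apply/sub_measurableE; have := mZG measurableT `[c, +oo[%classic (measurable_itv _).
  by rewrite setTI; congr measurable; apply/seteqP; split => w /=; rewrite in_itv/= andbT.
have toA (U : Omega -> R) : \int[Pr]_w (U w * ind (true && (c <= Z w))) =
    fine (\int[Pr]_(w in A) (U w)%:E)%E.
  rewrite -[RHS]/(Rintegral Pr A U) [RHS]Rintegral_mkcond; apply: eq_Rintegral => w _.
  rewrite patchE; case: ifPn => [/set_mem /= ->|/negP wA]; rewrite /= ?mulr1//.
  by rewrite (_ : (c <= Z w) = false) ?mulr0//; apply/negP => h; apply: wA; exact/mem_set.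
by rewrite !toA XY.
Qed.

Lemma condexp_test (X Y Z : Omega -> R) : is_condexp Pr G X Y ->
  measurable_fun setT (Z : g_sigma_algebraType G -> R) ->
  Pr.-integrable setT (EFin \o (fun w => X w * Z w)) ->
  Pr.-integrable setT (EFin \o (fun w => Y w * Z w)) ->
  \int[Pr]_w (X w * Z w) = \int[Pr]_w (Y w * Z w).
Proof.
move=> XY mZG iXZ iYZ; have mZ := sub_measurable_fun mZG.
have [/integrableP[/measurable_EFinP mX _] [mY [/integrableP[/measurable_EFinP mY' _] _]]] := XY.
pose Zp w := Num.max (Z w) 0; pose Zn w := Num.max (- Z w) 0.
have mZp : measurable_fun setT (Zp : g_sigma_algebraType G -> R).
  exact: measurable_maxr.
have mZn : measurable_fun setT (Zn : g_sigma_algebraType G -> R).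
  by apply: measurable_maxr => //; exact: measurableT_comp.
have ZE w : Z w = Zp w - Zn w.
  by rewrite /Zp /Zn; case: (leP (Z w) 0) => h; case: (leP (- Z w) 0) => h'; lra.
have Zb w : 0 <= Zp w <= `|Z w| /\ 0 <= Zn w <= `|Z w|.
  rewrite /Zp /Zn !le_max !ge_max lexx !orbT normr_ge0 ler_norm.
  by have := ler_norm (- Z w); rewrite normrN => ->.
have bnd (U V : Omega -> R) : measurable_fun setT U -> measurable_fun setT V ->
    (forall w, 0 <= V w <= `|Z w|) ->
    Pr.-integrable setT (EFin \o (fun w => U w * Z w)) ->
    Pr.-integrable setT (EFin \o (fun w => U w * V w)).
  move=> mU mV Vb iU; have iU' := integrable_norm iU.
  apply: (integrable_fin_le _ _ (g := fun w => `|U w * Z w|)) => //.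
    exact: measurable_funM.
  by move=> w; have /andP[V0 VZ] := Vb w; rewrite !normrM ler_wpM2l// ger0_norm.
have mp := sub_measurable_fun mZp; have mn := sub_measurable_fun mZn.
have Zbp w := (Zb w).1; have Zbn w := (Zb w).2.
have split_int (U : Omega -> R) : measurable_fun setT U ->
  Pr.-integrable setT (EFin \o (fun w => U w * Z w)) ->
  \int[Pr]_w (U w * Z w) = \int[Pr]_w (U w * Zp w) - \int[Pr]_w (U w * Zn w).
  move=> mU iU; rewrite -RintegralB//; [|exact: bnd..].
  by apply: eq_Rintegral => w _; rewrite -mulrBr -ZE.
rewrite !split_int//; congr (_ - _); apply: condexp_test_ge0 => //;
  [|exact: bnd|exact: bnd| |exact: bnd|exact: bnd].
- by move=> w; case/andP: (Zbp w).
- by move=> w; case/andP: (Zbn w).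
Qed.

End conditional_expectation.

Section condexp_theory.
Context (R : realType) d (Omega : measurableType d) (Pr : probability Omega R).
Variable G : set (set Omega).
Hypothesis sG : sigma_algebra setT G.
Hypothesis GM : G `<=` measurable.
Implicit Types X Y Z : Omega -> R.

Lemma condexp_sub X Y : is_condexp Pr G X Y ->
  measurable_fun setT (Y : g_sigma_algebraType G -> R).
Proof. by move=> [_ [/(sub_measurable_funP sG) ? _]]. Qed.

Lemma condexp_intX X Y : is_condexp Pr G X Y -> Pr.-integrable setT (EFin \o X).
Proof. by case. Qed.

Lemma condexp_intY X Y : is_condexp Pr G X Y -> Pr.-integrable setT (EFin \o Y).
Proof. by move=> [_ [_ []]]. Qed.

Lemma integrable_measurable X : Pr.-integrable setT (EFin \o X) -> measurable_fun setT X.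
Proof. by case/integrableP => /measurable_EFinP. Qed.

Lemma integrableM_bnd X Z M : Pr.-integrable setT (EFin \o X) ->
  measurable_fun setT Z -> (forall w, `|Z w| <= M) ->
  Pr.-integrable setT (EFin \o (fun w => X w * Z w)).
Proof.
move=> iX mZ ZM.
apply: (integrable_fin_le _ _ (g := fun w => M * `|X w|)).
- by apply: measurable_funM => //; exact: integrable_measurable.
- by move=> w; rewrite normrM mulrC ler_wpM2r.
- by apply: integrable_finZ; exact: integrable_norm.
Qed.

Lemma condexp_testb X Y Z M : is_condexp Pr G X Y ->
  measurable_fun setT (Z : g_sigma_algebraType G -> R) ->
  (forall w, `|Z w| <= M) ->
  \int[Pr]_w (X w * Z w) = \int[Pr]_w (Y w * Z w).
Proof.
move=> XY mZ ZM; have mZ' := sub_measurable_fun sG GM mZ.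
apply: (condexp_test sG GM XY mZ).
- exact: integrableM_bnd (condexp_intX XY) mZ' ZM.
- exact: integrableM_bnd (condexp_intY XY) mZ' ZM.
Qed.

Lemma sub_measurable_indic (A : set Omega) : G A ->
  measurable_fun setT (\1_A : g_sigma_algebraType G -> R).
Proof. by move=> GA; apply: measurable_indic; apply/(sub_measurableE sG). Qed.

Lemma indic_norm (A : set Omega) w : `|\1_A w : R| <= 1.
Proof. by rewrite indicE; case: (_ \in _); rewrite ?normr1 ?normr0. Qed.

Lemma Rintegral_indic_mul X (A : set Omega) :
  \int[Pr]_(w in A) X w = \int[Pr]_w (X w * \1_A w).
Proof.
rewrite Rintegral_mkcond; apply: eq_Rintegral => w _; rewrite patchE indicE.
by case: ifP => _; rewrite ?mulr1 ?mulr0.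
Qed.

Lemma condexp_intro X Y : Pr.-integrable setT (EFin \o X) ->
  measurable_fun setT (Y : g_sigma_algebraType G -> R) ->
  Pr.-integrable setT (EFin \o Y) ->
  (forall A, G A -> \int[Pr]_w (Y w * \1_A w) = \int[Pr]_w (X w * \1_A w)) ->
  is_condexp Pr G X Y.
Proof.
move=> iX mY iY XY; split=> //; split; first exact/(sub_measurable_funP sG).
split=> // A GA; have mA := GM GA.
have fA U : Pr.-integrable setT (EFin \o U) -> (\int[Pr]_(w in A) (U w)%:E)%E \is a fin_num.
  by move=> iU; apply: integrable_fin_num => //; exact: integrableS iU.
rewrite -[LHS](fineK (fA _ iY)) -[RHS](fineK (fA _ iX)); congr EFin.
by rewrite -[LHS]/(Rintegral Pr A Y) -[RHS]/(Rintegral Pr A X) (Rintegral_indic_mul Y A) (Rintegral_indic_mul X A) XY.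
Qed.

Lemma condexp_indicM X Y A : is_condexp Pr G X Y -> G A ->
  \int[Pr]_w (X w * \1_A w) = \int[Pr]_w (Y w * \1_A w).
Proof.
move=> XY GA; apply: (condexp_testb XY); first exact: sub_measurable_indic.
exact: indic_norm.
Qed.

(** The event [Y' < Y] belongs to [G]. Tested on its indicator, the nonnegative variable [f] has the
    same integral as [X - X'] times that indicator, which is at most 0. *)
Lemma condexp_le X Y X' Y' : is_condexp Pr G X Y -> is_condexp Pr G X' Y' ->
  {ae Pr, forall w, X w <= X' w} -> {ae Pr, forall w, Y w <= Y' w}.
Proof.
move=> XY XY' XX'.
pose b w := Y' w < Y w.
have mb : measurable_fun setT (fun w : g_sigma_algebraType G => ind (b w) : R).
  apply: measurable_ind; apply: measurable_fun_ltr.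
    exact: condexp_sub XY'.
  exact: condexp_sub XY.
have nb w : `|ind (b w) : R| <= 1 by exact: norm_ind.
have mb' := sub_measurable_fun sG GM mb.
have b0 w : 0 <= ind (b w) :> R by rewrite /ind; case: ifP.
pose f w := (Y w - Y' w) * ind (b w).
have f0 w : 0 <= f w.
  by rewrite /f /ind /b; case: ltP => h; rewrite ?mulr0 ?mulr1// subr_ge0 ltW.
have iYb := integrableM_bnd (condexp_intY XY) mb' nb.
have iYb' := integrableM_bnd (condexp_intY XY') mb' nb.
have iXb := integrableM_bnd (condexp_intX XY) mb' nb.
have iXb' := integrableM_bnd (condexp_intX XY') mb' nb.
have fi : Pr.-integrable setT (EFin \o f).
  have := integrable_finB iYb iYb'; apply: eq_integrable => // w _ /=.
  by rewrite /f mulrBl.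
have If : \int[Pr]_w f w = \int[Pr]_w (X w * ind (b w)) - \int[Pr]_w (X' w * ind (b w)).
  rewrite (condexp_testb XY mb nb) (condexp_testb XY' mb nb) -RintegralB//.
  by apply: eq_Rintegral => w _; rewrite /f mulrBl.
have If0 : \int[Pr]_w f w <= 0.
  rewrite If subr_le0; apply: ae_le_Rintegral => //.
  by apply: filterS XX' => w h; rewrite ler_wpM2r.
apply: filterS (Rintegral_le0_ae0 fi f0 If0) => w; rewrite /f /ind /b.
by case: ltP => // h /eqP; rewrite mulr1 subr_eq0 => /eqP e; move: h; rewrite e ltxx.
Qed.

Lemma condexp_unique X Y Y' : is_condexp Pr G X Y -> is_condexp Pr G X Y' ->
  {ae Pr, forall w, Y w = Y' w}.
Proof.
move=> XY XY'.
have h1 : {ae Pr, forall w, Y w <= Y' w} by apply: (condexp_le XY XY'); exact: nearW.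
have h2 : {ae Pr, forall w, Y' w <= Y w} by apply: (condexp_le XY' XY); exact: nearW.
by apply: filterS2 h1 h2 => w h1 h2; apply/eqP; rewrite eq_le h1.
Qed.

Lemma ae_integrable X X' : Pr.-integrable setT (EFin \o X) -> measurable_fun setT X' ->
  {ae Pr, forall w, X w = X' w} -> Pr.-integrable setT (EFin \o X').
Proof.
move=> iX mX' XX'; have mX := integrable_measurable iX.
apply/integrableP; split; first exact/measurable_EFinP.
case/integrableP: iX => _; congr (_ < _)%E; apply: ae_eq_integral => //=.
- by apply/measurable_EFinP; exact: measurableT_comp.
- by apply/measurable_EFinP; exact: measurableT_comp.
- by apply: filterS XX' => w -> _.
Qed.

Lemma condexp_ae X X' Y Y' : is_condexp Pr G X Y -> measurable_fun setT X' ->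
  measurable_fun setT (Y' : g_sigma_algebraType G -> R) ->
  {ae Pr, forall w, X w = X' w} -> {ae Pr, forall w, Y w = Y' w} ->
  is_condexp Pr G X' Y'.
Proof.
move=> XY mX' mY' XX' YY'; have mY2 := sub_measurable_fun sG GM mY'.
have iX := condexp_intX XY; have iY := condexp_intY XY.
apply: condexp_intro => //; [exact: ae_integrable XX'|exact: ae_integrable YY'|].
move=> A GA; have mA : measurable_fun setT (\1_A : Omega -> R) by exact: measurable_indic (GM GA).
transitivity (\int[Pr]_w (Y w * \1_A w)).
  apply: ae_Rintegral; [exact: measurable_funM| |].
    by apply: measurable_funM => //; exact: integrable_measurable.
  by apply: filterS YY' => w ->.
rewrite -(condexp_indicM XY GA); apply: ae_Rintegral.
- by apply: measurable_funM => //; exact: integrable_measurable.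
- exact: measurable_funM.
- by apply: filterS XX' => w ->.
Qed.

Lemma condexpD X Y X' Y' : is_condexp Pr G X Y -> is_condexp Pr G X' Y' ->
  is_condexp Pr G (fun w => X w + X' w) (fun w => Y w + Y' w).
Proof.
move=> XY XY'; have iX := condexp_intX XY; have iY := condexp_intY XY.
have iX' := condexp_intX XY'; have iY' := condexp_intY XY'.
apply: condexp_intro; [exact: integrable_finD| |exact: integrable_finD|].
  by apply: measurable_funD; [exact: condexp_sub XY|exact: condexp_sub XY'].
move=> A GA; have mA : measurable_fun setT (\1_A : Omega -> R) by exact: measurable_indic (GM GA).
have iA U : Pr.-integrable setT (EFin \o U) ->
   Pr.-integrable setT (EFin \o (fun w => U w * \1_A w)).
  by move=> iU; apply: (integrableM_bnd iU mA (M := 1)); exact: indic_norm.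
under eq_Rintegral do rewrite mulrDl.
under [RHS]eq_Rintegral do rewrite mulrDl.
by rewrite !RintegralD//; [rewrite (condexp_indicM XY GA) (condexp_indicM XY' GA)|exact: iA..].
Qed.

Lemma condexpZ c X Y : is_condexp Pr G X Y ->
  is_condexp Pr G (fun w => c * X w) (fun w => c * Y w).
Proof.
move=> XY; have iX := condexp_intX XY; have iY := condexp_intY XY.
apply: condexp_intro; [exact: integrable_finZ| |exact: integrable_finZ|].
  by apply: measurable_funM => //; exact: condexp_sub XY.
move=> A GA; have mA : measurable_fun setT (\1_A : Omega -> R) by exact: measurable_indic (GM GA).
have iA U : Pr.-integrable setT (EFin \o U) ->
   Pr.-integrable setT (EFin \o (fun w => U w * \1_A w)).
  by move=> iU; apply: (integrableM_bnd iU mA (M := 1)); exact: indic_norm.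
under eq_Rintegral do rewrite -mulrA.
under [RHS]eq_Rintegral do rewrite -mulrA.
by rewrite !RintegralZl//; [rewrite (condexp_indicM XY GA)|exact: iA..].
Qed.

Lemma condexpB X Y X' Y' : is_condexp Pr G X Y -> is_condexp Pr G X' Y' ->
  is_condexp Pr G (fun w => X w - X' w) (fun w => Y w - Y' w).
Proof.
move=> XY /(condexpZ (-1)) XY'; have := condexpD XY XY'.
by under eq_fun do rewrite mulN1r; under [X in is_condexp _ _ _ X]eq_fun do rewrite mulN1r.
Qed.

Lemma condexp_self X : measurable_fun setT (X : g_sigma_algebraType G -> R) ->
  Pr.-integrable setT (EFin \o X) -> is_condexp Pr G X X.
Proof. by move=> mX iX; exact: condexp_intro. Qed.

(** The truncation [Z n] of [Y] is a bounded test function, and [ip Pr (Z n) (Z n) = ip Pr X (Z n)];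
    expanding the squared norm of [X - Z n] bounds the norm of [Z n] by that of [X]. Monotone
    convergence removes the truncation. *)
Lemma condexp_L2 X Y : is_condexp Pr G X Y -> L2 Pr X ->
  L2 Pr Y /\ ip Pr Y Y <= ip Pr X X.
Proof.
move=> XY LX; have mY := condexp_sub XY; have mY' := sub_measurable_fun sG GM mY.
pose b n w := `|Y w| <= n%:R.
pose Z n w := Y w * ind (b n w).
have mZ n : measurable_fun setT (Z n : g_sigma_algebraType G -> R).
  apply: measurable_funM => //; apply: measurable_ind; apply: measurable_fun_ler => //.
  exact: measurableT_comp.
have Zb n w : `|Z n w| <= n%:R.
  by rewrite /Z /ind /b; case: ifP => h; rewrite ?mulr1// mulr0 normr0.
have LZ n : L2 Pr (Z n).
  by apply: L2_bnd (Zb n); exact: sub_measurable_fun (mZ n).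
have Zle n : ip Pr (Z n) (Z n) <= ip Pr X X.
  have E1 : ip Pr (Z n) (Z n) = ip Pr X (Z n).
    rewrite [RHS](condexp_testb XY (mZ n) (Zb n)); apply: eq_Rintegral => w _.
    by rewrite /Z /ind; case: ifP => _; rewrite ?mulr1 ?mulr0.
  have := ip_ge0 Pr (fun w => X w - Z n w).
  have LB := L2B LX (LZ n).
  rewrite ipBl// !ipBr// (ipC Pr (Z n) X) -E1; lra.
apply/L2_norm_leP => //.
have -> : (\int[Pr]_w ((Y w ^+ 2)%R)%:E)%E =
    (\int[Pr]_w limn (fun n => ((Z n w ^+ 2)%R)%:E))%E.
  apply: eq_integral => w _; apply/esym/cvg_lim => //.
  apply: cvg_near_cst; near=> n; rewrite /Z /ind /b ifT ?mulr1//.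
  by near: n; exact: nbhs_infty_ger.
rewrite monotone_convergence//.
- apply: lime_le.
    apply: ereal_nondecreasing_is_cvgn => m n mn; apply: ge0_le_integral => //.
    + by move=> w _; rewrite lee_fin sqr_ge0.
    + by apply/measurable_EFinP; apply: measurable_funX; exact: L2_measurable (LZ m).
    + by apply/measurable_EFinP; apply: measurable_funX; exact: L2_measurable (LZ n).
    + move=> w _; rewrite lee_fin /Z /ind /b; case: ifP => h.
        by rewrite ifT// (le_trans h)// ler_nat.
      by rewrite mulr0 expr0n/= sqr_ge0.
  apply: nearW => n; apply/(L2_norm_leP _ _ _).2 => //.
  by exact: L2_measurable (LZ n).
- by move=> n; apply/measurable_EFinP; apply: measurable_funX; exact: L2_measurable (LZ n).
- by move=> n w _; rewrite lee_fin sqr_ge0.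
- move=> w _ m n mn; rewrite lee_fin /Z /ind /b; case: ifP => h.
    by rewrite ifT// (le_trans h)// ler_nat.
  by rewrite mulr0 expr0n/= sqr_ge0.
Unshelve. all: by end_near. Qed.

End condexp_theory.

Section condexp_existence.
Context (R : realType) d (Omega : measurableType d) (Pr : probability Omega R).
Variable G : set (set Omega).
Hypothesis sG : sigma_algebra setT G.
Hypothesis GM : G `<=` measurable.
Implicit Types X Y Z : Omega -> R.

(** The conditional probability is the Radon-Nikodym derivative, on [G], of the measure restricted
    to [A] with respect to [Pr]. *)
Lemma condexp_indic (A : set Omega) : measurable A -> exists Y,
  is_condexp Pr G (\1_A) Y /\ forall w, 0 <= Y w <= 1.
Proof.
move=> mA; have GMs := sub_sigma_measurable sG GM.
have fA : (Pr A < +oo)%E by rewrite (le_lt_trans (probability_le1 Pr mA)) ?ltry.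
pose nu := subm (mfrestr mA fA) GMs.
pose P' := subm Pr GMs.
have dom : nu `<< P'.
  apply/null_content_dominatesP => B mB PB0.
  rewrite /nu /subm /mfrestr /mrestr/=; apply/eqP; rewrite -measure_le0.
  have mB' : d.-measurable B by exact: (GMs _ mB).
  rewrite -[leRHS]PB0; apply: le_measure; rewrite ?inE//.
  exact: measurableI.
have [f [f0 ff fi fE]] := radon_nikodym_sigma_finite dom.
have iA : Pr.-integrable setT (EFin \o (\1_A : Omega -> R)).
  by apply: integrable_indic.
pose Y : Omega -> R := fun w => fine (f w).
have EY : EFin \o Y = f by apply/funext => w; rewrite /= fineK//; exact: ff.
have mY : measurable_fun setT (Y : g_sigma_algebraType G -> R).
  by apply: measurableT_comp => //; case/integrableP : fi.
have iY : Pr.-integrable setT (EFin \o Y).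
  by rewrite EY; exact: (integrable_subm (GM := GMs)) fi.
have XY : is_condexp Pr G (\1_A) Y.
  split=> //; split; first exact/(sub_measurable_funP sG).
  split=> // B GB.
  have mB : measurable (B : set (g_sigma_algebraType G)) by apply/(sub_measurableE sG).
  rewrite integral_indic//; last exact: GM.
  have E1 : Pr (B `&` A) = (\int[P']_(x in B) f x)%E by exact: fE _ mB.
  transitivity (\int[P']_(x in B) f x)%E; last first.
    by rewrite (setIC A B); exact/esym/E1.
  rewrite -[LHS]/(\int[Pr]_(w in B) (EFin \o Y) w)%E EY.
  apply/esym; apply: integral_subm => //; first by case/integrableP : fi.
  rewrite -EY; apply: (integrableS measurableT) => //; exact: GM.
have Yae0 : {ae Pr, forall w, 0 <= Y w}.
  have c0 : is_condexp Pr G (fun=> 0) (fun=> 0).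
    by apply: condexp_self => //; exact: finite_measure_integrable_cst.
  by apply: (condexp_le sG GM c0 XY); apply: nearW => w; rewrite indicE ler0n.
have Yae1 : {ae Pr, forall w, Y w <= 1}.
  have c1 : is_condexp Pr G (fun=> 1) (fun=> 1).
    by apply: condexp_self => //; exact: finite_measure_integrable_cst.
  apply: (condexp_le sG GM XY c1); apply: nearW => w; rewrite indicE.
  by case: (_ \in _).
have Yae : {ae Pr, forall w, Y w = Num.min 1 (Num.max 0 (Y w))}.
  by apply: filterS2 Yae0 Yae1 => w h0 h1; rewrite max_r// min_r.
(* The bounds hold almost surely for [Y]; the truncation makes them hold at every outcome. *)
exists (fun w => Num.min 1 (Num.max 0 (Y w))); split; last first.
  move=> w; rewrite le_min ler01 le_max lexx ge_min lexx//.
apply: (condexp_ae sG GM XY) => //.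
- by apply: measurable_minr => //; exact: measurable_maxr.
- exact: nearW.
Qed.

(** The version of the limit is prescribed by a formula in the [Y_ n]. Used for each time [s] with
    versions jointly measurable in [s], it yields a jointly measurable version again. *)
Lemma condexp_monotone (X_ Y_ : nat -> Omega -> R) X :
  (forall n w, 0 <= X_ n w) ->
  (forall w, {homo (X_^~ w) : n m / (n <= m)%N >-> n <= m}) ->
  (forall w, X_ n w @[n --> \oo] --> X w) ->
  Pr.-integrable setT (EFin \o X) ->
  (forall n, is_condexp Pr G (X_ n) (Y_ n)) ->
  is_condexp Pr G X (fun w => fine (limn_esup (fun n => (Y_ n w)%:E))).
Proof.
move=> X0 Xnd Xcv iX XY.
(* Running maxima are nonnegative and nondecreasing at every outcome, and coincide almost surely
   with the [Y_ n], for which monotonicity is only almost sure. *)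
pose Ym := fix Ym n w := if n is m.+1 then Num.max (Ym m w) (Y_ n w)
  else Num.max 0 (Y_ 0%N w).
have Ym0 n w : 0 <= Ym n w.
  by elim: n => [|n ih] /=; rewrite le_max ?lexx// ih.
have Ymnd w : {homo (Ym^~ w) : n m / (n <= m)%N >-> n <= m}.
  by apply: homo_leq => //= [x y z|n]; [exact: le_trans|rewrite le_max lexx].
have mYn n : measurable_fun setT (Y_ n : g_sigma_algebraType G -> R).
  exact: condexp_sub (XY n).
have mYm n : measurable_fun setT (Ym n).
  apply: (sub_measurable_fun sG GM).
  by elim: n => [|n ih] /=; exact: measurable_maxr.
have ae1 : {ae Pr, forall w, forall n, Ym n w = Y_ n w}.
  have h0 : {ae Pr, forall w, 0 <= Y_ 0%N w}.
    have c0 : is_condexp Pr G (fun=> 0) (fun=> 0).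
      by apply: condexp_self => //; exact: finite_measure_integrable_cst.
    by apply: (condexp_le sG GM c0 (XY 0%N)); exact: nearW.
  have hn : {ae Pr, forall w, forall n, Y_ n w <= Y_ n.+1 w}.
    apply: ae_foralln => n; apply: (condexp_le sG GM (XY n) (XY n.+1)).
    by apply: nearW => w; exact: Xnd.
  apply: filterS2 h0 hn => w h0 hn; elim=> [|n ih] /=; first exact: max_r.
  by rewrite ih max_r.
pose YE w := limn (fun n => (Ym n w)%:E).
have YEcv w : (Ym n w)%:E @[n --> \oo] --> YE w.
  by apply: ereal_nondecreasing_is_cvgn => n m nm; rewrite lee_fin; exact: Ymnd.
have YE0 w : (0 <= YE w)%E.
  by apply: lime_ge; [exact: YEcv|apply: nearW => n; rewrite lee_fin].
have mYE : measurable_fun setT YE.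
  apply: (emeasurable_fun_cvg (fun n w => (Ym n w)%:E)) => // n.
  exact/measurable_EFinP.
have mX_ n : measurable_fun setT (X_ n) by exact: integrable_measurable (condexp_intX (XY n)).
have IYE A : G A -> (\int[Pr]_(w in A) YE w = \int[Pr]_(w in A) (X w)%:E)%E.
  move=> GA; have mA := GM GA.
  rewrite monotone_convergence//; first last.
  - by move=> w _ n m nm; rewrite lee_fin; exact: Ymnd.
  - by move=> n w _; rewrite lee_fin.
  - by move=> n; apply/measurable_EFinP; exact: measurable_funS (mYm n).
  transitivity (limn (fun n => \int[Pr]_(w in A) (X_ n w)%:E))%E.
    congr (limn _); apply/funext => n; have [_ [_ [_ <-]]] // := XY n.
    apply: ae_eq_integral => //.
    - by apply/measurable_EFinP; exact: measurable_funS (mYm n).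
    - apply/measurable_EFinP; apply: measurable_funS (sub_measurable_fun sG GM (mYn n)) => //.
    - by apply: filterS ae1 => w -> _.
  rewrite -monotone_convergence//; first last.
  - by move=> w _ n m nm; rewrite lee_fin; exact: Xnd.
  - by move=> n w _; rewrite lee_fin.
  - by move=> n; apply/measurable_EFinP; exact: measurable_funS (mX_ n).
  apply: eq_integral => w _; apply/cvg_lim => //.
  by apply/fine_cvgP; split; [exact: nearW|exact: Xcv].
have GT : G setT by have [h1 h2 _] := sG; rewrite -(setD0 setT); exact: h2.
have YEi : Pr.-integrable setT YE.
  apply/integrableP; split=> //.
  under eq_integral do rewrite gee0_abs//.
  rewrite IYE//; case/integrableP: iX => mX; apply: le_lt_trans.
  apply: ge0_le_integral => //.
  - move=> w _; rewrite lee_fin; apply: (cvgr_to_ge (Xcv w)); exact: nearW.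
  - exact: measurableT_comp.
  - by move=> w _; rewrite lee_fin ler_norm.
pose L w := fine (limn_esup (fun n => (Y_ n w)%:E)).
have LYE : {ae Pr, forall w, (L w)%:E = YE w}.
  apply: filterS2 ae1 (integrable_ae measurableT YEi) => w h fin.
  have -> : L w = fine (YE w).
    congr fine; apply: (cvg_limn_einf_sup (l := YE w) _).2.
    by under eq_fun do rewrite -h; exact: YEcv.
  by rewrite fineK//; exact: fin.
have mL : measurable_fun setT (L : g_sigma_algebraType G -> R).
  apply: measurableT_comp => //; apply: measurable_fun_limn_esup => n.
  exact/measurable_EFinP.
have mL' := sub_measurable_fun sG GM mL.
split=> //; split; first exact/(sub_measurable_funP sG).
have mEL : measurable_fun setT (EFin \o L) by exact/measurable_EFinP.
split.
  apply/integrableP; split=> //.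
  case/integrableP: YEi => _; apply: le_lt_trans.
  rewrite le_eqVlt; apply/orP; left; apply/eqP; apply: ae_eq_integral => //.
  - exact: measurableT_comp.
  - exact: measurableT_comp.
  - by apply: filterS LYE => w h _; rewrite /comp h.
move=> A GA; rewrite -IYE//; apply: ae_eq_integral => //; [exact: GM| | |].
- exact: measurable_funS mEL.
- exact: measurable_funS mYE.
- by apply: filterS LYE => w -> _.
Qed.

End condexp_existence.

Import HBSimple HBNNSimple.

(** * Jointly measurable fields of conditional expectations *)

Section projection.
Context (R : realType) d (Omega : measurableType d) (Pr : probability Omega R).
Context dS (S : measurableType dS) (nu : {measure set S -> \bar R}).
Variable F : S -> set (set Omega).
Hypothesis sF : forall s, sigma_algebra setT (F s).
Hypothesis FM : forall s, F s `<=` measurable.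
Variable YY : set (set (S * Omega)).
Hypothesis YY_rect : forall B, measurable B ->
  measurable (B `*` setT : set (g_sigma_algebraType YY)).
Hypothesis YY_indic : forall A, measurable A -> exists Y : S -> Omega -> R,
  measurable_fun setT (fun p : g_sigma_algebraType YY => Y p.1 p.2) /\
  {ae nu, forall s, is_condexp Pr (F s) (\1_A) (Y s)}.
Implicit Types X Y : S -> Omega -> R.

(** [YY] is the sigma-algebra in which versions must be measurable jointly in time and outcome. It
    will be the progressive sigma-algebra for a moving [F s], and the product of the Borel sets with
    [F t] for a fixed [t]. *)
Definition projectable X := exists Y,
  measurable_fun setT (fun p : g_sigma_algebraType YY => Y p.1 p.2) /\
  {ae nu, forall s, is_condexp Pr (F s) (X s) (Y s)}.

Lemma projectable_eq X X' : X =2 X' -> projectable X -> projectable X'.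
Proof.
move=> XX' [Y [mY cY]]; exists Y; split=> //; apply: filterS cY => s.
by have -> : X s = X' s by apply/funext => w; exact: XX'.
Qed.

Lemma projectableD X X' : projectable X -> projectable X' ->
  projectable (fun s w => X s w + X' s w).
Proof.
move=> [Y [mY cY]] [Y' [mY' cY']]; exists (fun s w => Y s w + Y' s w); split.
  exact: measurable_funD.
by apply: filterS2 cY cY' => s; exact: condexpD.
Qed.

Lemma projectableZ c X : projectable X -> projectable (fun s w => c * X s w).
Proof.
move=> [Y [mY cY]]; exists (fun s w => c * Y s w); split.
  exact: measurable_funM.
by apply: filterS cY => s; exact: condexpZ.
Qed.

Lemma projectable0 : projectable (fun _ _ => 0).
Proof.
have [Y [mY cY]] := YY_indic measurable0.
apply: (@projectable_eq (fun s w => 0 * \1_(@set0 Omega) w)); first by move=> s w; rewrite mul0r.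
by apply: projectableZ; exists Y.
Qed.

Lemma projectable_mono (X_ : nat -> S -> Omega -> R) X :
  (forall n s w, 0 <= X_ n s w) ->
  (forall s w, {homo (fun n => X_ n s w) : n m / (n <= m)%N >-> n <= m}) ->
  (forall s w, X_ n s w @[n --> \oo] --> X s w) ->
  {ae nu, forall s, Pr.-integrable setT (EFin \o X s)} ->
  (forall n, projectable (X_ n)) -> projectable X.
Proof.
move=> X0 Xnd Xcv iX /choice[Y_ YP].
exists (fun s w => fine (limn_esup (fun n => (Y_ n s w)%:E))); split.
  apply: measurableT_comp => //; apply: measurable_fun_limn_esup => n.
  by apply/measurable_EFinP; case: (YP n).
have h : {ae nu, forall s, forall n, is_condexp Pr (F s) (X_ n s) (Y_ n s)}.
  by apply: ae_foralln => n; case: (YP n).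
apply: filterS2 iX h => s iXs XYs; have := @condexp_monotone _ _ _ Pr _ (sF s) (@FM s) (fun n => X_ n s)
  (fun n => Y_ n s) (X s) (fun n w => X0 n s w) (Xnd s) (Xcv s) iXs XYs.
exact.
Qed.

Lemma projectable_rect (B : set S) (A : set Omega) : measurable B -> measurable A ->
  projectable (fun s w => \1_(B `*` A) (s, w)).
Proof.
move=> mB mA; have [Y [mY cY]] := YY_indic mA.
exists (fun s w => \1_B s * Y s w); split.
  apply: measurable_funM => //.
  have := @measurable_indic _ (g_sigma_algebraType YY) R setT _ (YY_rect mB).
  congr (measurable_fun _ _); apply/funext => -[s w]; rewrite !indicE.
  by congr ((nat_of_bool _)%:R); apply/idP/idP => /set_mem => [[h _]|h]; apply/mem_set.
apply: filterS cY => s /(condexpZ (sF s) (@FM s) (\1_B s)).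
congr is_condexp; apply/funext => w; rewrite !indicE -natrM mulnb.
congr ((nat_of_bool _)%:R); apply/idP/idP; first by move=> /andP[/set_mem h1 /set_mem h2]; apply/mem_set.
by move=> /set_mem[/= h1 h2]; apply/andP; split; apply/mem_set.
Qed.

(** Monotone classes, starting from rectangles; a disjoint union is the increasing limit of its
    finite partial sums, which [projectable_mono] handles. *)
Lemma projectable_indic (E : set (S * Omega)) : measurable E ->
  projectable (fun s w => \1_E (s, w)).
Proof.
rewrite measurable_prod_measurableType.
apply: (@dynkin_induction _ _ _ (fun E => projectable (fun s w => \1_E (s, w)))).
- exact: measurable_prod_measurableType.
- move=> _ _ [A1 mA1 [B1 mB1 <-]] [A2 mA2 [B2 mB2 <-]].
  exists (A1 `&` A2); first exact: measurableI.
  exists (B1 `&` B2); first exact: measurableI.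
  by rewrite setXI.
- apply: projectable_eq (projectable_rect measurableT measurableT) => s w.
  by rewrite setXTT.
- by move=> _ [A mA [B mB <-]]; exact: projectable_rect.
- move=> E' mE pE.
  have pT := projectable_rect measurableT measurableT.
  have := projectableD pT (projectableZ (-1) pE); apply: projectable_eq => s w.
  rewrite !indicE setXTT in_setT in_setC; case: (_ \in _) => /=; ring.
- move=> H mE tE pE.
  pose X_ n s w : R := \sum_(k < n) \1_(H k) (s, w).
  have XE n s w : X_ n s w = \1_(\bigcup_(k < n) H k) (s, w).
    rewrite /X_ bigcup_mkord; elim: n => [|n ih].
      by rewrite !big_ord0 indicE in_set0.
    rewrite !big_ord_recr/= ih !indicE in_setU -natrD; congr (_%:R).
    case: (boolP ((s, w) \in H n)) => [En|_]; last by rewrite orbF addn0.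
    case: (boolP (_ \in _)) => //= /set_mem; rewrite -bigcup_mkord.
    move=> [k /= kn Ek]; have /trivIsetP/(_ k n I I) := tE.
    have kn' : k != n by rewrite ltn_eqF.
    move=> /(_ kn') /seteqP[/(_ (s, w))]; case; split=> //; exact: set_mem.
  apply: (@projectable_mono X_).
  - by move=> n s w; rewrite XE indicE ler0n.
  - move=> s w n m nm; rewrite !XE !indicE.
    case: (boolP (_ \in _)) => [/set_mem[k kn Ek]|_]; last exact: ler0n.
    rewrite mem_set//; exists k => //=; exact: leq_trans nm.
  - move=> s w; have [[k _ Ek]|nE] := pselect ((\bigcup_k H k) (s, w)).
      apply: cvg_near_cst; near=> n; rewrite XE !indicE !mem_set//; first by exists k.
      exists k => //=; near: n; exact: nbhs_infty_gt.
    apply: cvg_near_cst; apply: nearW => n; rewrite XE !indicE !memNset//.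
    by move=> [k _ Ek]; apply: nE; exists k.
  - apply: nearW => s; apply: L2_integrable; apply: (@L2_bnd _ _ _ _ 1) => [|w].
      have mU : measurable (\bigcup_k H k) by exact: bigcup_measurable.
      exact: (measurable_fun_pair2 s (@measurable_indic _ _ R setT _ mU)).
    by rewrite indicE; case: (_ \in _); rewrite ?normr1 ?normr0.
  - elim=> [|n ih].
      by apply: projectable_eq projectable0 => s w; rewrite /X_ big_ord0.
    apply: projectable_eq (projectableD ih (pE n)) => s w.
    by rewrite /X_ big_ord_recr.
Unshelve. all: by end_near. Qed.

Lemma projectable_nnsfun (f : {nnsfun (S * Omega)%type >-> R}) :
  projectable (fun s w => f (s, w)).
Proof.
apply: (@projectable_eq (fun s w => \sum_(y <- finmap.enum_fset (fset_set (range f)))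
    (y * \1_(f @^-1` [set y]) (s, w)))).
  by move=> s w; rewrite [RHS](fimfunE f) fsbig_finite.
elim: (finmap.enum_fset _) => [|y l ih].
  by apply: projectable_eq projectable0 => s w; rewrite big_nil.
have p1 : projectable (fun s w => y * \1_(f @^-1` [set y]) (s, w)).
  by apply: projectableZ; exact: projectable_indic.
apply: projectable_eq (projectableD p1 ih) => s w.
by rewrite big_cons.
Qed.

Lemma projectable_ge0 X : measurable_fun setT (fun p : S * Omega => X p.1 p.2) ->
  (forall s w, 0 <= X s w) ->
  {ae nu, forall s, Pr.-integrable setT (EFin \o X s)} -> projectable X.
Proof.
move=> mX X0 iX.
have mE : measurable_fun setT (EFin \o (fun p : S * Omega => X p.1 p.2)).
  exact/measurable_EFinP.
pose f := nnsfun_approx measurableT mE.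
apply: (@projectable_mono (fun n s w => f n (s, w))) => //.
- move=> s w n m nm; have := nd_nnsfun_approx measurableT mE nm.
  by move=> /lefP /(_ (s, w)).
- move=> s w; have E0 p : [set: S * Omega] p -> (0 <= (EFin \o (fun p => X p.1 p.2)) p)%E.
    by rewrite lee_fin.
  have /fine_cvgP[_] := cvg_nnsfun_approx measurableT mE E0 (x := (s, w)) I.
  exact.
- by move=> n; exact: projectable_nnsfun.
Qed.

Lemma projectable_integrable X :
  measurable_fun setT (fun p : S * Omega => X p.1 p.2) ->
  {ae nu, forall s, Pr.-integrable setT (EFin \o X s)} -> projectable X.
Proof.
move=> mX iX.
pose Xp s w := Num.max (X s w) 0; pose Xn s w := Num.max (- X s w) 0.
have bnd (V : Omega -> R) (U : Omega -> R) : measurable_fun setT U -> (forall w, `|U w| <= `|V w|) ->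
    Pr.-integrable setT (EFin \o V) -> Pr.-integrable setT (EFin \o U).
  by move=> mU UV iV; exact: integrable_fin_le UV (integrable_norm iV).
have nb (z : R) : `|Num.max z 0| <= `|z|.
  by rewrite maxEle; case: ifP => // _; rewrite normr0.
have pp : projectable Xp.
  apply: projectable_ge0; first exact: measurable_maxr.
  - by move=> s w; rewrite le_max lexx orbT.
  - apply: filterS iX => s iXs; apply: bnd iXs => // ; last by move=> w; exact: nb.
    by apply: measurable_maxr => //; exact: (measurable_fun_pair2 s mX).
have pn : projectable Xn.
  apply: projectable_ge0; first by apply: measurable_maxr => //; exact: measurableT_comp.
  - by move=> s w; rewrite le_max lexx orbT.
  - apply: filterS iX => s iXs; apply: bnd iXs => // ; last by move=> w; rewrite -[leRHS]normrN; exact: nb.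
    apply: measurable_maxr => //; apply: measurableT_comp => //.
    exact: (measurable_fun_pair2 s mX).
apply: projectable_eq (projectableD pp (projectableZ (-1) pn)) => s w.
rewrite mulN1r /Xp /Xn !maxEle; case: ifP => h1; case: ifP => h2; lra.
Qed.

End projection.

(** * Measurable versions of conditional expectations *)

Section time_measure.
Context (R : realType).
Implicit Types T : R.

Lemma IccE (a b : R) : Icc a b = `[a, b]%classic.
Proof. by apply/seteqP; split=> x /=; rewrite in_itv. Qed.

Lemma measurable_Icc (a b : R) : measurable (Icc a b).
Proof. by rewrite IccE. Qed.

Lemma leb_Icc (a b : R) : a <= b -> leb (Icc a b) = (b - a)%:E.
Proof.
move=> ab; rewrite IccE [LHS]lebesgue_measure_itv/= lte_fin.
case: ltP => h; first by rewrite EFinB.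
by have -> : b = a; [apply/eqP; rewrite eq_le h|rewrite subrr].
Qed.

Lemma leb_Icc_fin (a b : R) : (leb (Icc a b) < +oo)%E.
Proof.
rewrite IccE [X in (X < _)%E]lebesgue_measure_itv/=; case: ifP => _; last exact: ltry.
by rewrite -EFinB ltry.
Qed.

(* [muT] lives on [R] itself, whereas [lebesgue_measure] lives on the alias
   [measurableTypeR R], which has another display. *)
Let lebT T : {finite_measure set (measurableTypeR R) -> \bar R} :=
  @mfrestr _ (measurableTypeR R) R (Icc 0 T) (@lebesgue_measure R)
    (measurable_Icc 0 T) (leb_Icc_fin 0 T).

Definition time_measure T : set R -> \bar R := lebT T.

Let time_measure0 T : time_measure T set0 = 0%E.
Proof. exact: measure0. Qed.
Let time_measure_ge0 T A : (0 <= time_measure T A)%E.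
Proof. exact: measure_ge0. Qed.
Let time_measure_sigma_additive T : semi_sigma_additive (time_measure T).
Proof.
by move=> F mF tF mUF; apply: (measure_semi_sigma_additive (s := lebT T)).
Qed.
HB.instance Definition _ T := isMeasure.Build _ _ _ (time_measure T)
  (time_measure0 T) (time_measure_ge0 T) (@time_measure_sigma_additive T).

Let time_measure_fin T : fin_num_fun (time_measure T).
Proof. by move=> A mA; exact: (fin_num_measure (lebT T)). Qed.
HB.instance Definition _ T :=
  Measure_isFinite.Build _ _ _ (time_measure T) (@time_measure_fin T).

Definition muT T : {finite_measure set R -> \bar R} := time_measure T.

Lemma muTE T A : muT T A = leb (A `&` Icc 0 T).
Proof. by []. Qed.

Lemma muT_ae T (P : R -> Prop) :
  {ae leb, forall s, Icc 0 T s -> P s} <-> {ae muT T, forall s, P s}.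
Proof.
split=> -[N [mN N0 PN]].
  exists (N `|` ~` Icc 0 T); split.
  - by apply: measurableU => //; apply: measurableC; exact: measurable_Icc.
  - rewrite muTE; apply/eqP; rewrite -measure_le0 -[leRHS]N0; apply: le_measure.
    + rewrite inE; apply: measurableI; last exact: measurable_Icc.
      by apply: measurableU => //; apply: measurableC; exact: measurable_Icc.
    + by rewrite inE.
    + by move=> s [[//|h] h'].
  - move=> s /= nP; have [h|h] := pselect (Icc 0 T s); last by right.
    by left; apply: PN => /= /(_ h).
exists (N `&` Icc 0 T); split=> //.
  by apply: measurableI => //; exact: measurable_Icc.
move=> s /= nP; have [h|h] := pselect (Icc 0 T s); last by exfalso; apply: nP.
by split=> //; apply: PN => /= h'; apply: nP.
Qed.

Lemma muT_ae_in T : {ae muT T, forall s, Icc 0 T s}.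
Proof. by apply/muT_ae; apply: nearW. Qed.

Lemma integral_muT T (f : R -> \bar R) : measurable_fun setT f ->
  (\int[muT T]_x f x = \int[leb]_(x in Icc 0 T) f x)%E.
Proof.
move=> mf; have mI := measurable_Icc 0 T.
transitivity (\int[muT T]_x (f \_ (Icc 0 T)) x)%E.
  apply: ae_eq_integral => //.
    by apply/(measurable_restrictT f mI); exact: measurable_funS mf.
  apply: filterS (muT_ae_in T) => x xI _.
  by rewrite patchE mem_set.
rewrite -integral_mkcond.
have mid : measurable_fun setT (id : measurableTypeR R -> R) by [].
have ge0 (g : R -> \bar R) : measurable_fun setT g -> (forall x, (0 <= g x)%E) ->
    (\int[muT T]_(x in Icc 0 T) g x = \int[leb]_(x in Icc 0 T) g x)%E.
  move=> mg g0.
  have -> : (\int[muT T]_(x in Icc 0 T) g x = \int[lebT T]_(x in Icc 0 T) g x)%E.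
    have mg' : measurable_fun (Icc 0 T) g by exact: measurable_funS mg.
    exact (@ge0_integral_pushforward _ _ _ _ _ _ mid (lebT T) (Icc 0 T) g
      (measurable_Icc 0 T) mg' (fun y _ => g0 y)).
  by apply: eq_measure_integral => A mA AI; rewrite /lebT/= /mfrestr /mrestr setIidl.
rewrite integralE [RHS]integralE; congr (_ - _)%E; apply: ge0 => //.
- exact: measurable_funepos.
- exact: measurable_funeneg.
Qed.

(** Measurability is asked of [g] only, and [f] agrees with it on [[a, b]]: the integrands of the
    statement are compared with processes cut to the horizon. *)
Lemma RInt_muT T a b (f g : R -> R) : 0 <= a -> b <= T ->
  measurable_fun setT g ->
  (forall x, a <= x <= b -> f x = g x) ->
  RInt a b f = \int[muT T]_x (ind ((a <= x) && (x <= b)) * g x).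
Proof.
move=> a0 bT mg fg.
have mi : measurable_fun setT (fun x : R => ind ((a <= x) && (x <= b)) * g x).
  apply: measurable_funM => //; apply: measurable_ind; apply: measurable_and;
    exact: measurable_fun_ler.
rewrite /RInt /Rintegral; congr fine.
rewrite integral_muT; last exact/measurable_EFinP.
rewrite integral_mkcond [RHS]integral_mkcond; apply: eq_integral => x _.
rewrite !patchE; case: (boolP (x \in Icc a b)) => [/set_mem /= xab|xab].
  have /andP[xa xb] := xab.
  have xT : Icc 0 T x by rewrite /Icc/= (le_trans a0 xa) (le_trans xb bT).
  by rewrite (mem_set xT) xa xb mul1r fg.
have -> : ((a <= x) && (x <= b)) = false.
  by apply/negP => h; move/negP: xab; apply; apply/mem_set.
by rewrite mul0r; case: ifP.
Qed.

Lemma muT_set1 T (x : R) : muT T [set x] = 0%E.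
Proof.
rewrite muTE; apply/eqP; rewrite -measure_le0 -(lebesgue_measure_set1 x).
apply: le_measure; rewrite ?inE//.
by apply: measurableI => //; exact: measurable_Icc.
Qed.

Lemma muT_ae_neq T (x : R) : {ae muT T, forall y, y <> x}.
Proof.
exists [set x]; split; [exact: measurable_set1|exact: muT_set1|].
by move=> s /= /contrapT.
Qed.

Lemma muT_Icc T (a b : R) : a <= b -> (muT T (Icc a b) <= (b - a)%:E)%E.
Proof.
move=> ab; rewrite muTE -leb_Icc//; apply: le_measure; rewrite ?inE.
- by apply: measurableI; exact: measurable_Icc.
- exact: measurable_Icc.
- by move=> x [].
Qed.

Lemma Rint_expR (K y : R) : 0 < K -> 0 < y ->
  RInt 0 y (fun s => expR (K * s)) = (expR (K * y) - 1) / K.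
Proof.
move=> K0 y0; have KN0 : K != 0 by rewrite gt_eqF.
pose F s : R := K^-1 * expR (K * s).
have dF (s : R) : is_derive s 1 F (expR (K * s)).
  rewrite /F; apply: is_derive_eq.
  by rewrite /GRing.scale/=; field.
have cE : continuous (fun s : R => expR (K * s)).
  move=> s; apply: continuous_comp; last exact: continuous_expR.
  by apply: cvgM; [exact: cvg_cst|exact: cvg_id].
have dFs (s : R) : derivable F s 1 by have [] := dF s.
have cF : continuous F by move=> s; apply: differentiable_continuous; exact/derivable1_diffP.
rewrite /RInt /Rintegral IccE (@continuous_FTC2 _ _ F 0 y y0).
- by rewrite /= /F mulr0 expR0 -mulrBr mulrC.
- exact: continuous_subspaceT.
- split.
  + by move=> s _.
  + exact: cvg_at_right_filter (cF 0).
  + exact: cvg_at_left_filter (cF y).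
- by move=> s _; rewrite derive1E; have [_] := dF s.
Qed.

(** The weight is [expR (K * x)], with [x] clamped to [[0, T]] to keep it bounded; [K] times its
    integral from 0 to [x] is [expR (K * x) - 1]. *)
Lemma muT_weight T : 0 < T -> forall K : R, 0 < K -> exists (w : R -> R) (M : R),
  [/\ measurable_fun setT w, forall x, 0 < w x <= M &
      forall x, K * ip (muT T) (fun s => ind (s <= x)) w <= w x].
Proof.
move=> T0 K K0; pose cl (x : R) := Num.min (Num.max x 0) T.
have cl0 x : 0 <= cl x <= T.
  by rewrite /cl le_min ge_min le_max lexx (ltW T0) lexx !orbT.
have mE : measurable_fun setT (fun s : R => expR (K * s)).
  by apply: measurableT_comp => //; exact: measurable_funM.
exists (fun x => expR (K * cl x)), (expR (K * T)); split.
- apply: (measurableT_comp mE); apply: measurable_minr => //.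
  exact: measurable_maxr.
- by move=> x; rewrite expR_gt0 ler_expR ler_pM2l//; case/andP: (cl0 x).
- move=> x; have [x0|x0] := ltP x 0.
    rewrite (_ : ip _ _ _ = 0) ?mulr0 ?expR_ge0//.
    rewrite -(ip0l (muT T) (fun x => expR (K * cl x))); apply: ip_ae => //.
    + by apply: measurable_ind; exact: measurable_fun_ler.
    + apply: (measurableT_comp mE); apply: measurable_minr => //.
      exact: measurable_maxr.
    + apply: filterS (muT_ae_in T) => s /andP[s0 _].
      by rewrite leNgt (lt_le_trans x0 s0).
  have [cx0 cxT] := andP (cl0 x).
  have -> : ip (muT T) (fun s => ind (s <= x)) (fun x => expR (K * cl x)) =
      RInt 0 (cl x) (fun s => expR (K * s)).
    rewrite (@RInt_muT T _ _ _ (fun s => expR (K * s)))//; apply: ae_Rintegral.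
    + apply: measurable_funM; first by apply: measurable_ind; exact: measurable_fun_ler.
      apply: (measurableT_comp mE); apply: measurable_minr => //.
      exact: measurable_maxr.
    + apply: measurable_funM => //; apply: measurable_ind; apply: measurable_and;
        exact: measurable_fun_ler.
    + apply: filterS (muT_ae_in T) => s /andP[s0 sT].
      rewrite s0 /cl (max_l s0) (min_l sT) (max_l x0) le_min sT andbT.
      by [].
  have [->|cxp] := eqVneq (cl x) 0.
    rewrite /RInt (_ : Icc 0 0 = [set 0]); last first.
      by apply/seteqP; split=> s; rewrite /Icc/=; [rewrite -eq_le => /eqP <-|move=> ->; rewrite lexx].
    by rewrite Rintegral_set1 mulr0 expR_ge0.
  rewrite Rint_expR//; last by rewrite lt_def cxp.
  by rewrite mulrCA mulfV ?gt_eqF// mulr1 gerBl.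
Qed.

End time_measure.

(** * The progressive sigma-algebra *)

Section progressive_sigma_algebra.
Context (R : realType) d (Omega : measurableType d) (Pr : probability Omega R).
Variables (T : R) (F : R -> set (set Omega)).
Hypothesis T0 : 0 < T.
Hypothesis uF : usual_filtration Pr T F.
Implicit Types X Y : R -> Omega -> R.

Local Notation Om t := (g_sigma_algebraType (F t)).

Lemma filtration_sigma t : Icc 0 T t -> sigma_algebra setT (F t).
Proof. by move=> tT; have [/(_ t tT)[]] := uF. Qed.

Lemma filtration_sub t : Icc 0 T t -> F t `<=` measurable.
Proof. by move=> tT; have [/(_ t tT)[]] := uF. Qed.

Lemma filtration_mono s t : Icc 0 T s -> Icc 0 T t -> s <= t -> F s `<=` F t.
Proof. by move=> sT tT st; have [_ [/(_ s t sT tT st)]] := uF. Qed.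

Lemma filtration_measurable t : Icc 0 T t ->
  <<s F t>> `<=` (measurable : set (set Omega)).
Proof. move=> tT; exact: (sub_sigma_measurable (filtration_sigma tT) (filtration_sub tT)). Qed.

Lemma measurable_prod_from_sub d' (Y : measurableType d') t (f : R * Omega -> Y) :
  Icc 0 T t -> measurable_fun setT (f : R * Om t -> Y) -> measurable_fun setT f.
Proof.
move=> tT mf.
have mid : measurable_fun setT (id : R * Omega -> R * Om t).
  apply/measurable_fun_pairP; split; first exact: measurable_fst.
  exact: (measurableT_comp (measurable_to_sub (filtration_measurable tT)) measurable_snd).
exact: (measurableT_comp mf mid).
Qed.

Definition strip (t : R) : set (R * Omega) := [set p | Icc 0 t p.1].

Lemma measurable_strip t s : measurable (strip t : set (R * Om s)).
Proof.
rewrite (_ : strip t = Icc 0 t `*` setT); last by apply/seteqP; split=> p /= => [|[]].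
by apply: measurableX => //; exact: measurable_Icc.
Qed.

(** The sigma-algebra generated on the strip by the rectangles in [progressive] is the trace of the
    product of the Borel sets with [F t]; each inclusion follows from minimality of a generated
    sigma-algebra. *)
Lemma strip_generated t (E : set (R * Omega)) : Icc 0 T t ->
  <<s strip t, [set Z | exists (A : set R) (C : set Omega),
      [/\ measurable A, A `<=` Icc 0 t, F t C & Z = A `*` C]] >> (strip t `&` E)
  <-> measurable (strip t `&` E : set (R * Om t)).
Proof.
move=> tT; set Rt := [set Z | _]; split.
  apply: (@smallest_sub _ (sigma_algebra (strip t)) Rt
    (measurable : set (set (R * Om t)))); last first.
    move=> _ [A [C [mA _ FC ->]]]; apply: measurableX => //.
    exact: sub_sigma_algebra.
  split.
  - exact: measurable0.
  - by move=> A mA; apply: measurableD => //; exact: measurable_strip.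
  - by move=> A mA; exact: bigcupT_measurable.
have gen Z : measurable (Z : set (R * Om t)) -> <<s strip t, Rt>> (strip t `&` Z).
  rewrite measurable_prod_measurableType.
  apply: (@smallest_sub _ (sigma_algebra setT) _
    [set Z | <<s strip t, Rt>> (strip t `&` Z)]); last first.
    move=> _ [A mA [C mC <-]] /=; apply: sub_sigma_algebra.
    exists (A `&` Icc 0 t), C; split.
    - by apply: measurableI => //; exact: measurable_Icc.
    - by move=> s [].
    - by apply/(sub_measurableE (filtration_sigma tT)).
    - by apply/seteqP; split=> p /= => [[h [h1 h2]]|[[h1 h] h2]].
  split => /=.
  - by rewrite setI0; exact: sigma_algebra0.
  - move=> A hA; rewrite (_ : _ `&` _ = strip t `\` (strip t `&` A)).
      exact: sigma_algebraCD.
    apply/seteqP; split=> p /=; first by move=> [h1 [_ h2]]; split=> // -[].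
    by move=> [h1 h2]; split=> //; split=> // h3; apply: h2.
  - move=> A hA; rewrite setI_bigcupr; exact: sigma_algebra_bigcup.
by move=> /gen; rewrite setIA setIid.
Qed.

Definition progset : set (set (R * Omega)) := [set E |
  forall t, Icc 0 T t -> measurable (strip t `&` E : set (R * Om t))].

Lemma sigma_progset : sigma_algebra setT progset.
Proof.
split.
- by move=> t tT; rewrite setI0.
- move=> A hA t tT; rewrite (_ : _ `&` _ = strip t `\` (strip t `&` A)).
    by apply: measurableD; [exact: measurable_strip|exact: hA].
  apply/seteqP; split=> p /=; first by move=> [h1 [_ h2]]; split=> // -[].
  by move=> [h1 h2]; split=> //; split=> // h3; apply: h2.
- move=> A hA t tT; rewrite setI_bigcupr; apply: bigcupT_measurable => n.
  exact: hA.
Qed.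

Lemma progressiveP X : progressive T F X <->
  measurable_fun setT (fun p : g_sigma_algebraType progset => X p.1 p.2).
Proof.
split.
  move=> pX _ B mB; rewrite setTI; apply/(sub_measurableE sigma_progset) => t tT.
  by apply/(strip_generated _ tT); exact: pX.
move=> mX t tT B mB; apply/(strip_generated [set p | B (X p.1 p.2)] tT).
have := mX measurableT B mB; rewrite setTI => /(sub_measurableE sigma_progset).
exact.
Qed.

Lemma progressive_strip X : progressive T F X <-> forall t, Icc 0 T t ->
  measurable_fun (strip t : set (R * Om t)) (fun p : R * Om t => X p.1 p.2).
Proof.
split.
  move=> pX t tT _ B mB.
  have h := proj1 (strip_generated [set p | B (X p.1 p.2)] tT) (pX t tT B mB).
  exact: h.
move=> mX t tT B mB; apply/(strip_generated [set p | B (X p.1 p.2)] tT).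
by apply: mX => //; exact: measurable_strip.
Qed.

Lemma progressive_cut X t : Icc 0 T t -> progressive T F X ->
  measurable_fun setT (fun p : R * Om t => ind ((0 <= p.1) && (p.1 <= t)) * X p.1 p.2).
Proof.
move=> tT /progressive_strip/(_ t tT)/(measurable_restrictT _ (@measurable_strip t t)).
congr (measurable_fun _ _); apply/funext => -[s w] /=; rewrite patchE/=.
rewrite /ind; case: ifPn => [/set_mem -> |/negP h]; first by rewrite mul1r.
by rewrite ifF ?mul0r//; apply/negP => h'; apply: h; apply/mem_set.
Qed.

(** Being progressive constrains a process on [[0, T]] only, so joint measurability over all real
    times requires a cut to the horizon. *)
Lemma progressive_measurable X : progressive T F X ->
  measurable_fun setT (fun p : R * Omega => ind ((0 <= p.1) && (p.1 <= T)) * X p.1 p.2).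
Proof.
have TT : Icc 0 T T by rewrite /Icc/= lexx ltW.
by move=> /(progressive_cut TT); exact: measurable_prod_from_sub.
Qed.

Lemma progressive_adapted X t : Icc 0 T t -> progressive T F X ->
  measurable_fun setT (X t : Om t -> R).
Proof.
move=> tT /(progressive_cut tT) /(measurable_fun_pair2 t).
congr (measurable_fun _ _); apply/funext => w /=.
by have /andP[-> _] := tT; rewrite lexx mul1r.
Qed.

End progressive_sigma_algebra.

(** * Progressive versions of the conditional expectations given [F s] *)

Lemma cvg_geom_bound (R : realType) (a : nat -> R) (l z h : R) : 0 <= z < 1 ->
  (forall n, (l - a n) ^+ 2 <= (z ^+ n) ^+ 2 * h) -> a n @[n --> \oo] --> l.
Proof.
move=> /andP[z0 z1] ah.
have c0 : (fun n => z ^+ n * Num.sqrt h) @ \oo --> (0 : R).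
  rewrite -[X in _ --> X](mul0r (Num.sqrt h)); apply: cvgMl.
  by apply: cvg_expr; rewrite ger0_norm.
apply/cvgrPdist_le => e e0.
have hn : \forall n \near \oo, `|z ^+ n * Num.sqrt h| <= e by exact: cvgr0_norm_le c0 _ e0.
near=> n.
apply: (@le_trans _ _ (z ^+ n * Num.sqrt h)).
  rewrite -(@ler_pXn2r _ 2)// ?nnegrE ?mulr_ge0 ?exprn_ge0 ?sqrtr_ge0//.
  rewrite real_normK ?num_real//; apply: (le_trans (ah n)); rewrite exprMn ler_wpM2l ?sqr_ge0//.
  by have [h0|h0] := leP 0 h; [rewrite sqr_sqrtr|rewrite (le_trans (ltW h0)) ?sqr_ge0].
apply: le_trans (ler_norm _) _; near: n; exact: hn.
Unshelve. all: by end_near. Qed.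

Section optional_projection.
Context (R : realType) d (Omega : measurableType d) (Pr : probability Omega R).
Variables (T : R) (F : R -> set (set Omega)).
Hypothesis T0 : 0 < T.
Hypothesis uF : usual_filtration Pr T F.
Implicit Types X Y : R -> Omega -> R.

Definition clampT (s : R) : R := Num.min (Num.max s 0) T.
(** The filtration is frozen before 0 and after [T], which makes it a filtration over all real
    times. *)
Definition Fc (s : R) := F (clampT s).

Lemma clampT_in s : Icc 0 T (clampT s).
Proof.
by rewrite /Icc/= /clampT le_min ge_min le_max lexx (ltW T0) lexx !orbT.
Qed.

Lemma clampT_id s : Icc 0 T s -> clampT s = s.
Proof. by move=> /andP[s0 sT]; rewrite /clampT max_l// min_l. Qed.

Lemma clampT_mono r s : r <= s -> clampT r <= clampT s.
Proof.
move=> rs; rewrite /clampT le_min !ge_min lexx orbT andbT.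
by rewrite ge_max !le_max rs lexx orbT.
Qed.

Lemma FcE s : Icc 0 T s -> Fc s = F s.
Proof. by move=> sT; rewrite /Fc clampT_id. Qed.

Lemma Fc_sigma s : sigma_algebra setT (Fc s).
Proof. exact: (filtration_sigma uF (clampT_in s)). Qed.

Lemma Fc_sub s : Fc s `<=` measurable.
Proof. exact: (filtration_sub uF (clampT_in s)). Qed.

Lemma Fc_mono r s : r <= s -> Fc r `<=` Fc s.
Proof.
by move=> rs; apply: (filtration_mono uF (clampT_in _) (clampT_in _)); exact: clampT_mono.
Qed.

Lemma sub_measurable_mono (G H : set (set Omega)) (Y : Omega -> R) :
  sigma_algebra setT G -> sigma_algebra setT H -> G `<=` H ->
  measurable_fun setT (Y : g_sigma_algebraType G -> R) ->
  measurable_fun setT (Y : g_sigma_algebraType H -> R).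
Proof.
move=> sG sH GH /(sub_measurable_funP sG) mY; apply/(sub_measurable_funP sH) => B mB.
exact/GH/mY.
Qed.

Local Notation PT := (g_sigma_algebraType (progset T F)).

Section martingale.
Variable M : R -> Omega -> R.
Variable A : set Omega.
Hypothesis mA : measurable A.
Hypothesis cM : forall s, is_condexp Pr (Fc s) (\1_A) (M s).
Hypothesis M01 : forall s w, 0 <= M s w <= 1.

(** The energy of the martingale. Its increments are orthogonal, so the squared distance between two
    times is the increment of [phi], a nondecreasing function with values in [[0, 1]]. *)
Let phi s := ip Pr (M s) (M s).

Let Mb s w : `|M s w| <= 1.
Proof. by have /andP[h0 h1] := M01 s w; rewrite ger0_norm. Qed.

Let M_sub s : measurable_fun setT (M s : g_sigma_algebraType (Fc s) -> R).
Proof. exact: (condexp_sub (Fc_sigma s) (cM s)). Qed.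

Let LM s : L2 Pr (M s).
Proof.
have m := sub_measurable_fun (Fc_sigma s) (@Fc_sub s) (@M_sub s).
exact: (L2_bnd Pr m (Mb s)).
Qed.

Let ip_M r s : r <= s -> ip Pr (M s) (M r) = phi r.
Proof.
move=> rs; have mr := sub_measurable_mono (Fc_sigma r) (Fc_sigma s) (Fc_mono rs) (@M_sub r).
rewrite /ip -(condexp_testb (Fc_sigma s) (@Fc_sub s) (cM s) mr (Mb r)).
exact: (condexp_testb (Fc_sigma r) (@Fc_sub r) (cM r) (@M_sub r) (Mb r)).
Qed.

Let ip_MB r s : r <= s ->
  ip Pr (fun w => M s w - M r w) (fun w => M s w - M r w) = phi s - phi r.
Proof.
move=> rs; have LB := L2B (LM s) (LM r).
rewrite ipBl// !ipBr// (ipC Pr (M r) (M s)) (ip_M rs) -/(phi s) -/(phi r); ring.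
Qed.

Let phi_mono r s : r <= s -> phi r <= phi s.
Proof. by move=> rs; rewrite -subr_ge0 -ip_MB// ip_ge0. Qed.

Let phi01 s : 0 <= phi s <= 1.
Proof.
rewrite ip_ge0/=.
have hM w : M s w ^+ 2 <= 1 by have /andP[h0 h1] := M01 s w; rewrite expr_le1.
apply: (le_trans (ip_bnd_le (LM s) hM)).
by rewrite mul1r [X in fine X](probability_setT Pr).
Qed.

Let h n : R := T / 2 ^+ n.
Let hp n : 0 < h n. Proof. by rewrite divr_gt0// exprn_gt0. Qed.
Let kn n (s : R) : nat := Num.truncn (s / h n).
Let Mn n s w := M (h n * (kn n s)%:R) w.

Let kn_le n s : 0 <= s -> h n * (kn n s)%:R <= s < h n * (kn n s).+1%:R.
Proof.
move=> s0; have := truncn_itv (divr_ge0 s0 (ltW (hp n))).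
by rewrite -/(kn n s) ler_pdivlMr// ltr_pdivrMr// ![_%:R * h n]mulrC.
Qed.

Let J n (k : nat) : set R := `[h n * k%:R, h n * k.+1%:R[%classic.

Let knJ n s k : 0 <= s -> J n k s <-> kn n s = k.
Proof.
move=> s0; rewrite /J/= in_itv/=; split=> [/andP[h1 h2]|<-]; last exact: kn_le.
apply: truncn_def; rewrite ler_pdivlMr// ltr_pdivrMr//.
by rewrite ![_%:R * h n]mulrC h1.
Qed.

(** The sample is taken at the left end of the grid cell: up to time [t] only values of [M] at grid
    points not after [t] are seen, and these are [F t]-measurable. *)
Let Mn_prog n : measurable_fun setT (fun p : PT => Mn n p.1 p.2).
Proof.
apply/(progressiveP uF)/(progressive_strip uF) => t tT _ B mB.
rewrite [X in _ X](_ : _ = \bigcup_k ((Icc 0 t `&` J n k) `*` (M (h n * k%:R) @^-1` B))); last first.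
  apply/seteqP; split=> -[s w] /=.
    move=> [st Bs]; have /andP[s0 _] := st; exists (kn n s) => //=.
    by split=> //; split=> //; apply/knJ.
  by move=> [k _ [[st Js] Bs]]; split=> //; have /andP[s0 _] := st; rewrite /Mn; move/(knJ _ _ s0) : Js => ->.
apply: bigcupT_measurable => k.
have [kt|kt] := leP (h n * k%:R) t; last first.
  rewrite (_ : _ `*` _ = set0); first exact: measurable0.
  apply/seteqP; split=> -[s w] //= [[/andP[_ st] Js] _].
  by move: Js; rewrite /J/= in_itv/= => /andP[ks _]; move: (le_lt_trans (le_trans ks st) kt); rewrite ltxx.
apply: measurableX; first by apply: measurableI; [exact: measurable_Icc|exact: measurable_itv].
apply/(sub_measurableE (filtration_sigma uF tT)).
rewrite -(FcE tT); apply: (Fc_mono kt).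
by have /(sub_measurable_funP (Fc_sigma _)) := @M_sub (h n * k%:R); apply.
Qed.

Let c n k := phi (h n * k.+1%:R) - phi (h n * k%:R).
Let c_ge0 n k : 0 <= c n k.
Proof. by rewrite subr_ge0; apply: phi_mono; rewrite ler_pM2l// ler_nat. Qed.

(** A step function dominating, on [[0, T)], the squared distance between [M s] and its grid sample:
    each cell carries the full increment of [phi] over it. *)
Let psi n (s : R) : R := \sum_(k < 2 ^ n) c n k * \1_(J n k) s.

Let psi_ge n s : 0 <= s < T -> phi s - phi (h n * (kn n s)%:R) <= psi n s.
Proof.
move=> /andP[s0 sT]; have /andP[k1 k2] := kn_le n s0.
have kN : (kn n s < 2 ^ n)%N.
  rewrite -(ltr_nat R) -(ltr_pM2l (hp n)) (le_lt_trans k1)//.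
  by rewrite natrX /h divfK ?expf_neq0.
rewrite /psi (bigD1 (Ordinal kN))//= indicE mem_set; last by apply/knJ.
rewrite mulr1 -[leLHS]addr0 lerD//.
  by rewrite /c lerB// phi_mono// ltW.
by apply: sumr_ge0 => k _; rewrite mulr_ge0// indicE ler0n.
Qed.

Let mpsi n : measurable_fun setT (psi n).
Proof.
by apply: measurable_sum => k; apply: measurable_funM => //; apply: measurable_indic; exact: measurable_itv.
Qed.

Let psi_ge0 n s : 0 <= psi n s.
Proof. by apply: sumr_ge0 => k _; rewrite mulr_ge0// indicE ler0n. Qed.

(** The cells have length [h n], and the increments of [phi] telescope to at most 1. *)
Let Ipsi n : (\int[muT T]_s (psi n s)%:E <= (T * (2^-1) ^+ n)%:E)%E.
Proof.
rewrite /psi; under eq_integral do rewrite -sumEFin.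
rewrite ge0_integral_sum//; last 2 first.
- by move=> k; apply/measurable_EFinP; apply: measurable_funM => //; apply: measurable_indic; exact: measurable_itv.
- by move=> k s _; rewrite lee_fin mulr_ge0// indicE ler0n.
apply: (@le_trans _ _ (\sum_(k < 2 ^ n) (c n k * h n)%:E)%E).
  apply: lee_sum => k _; under eq_integral do rewrite EFinM.
  rewrite ge0_integralZl ?lee_fin//; last first.
    by apply/measurable_EFinP; apply: measurable_indic; exact: measurable_itv.
  rewrite integral_indic//; last exact: measurable_itv.
  rewrite setIT EFinM; apply: lee_wpmul2l; first by rewrite lee_fin.
  have hk : h n * k%:R <= h n * k.+1%:R by rewrite ler_pM2l// ler_nat.
  apply: (@le_trans _ _ (muT T (Icc (h n * k%:R) (h n * k.+1%:R)))).
    apply: le_measure; rewrite ?inE; [exact: measurable_itv|exact: measurable_Icc|].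
    by move=> s; rewrite /J /Icc/= in_itv/= => /andP[-> /ltW ->].
  apply: (le_trans (muT_Icc T hk)).
  by rewrite lee_fin -mulrBr -natrB// subSnn mulr1.
rewrite sumEFin lee_fin -mulr_suml mulrC /c.
rewrite -(big_mkord xpredT (fun k => phi (h n * k.+1%:R) - phi (h n * k%:R))).
rewrite (telescope_sumr (fun k => phi (h n * k%:R)))//.
rewrite /h exprVn ler_piMr//; first by rewrite ltW// hp.
have /andP[_ p1] := phi01 (T / 2 ^+ n * (2 ^ n)%:R).
have /andP[p0 _] := phi01 (T / 2 ^+ n * 0%:R).
lra.
Qed.

Let dpsi n s := Num.sqrt (psi n s).

Let Ldpsi n : L2 (muT T) (dpsi n) /\ ip (muT T) (dpsi n) (dpsi n) <= T * (2^-1) ^+ n.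
Proof.
apply/L2_norm_leP.
  exact: (measurableT_comp (continuous_measurable_fun (@sqrt_continuous R)) (mpsi n)).
by under eq_integral do rewrite sqr_sqrtr//.
Qed.

(** The [M s] are chosen independently of each other, with no measurability in [s]; the progressive
    version is the upper limit of the grid samples. Summability of the time-integrated errors gives,
    at almost every [s], geometric convergence in mean square to [M s], hence almost sure
    convergence. *)
Lemma martingale_version : exists Y : R -> Omega -> R,
  measurable_fun setT (fun p : PT => Y p.1 p.2) /\
  {ae muT T, forall s, is_condexp Pr (Fc s) (\1_A) (Y s)}.
Proof.
exists (fun s w => fine (limn_esup (fun n => (Mn n s w)%:E))).
have mY : measurable_fun setT (fun p : PT => fine (limn_esup (fun n => (Mn n p.1 p.2)%:E))).
  apply: measurableT_comp => //; apply: measurable_fun_limn_esup => n.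
  by apply/measurable_EFinP; exact: Mn_prog.
split=> //.
(* Two uses of [ae_geom], in time and then in the outcome. The ratio 1/2 is below
   [(4 / 5) ^+ 2 = 16 / 25], the rate at almost every time, which in turn is below [(9 / 10) ^+ 2].
   Square roots appear because [ae_geom] bounds squares. *)
have [H [_ H0 aeH _]] := @ae_geom R _ R (muT T) dpsi T 2^-1 (4 / 5) ltac:(lra)
  ltac:(lra) ltac:(lra) (fun n => (Ldpsi n).1) (fun n => (Ldpsi n).2).
(* The cells of [psi n] cover [[0, T)] only. *)
have aeT : {ae muT T, forall s, s <> T}.
  exists [set T]; split; [exact: measurable_set1|exact: muT_set1|].
  by move=> s /= /contrapT.
apply: filterS3 aeH aeT (muT_ae_in T) => s sH sT sI.
have /andP[s0 sT'] := sI.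
have sT2 : 0 <= s < T by rewrite s0 lt_neqAle sT' andbT; apply/eqP.
have B1 n : ip Pr (fun w => M s w - Mn n s w) (fun w => M s w - Mn n s w)
    <= H s * (16 / 25) ^+ n.
  have /andP[k1 _] := kn_le n s0; rewrite (ip_MB k1).
  apply: (le_trans (psi_ge n sT2)); have := sH n.
  rewrite /dpsi sqr_sqrtr// mulrC -exprM mulnC exprM.
  by rewrite (_ : (4 / 5) ^+ 2 = 16 / 25 :> R); last by field.
have LB n : L2 Pr (fun w => M s w - Mn n s w) by apply: L2B; exact: LM.
have [H' [_ H0' aeH' _]] := @ae_geom R _ _ Pr (fun n w => M s w - Mn n s w)
  (H s) (16 / 25) (9 / 10) ltac:(lra) ltac:(lra) ltac:(lra) LB B1.
apply: (condexp_ae (Fc_sigma s) (@Fc_sub s) (cM s)).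
- exact: measurable_indic.
- rewrite (FcE sI); have := progressive_adapted uF sI (X := fun s w => fine (limn_esup (fun n => (Mn n s w)%:E))).
  by apply; apply/(progressiveP uF).
- exact: nearW.
- apply: filterS aeH' => w wH.
  rewrite (_ : limn_esup _ = (M s w)%:E)//.
  apply: (cvg_limn_einf_sup (l := (M s w)%:E) _).2; apply/fine_cvgP; split; first exact: nearW.
  have z01 : 0 <= (9 / 10 : R) < 1 by lra.
  exact: (@cvg_geom_bound _ (fun n => Mn n s w) (M s w) (9 / 10) (H' w) z01 wH).
Qed.

End martingale.
Lemma optional_projection X :
  measurable_fun setT (fun p : R * Omega => X p.1 p.2) ->
  {ae muT T, forall s, Pr.-integrable setT (EFin \o X s)} ->
  exists Y, progressive T F Y /\ {ae muT T, forall s, is_condexp Pr (F s) (X s) (Y s)}.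
Proof.
move=> mX iX.
have rect B : measurable B -> measurable (B `*` setT : set PT).
  move=> mB; apply/(sub_measurableE (sigma_progset T F)) => t tT.
  rewrite (_ : _ `&` _ = (Icc 0 t `&` B) `*` setT).
    by apply: measurableX => //; apply: measurableI => //; exact: measurable_Icc.
  by apply/seteqP; split=> p /= => [[h1 []]|[[h1 h2] _]].
have ind A : measurable A -> exists Y : R -> Omega -> R,
    measurable_fun setT (fun p : PT => Y p.1 p.2) /\
    {ae muT T, forall s, is_condexp Pr (Fc s) (\1_A) (Y s)}.
  move=> mA.
  have /choice[M MP] : forall s, exists Y : Omega -> R, is_condexp Pr (Fc s) (\1_A) Y /\
      forall w, 0 <= Y w <= 1.
    by move=> s; exact: (condexp_indic Pr (Fc_sigma s) (@Fc_sub s) mA).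
  apply: (@martingale_version M A mA) => [s|s w]; first by case: (MP s).
  by have [_] := MP s.
have [Y [mY cY]] := projectable_integrable Fc_sigma Fc_sub rect ind mX iX.
exists Y; split; first exact/(progressiveP uF).
by apply: filterS2 cY (muT_ae_in T) => s h sI; rewrite -(FcE sI).
Qed.

(** Measurability is for the Borel sets times [F t], stronger than plain joint measurability: it
    makes time integrals of the version [F t]-measurable. *)
Lemma fixed_projection t X : Icc 0 T t ->
  measurable_fun setT (fun p : R * Omega => X p.1 p.2) ->
  {ae muT T, forall s, Pr.-integrable setT (EFin \o X s)} ->
  exists Y : R -> Omega -> R,
    measurable_fun setT (fun p : R * g_sigma_algebraType (F t) => Y p.1 p.2) /\
    {ae muT T, forall s, is_condexp Pr (F t) (X s) (Y s)}.
Proof.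
move=> tT mX iX; have sF := filtration_sigma uF tT; have FM := filtration_sub uF tT.
pose YY : set (set (R * Omega)) := @measurable _ (R * g_sigma_algebraType (F t))%type.
have sYY : sigma_algebra setT YY by exact: sigma_algebra_measurable.
have YYE (f : R * Omega -> R) : measurable_fun setT (f : g_sigma_algebraType YY -> R) <->
    measurable_fun setT (f : R * g_sigma_algebraType (F t) -> R).
  split=> mf _ B mB; rewrite setTI.
    by apply/(sub_measurableE sYY); have := mf measurableT B mB; rewrite setTI.
  by apply/(sub_measurableE sYY); have := mf measurableT B mB; rewrite setTI.
have rect B : measurable B -> measurable (B `*` setT : set (g_sigma_algebraType YY)).
  by move=> mB; apply/(sub_measurableE sYY); exact: measurableX.
have ind A : measurable A -> exists Y : R -> Omega -> R,
    measurable_fun setT (fun p : g_sigma_algebraType YY => Y p.1 p.2) /\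
    {ae muT T, forall s, is_condexp Pr (F t) (\1_A) (Y s)}.
  move=> mA; have [Y [cY _]] := condexp_indic Pr sF FM mA.
  exists (fun _ => Y); split; last exact: nearW.
  apply/YYE; exact: (measurableT_comp (condexp_sub sF cY) measurable_snd).
have [Y [mY cY]] := projectable_integrable (F := fun _ => F t) (fun _ => sF) (fun _ => FM) rect ind mX iX.
by exists Y; split=> //; exact/YYE.
Qed.

End optional_projection.

(** * The operators of the model *)

Section model_kernel.
Context (R : realType).
Variables (T rho phi : R) (G : R -> R -> R).
Hypothesis T0 : 0 < T.
Hypothesis rho0 : 0 <= rho.
Hypothesis phi0 : 0 <= phi.
Hypothesis GK : kernel_class T G.
Let mu := muT T.

Definition in_horizon (x : R) : bool := (0 <= x) && (x <= T).
(* Restricts to [[0, T]]; [muT] does not see the complement, but pointwise identities do. *)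
Definition cut_horizon (f : R -> R) : R -> R := fun x => ind (in_horizon x) * f x.
Definition cut2 (k : R -> R -> R) (x y : R) : R := ind (in_horizon x) * ind (in_horizon y) * k x y.
Definition le_kernel (x u : R) : R := ind (x <= u).
(** The kernel of [1^* 1]; on the horizon it equals [T - max x y]. *)
Definition mkern (x y : R) : R := ip mu (le_kernel x) (le_kernel y).
Definition Gc := cut2 (Gt G rho).
(** [2 lam + kap] is the operator [D_0] of the statement, and [D_t] is its compression to [[t, T]];
    see [D_opE]. *)
Definition kap (x y : R) : R := Gc x y + Gc y x + 2 * phi * mkern x y.

Lemma measurable_inT d (X : measurableType d) (f : X -> R) :
  measurable_fun setT f -> measurable_fun setT (fun x => ind (in_horizon (f x)) : R).
Proof.
move=> mf; apply: measurable_ind; apply: measurable_and; exact: measurable_fun_ler.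
Qed.

Lemma measurable_inT_id : measurable_fun setT (fun x : R => ind (in_horizon x) : R).
Proof. by apply: measurable_inT. Qed.

Lemma cutTE f x : in_horizon x -> cut_horizon f x = f x.
Proof. by move=> h; rewrite /cut_horizon h mul1r. Qed.

Lemma cutT_ae f : {ae mu, forall x, cut_horizon f x = f x}.
Proof. by apply: filterS (muT_ae_in T) => x; exact: cutTE. Qed.

Lemma measurable_cutT f : measurable_fun (Icc 0 T) f -> measurable_fun setT (cut_horizon f).
Proof.
move=> /(measurable_restrictT _ (measurable_Icc 0 T)).
congr (measurable_fun _ _); apply/funext => x; rewrite patchE /cut_horizon /ind.
case: ifPn => [/set_mem h|/negP h]; first by rewrite (_ : in_horizon x = true)// mul1r.
by rewrite ifF ?mul0r//; apply/negP => h'; apply: h; apply/mem_set.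
Qed.

Lemma sq_int_L2 f : sq_int T f <-> measurable_fun (Icc 0 T) f /\ L2 mu (cut_horizon f).
Proof.
have E : measurable_fun (Icc 0 T) f ->
    (\int[mu]_s ((cut_horizon f s ^+ 2)%R)%:E = \int[leb]_(s in Icc 0 T) ((f s) ^+ 2)%:E)%E.
  move=> mf; rewrite integral_muT.
    by apply: eq_integral => x /set_mem h; rewrite cutTE.
  by apply/measurable_EFinP; apply: measurable_funX; exact: measurable_cutT.
split=> -[mf h]; split=> //.
  split; first exact: measurable_cutT.
  apply/integrableP; split.
    by apply/measurable_EFinP; apply: measurable_funX; exact: measurable_cutT.
  under eq_integral do rewrite /= ger0_norm ?sqr_ge0//.
  by rewrite E.
rewrite -E//; have /integrableP[_] := h.2.
by under eq_integral do rewrite /= ger0_norm ?sqr_ge0//.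
Qed.

Lemma L2_sq_int f : L2 mu f -> sq_int T f.
Proof.
move=> Lf; apply/sq_int_L2; split; first exact: measurable_funS (L2_measurable Lf).
apply: (@L2_bndM _ _ _ _ 1) => // [|x]; last exact: norm_ind.
exact: measurable_inT.
Qed.

Lemma kern_le_kernel : kern mu le_kernel.
Proof.
apply: (@kern_bnd _ _ _ _ 1); first exact: measurable_ind_le.
by move=> ? ?; exact: norm_ind.
Qed.

Lemma kern_mkern : kern mu mkern.
Proof. exact: kern_comp kern_le_kernel kern_le_kernel. Qed.

Lemma measurable_cut2 (k : R -> R -> R) :
  measurable_fun setT (fun p : R * R => k p.1 p.2) ->
  measurable_fun setT (fun p : R * R => cut2 k p.1 p.2).
Proof.
move=> mk; apply: measurable_funM => //; apply: measurable_funM.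
  exact: (measurable_inT measurable_fst).
exact: (measurable_inT measurable_snd).
Qed.

Lemma kern_cut2G : kern mu (cut2 G).
Proof.
have [mG [_ [_ [_ [[C [C1 C2]] _]]]]] := GK.
have m2 := measurable_cut2 mG.
(* Rows and columns outside the horizon vanish; the maximum with 0 covers them. *)
exists (Num.max C 0); split=> // x.
  have mx := measurable_fun_pair2 x m2.
  apply/(L2_norm_leP _ _ mx); rewrite integral_muT; last first.
    by apply/measurable_EFinP; exact: measurable_funX.
  have [xT|xT] := boolP (in_horizon x).
    apply: (@le_trans _ _ C%:E); last by rewrite lee_fin le_max lexx.
    apply: le_trans (C1 x xT).
    rewrite le_eqVlt; apply/orP; left; apply/eqP; apply: eq_integral => y /set_mem yT.
    by rewrite /cut2 /= xT (_ : in_horizon y = true)// !mul1r.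
  rewrite (eq_integral (cst 0%E)); last first.
    by move=> y _; rewrite /cut2 /= (negbTE xT) !mul0r expr0n.
  by rewrite integral0 lee_fin le_max lexx orbT.
have mx := measurable_fun_pair1 x m2.
apply/(L2_norm_leP _ _ mx); rewrite integral_muT; last first.
  by apply/measurable_EFinP; exact: measurable_funX.
have [xT|xT] := boolP (in_horizon x).
  apply: (@le_trans _ _ C%:E); last by rewrite lee_fin le_max lexx.
  apply: le_trans (C2 x xT).
  rewrite le_eqVlt; apply/orP; left; apply/eqP; apply: eq_integral => y /set_mem yT.
  by rewrite /cut2 /= xT (_ : in_horizon y = true)// !mul1r.
rewrite (eq_integral (cst 0%E)); last first.
  by move=> y _; rewrite /cut2 /= (negbTE xT) mulr0 !mul0r expr0n.
by rewrite integral0 lee_fin le_max lexx orbT.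
Qed.

Let ltk := cut2 (fun x y => ind (y < x)).

Lemma kern_ltk : kern mu ltk.
Proof.
apply: (@kern_bnd _ _ _ _ 1).
  apply: measurable_cut2; apply: measurable_ind; apply: measurable_fun_ltr.
    exact: measurable_snd.
  exact: measurable_fst.
move=> x y; rewrite /ltk /cut2 !normrM.
by rewrite mulr_ile1 ?normr_ge0 ?norm_ind// ?mulr_ge0// mulr_ile1 ?norm_ind.
Qed.

Lemma GcE x y : Gc x y = 2 * rho * ltk x y + cut2 G x y.
Proof. by rewrite /Gc /cut2 /Gt /ltk /cut2; ring. Qed.

Lemma kern_Gc : kern mu Gc.
Proof.
have := kernD (kernZ (2 * rho) kern_ltk) kern_cut2G.
by congr kern; apply/funext => x; apply/funext => y; rewrite GcE.
Qed.

Lemma kern_kap : kern mu kap.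
Proof.
apply: kernD; last exact: kernZ kern_mkern.
by apply: kernD; [exact: kern_Gc|exact: kernT kern_Gc].
Qed.

Lemma mkern_sym x y : mkern x y = mkern y x. Proof. exact: ipC. Qed.

Lemma kap_sym x y : kap x y = kap y x.
Proof. by rewrite /kap mkern_sym; ring. Qed.

Lemma ip_OpT k f : kern mu k -> L2 mu f ->
  ip mu f (Op mu (fun x y => k y x) f) = ip mu f (Op mu k f).
Proof. by move=> kk Lf; rewrite [RHS](Op_adj kk Lf Lf) ipC. Qed.

(** The kernel and its transpose add up to 1 off the diagonal, which is null, and the quadratic form
    of the constant kernel 1 is the squared integral. *)
Lemma ip_le_sqr f : L2 mu f ->
  2 * ip mu f (Op mu (fun x y => le_kernel y x) f) = (\int[mu]_x f x) ^+ 2.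
Proof.
move=> Lf; have kl := kernT kern_le_kernel; have LO := L2_Op kl Lf.
have LT := L2_Op (kernT kl) Lf.
have : ip mu f (fun x => Op mu (fun x y => le_kernel y x) f x + Op mu le_kernel f x)
    = (\int[mu]_x f x) ^+ 2.
  rewrite ipC (eq_ip (f' := fun=> \int[mu]_y f y) (g' := f) mu)//.
    by rewrite /ip RintegralZl ?expr2//; exact: L2_integrable.
  move=> x; have Lk := kern_row x kl; have Lc := kern_col x kl.
  rewrite /Op -ipDl// (@ip_ae _ _ _ _ _ (fun=> 1)).
  - by apply: eq_Rintegral => y _; rewrite mul1r.
  - exact: (L2_measurable (L2D Lk Lc)).
  - by [].
  - exact: L2_measurable Lf.
  - apply: filterS (muT_ae_neq T x) => y yx; rewrite /le_kernel /ind.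
    by case: ltgtP yx => // [_ _|_ _]; rewrite ?addr0 ?add0r.
rewrite (ipDr LO LT Lf) -(ip_OpT (kernT kl) Lf) => <-.
by move: (ip _ _ _) => a; ring.
Qed.

Lemma ltk_ge0 f : L2 mu f -> 0 <= ip mu f (Op mu ltk f).
Proof.
move=> Lf; have kl := kernT kern_le_kernel.
have -> : ip mu f (Op mu ltk f) = ip mu f (Op mu (fun x y => le_kernel y x) f).
  rewrite ipC [RHS]ipC; apply: ip_ae.
  - exact: (L2_measurable (L2_Op kern_ltk Lf)).
  - exact: (L2_measurable (L2_Op kl Lf)).
  - exact: (L2_measurable Lf).
  apply: filterS (muT_ae_in T) => x xT; apply: ip_ae.
  - exact: (L2_measurable (kern_row x kern_ltk)).
  - exact: (L2_measurable (kern_row x kl)).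
  - exact: (L2_measurable Lf).
  apply: filterS2 (muT_ae_neq T x) (muT_ae_in T) => y yx yT.
  rewrite /ltk /cut2 (_ : in_horizon x = true)// (_ : in_horizon y = true)// !mul1r /le_kernel le_eqVlt.
  by rewrite (_ : (y == x) = false)//; apply/eqP.
have := sqr_ge0 (\int[mu]_x f x); rewrite -ip_le_sqr//; lra.
Qed.

Lemma cut2G_ge0 f : L2 mu f -> 0 <= ip mu f (Op mu (cut2 G) f).
Proof.
move=> Lf; have kG := kern_cut2G; have LO := L2_Op kG Lf; have LT := L2_Op (kernT kG) Lf.
have [_ [_ [_ [/(_ f (L2_sq_int Lf)) nn _]]]] := GK.
have E : RInt 0 T (fun t => RInt 0 T (fun s => (G t s + G s t) * f s * f t)) =
   ip mu f (fun x => Op mu (cut2 G) f x + Op mu (fun x y => cut2 G y x) f x).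
  have mg : measurable_fun setT (fun x => f x * (Op mu (cut2 G) f x + Op mu (fun x y => cut2 G y x) f x)).
    apply: measurable_funM; first exact: L2_measurable Lf.
    exact: (L2_measurable (L2D LO LT)).
  rewrite (@RInt_muT _ T _ _ _ (fun x => f x * (Op mu (cut2 G) f x + Op mu (fun x y => cut2 G y x) f x)))//.
    apply: ae_Rintegral => //.
      by apply: measurable_funM => //; exact: measurable_inT_id.
    by apply: filterS (muT_ae_in T) => x xT; rewrite (_ : (_ && _) = true)// mul1r.
  move=> x xT; have Lk := kern_row x kG; have Lc := kern_col x kG.
  rewrite /Op -ipDl//.
  have mgx : measurable_fun setT (fun y => (cut2 G x y + cut2 G y x) * f y * f x).
    apply: measurable_funM => //; apply: measurable_funM; last exact: L2_measurable Lf.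
    exact: (L2_measurable (L2D Lk Lc)).
  rewrite (@RInt_muT _ T _ _ _ (fun y => (cut2 G x y + cut2 G y x) * f y * f x))//.
    rewrite /ip mulrC -RintegralZr//; last exact: L2_mul (L2D Lk Lc) Lf.
    apply: ae_Rintegral => //.
      by apply: measurable_funM => //; exact: measurable_inT_id.
    by apply: filterS (muT_ae_in T) => y yT; rewrite (_ : (_ && _) = true)// mul1r.
  move=> y yT; rewrite /cut2 (_ : in_horizon x = true)// (_ : in_horizon y = true)// !mul1r; ring.
move: nn; rewrite E ipDr// (ip_OpT kG Lf); lra.
Qed.

Lemma Op_mkern f x : L2 mu f ->
  Op mu mkern f x = ip mu (le_kernel x) (Op mu (fun x y => le_kernel y x) f).
Proof.
move=> Lf; rewrite (Op_adj (kernT kern_le_kernel) Lf (kern_row x kern_le_kernel)).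
by apply: eq_ip => // y; rewrite /mkern ipC.
Qed.

(** Three nonnegative forms: the permanent impact gives a multiple of the squared integral of [f],
    the kernel [G] is nonnegative by assumption, and [mkern] gives the squared norm of the running
    integral of [f]. *)
Lemma kap_ge0 f : L2 mu f -> 0 <= ip mu f (Op mu kap f).
Proof.
move=> Lf.
have kG := kern_Gc; have LG := L2_Op kG Lf; have LGT := L2_Op (kernT kG) Lf.
have Lm := L2_Op kern_mkern Lf.
have -> : ip mu f (Op mu kap f) = 2 * ip mu f (Op mu Gc f) + 2 * phi * ip mu f (Op mu mkern f).
  have E x : Op mu kap f x = Op mu Gc f x + Op mu (fun x y => Gc y x) f x + 2 * phi * Op mu mkern f x.
    have Lk := kern_row x kG; have Lc := kern_col x kG; have Lmx := kern_row x kern_mkern.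
    rewrite /Op -ipZl// -ipDl// -ipDl//; [exact: L2D|exact: L2Z].
  rewrite (eq_ip mu (fun=> erefl) E) (ipDr (L2D LG LGT) (L2Z (2 * phi) Lm) Lf).
  rewrite (ipDr LG LGT Lf) (ipZr _ Lm Lf) (ip_OpT kG Lf).
  by move: (ip _ _ _) (ip _ _ _) => a b; ring.
have h1 : 0 <= ip mu f (Op mu Gc f).
  have L1 := L2_Op kern_ltk Lf; have L2' := L2_Op kern_cut2G Lf.
  have E x : Op mu Gc f x = 2 * rho * Op mu ltk f x + Op mu (cut2 G) f x.
    have Lk := kern_row x kern_ltk; have Lc := kern_row x kern_cut2G.
    rewrite /Op -ipZl// -ipDl//; last exact: L2Z.
    by apply: eq_ip => // y; exact: GcE.
  rewrite (eq_ip mu (fun=> erefl) E) ipDr//; last exact: L2Z.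
  rewrite ipZr// addr_ge0// ?cut2G_ge0// mulr_ge0 ?ltk_ge0//.
  by rewrite mulr_ge0.
have h2 : 0 <= ip mu f (Op mu mkern f).
  have LT := L2_Op (kernT kern_le_kernel) Lf.
  rewrite (eq_ip mu (fun=> erefl) (fun x => Op_mkern x Lf)).
  have -> : ip mu f (fun x => ip mu (le_kernel x) (Op mu (fun x y => le_kernel y x) f)) =
     ip mu (Op mu (fun x y => le_kernel y x) f) (Op mu (fun x y => le_kernel y x) f).
    exact: (Op_adj kern_le_kernel LT Lf).
  exact: ip_ge0.
apply: addr_ge0; first exact: mulr_ge0 (ler0n _ 2) h1.
exact: mulr_ge0 (mulr_ge0 (ler0n _ 2) phi0) h2.
Qed.

End model_kernel.

(** * The operators of the statement as kernel operators *)

Section operators.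
Context (R : realType).
Variables (T rho phi lam : R) (G : R -> R -> R).
Hypothesis T0 : 0 < T.
Hypothesis rho0 : 0 <= rho.
Hypothesis phi0 : 0 <= phi.
Hypothesis lam0 : 0 < lam.
Hypothesis GK : kernel_class T G.
Let mu := muT T.
Let K := kap T rho phi G.
Let kK : kern mu K := kern_kap rho phi GK.
Variable r : R -> R -> R.
Hypothesis kr : kern mu r.
Hypothesis r_supp : forall s x, x < s -> r s x = 0.
Hypothesis r_eq : forall s x, s <= x ->
  2 * lam * r s x + ip mu (K x) (r s) = K s x.

Local Notation cutT := (cut_horizon T).
Local Notation inT := (in_horizon T).
Local Notation A := (Aop mu r).
Local Notation D := (Dop mu K lam).
Local Notation Di := (Dinv mu r lam).
Local Notation le_k := (@le_kernel R).
Local Notation leT := (fun x y : R => le_kernel y x).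

Lemma RInt_full (f g : R -> R) : measurable_fun setT g ->
  (forall x, inT x -> f x = g x) -> RInt 0 T f = \int[mu]_x g x.
Proof.
move=> mg fg; rewrite (@RInt_muT _ T _ _ _ g)//.
apply: ae_Rintegral => //.
  by apply: measurable_funM => //; exact: measurable_inT_id.
by apply: filterS (muT_ae_in T) => x xT; rewrite (_ : (_ && _) = true)// mul1r.
Qed.

Let kle : kern mu le_k := kern_le_kernel T.

Lemma L2_cutT f : L2 mu f -> L2 mu (cutT f).
Proof.
move=> Lf; apply: (@L2_bndM _ _ _ _ 1) => // [|x]; last exact: norm_ind.
exact: measurable_inT_id.
Qed.

Lemma one_opE t f u : L2 mu (cutT f) ->
  one_op T t f u = Op mu leT (fun s => ind (t <= s) * cutT f s) u.
Proof.
move=> Lf; apply: RInt_full.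
  exact: measurable_funM (L2_measurable (kern_col u kle)) (L2_measurable (L2_ind_le t Lf)).
by move=> x xT; rewrite /le_kernel cutTE// mulrA.
Qed.

Lemma one_adjE t f s : L2 mu (cutT f) ->
  one_adj T t f s = ind (t <= s) * Op mu le_k (cutT f) s.
Proof.
move=> Lf; rewrite /Op /ip -RintegralZl//; last exact: L2_mul (kern_row s kle) Lf.
apply: RInt_full.
  apply: measurable_funM => //.
  exact: measurable_funM (L2_measurable (kern_row s kle)) (L2_measurable Lf).
by move=> x xT; rewrite /le_kernel cutTE//; ring.
Qed.

Lemma L2_one_op t f : L2 mu (cutT f) -> L2 mu (one_op T t f).
Proof.
move=> Lf; have := L2_Op (kernT kle) (L2_ind_le t Lf).
by congr (L2 _ _); apply/funext => u; rewrite one_opE.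
Qed.

Lemma L2_one_adj t f : L2 mu (cutT f) -> L2 mu (one_adj T t f).
Proof.
move=> Lf; have := L2_ind_le t (L2_Op kle Lf).
by congr (L2 _ _); apply/funext => u; rewrite one_adjE.
Qed.

Lemma Gt_causal x y : inT x -> inT y -> x <= y -> Gt G rho x y = 0.
Proof.
move=> xT yT xy; have [_ [_ [G0 _]]] := GK.
by rewrite /Gt G0// ltNge xy /ind mulr0 addr0.
Qed.

Lemma Gc_causal x y : x <= y -> Gc T rho G x y = 0.
Proof.
move=> xy; rewrite /Gc /cut2.
have [xT|_] := boolP (inT x); last by rewrite !mul0r.
have [yT|_] := boolP (inT y); last by rewrite mulr0 mul0r.
by rewrite Gt_causal ?mulr0.
Qed.

Lemma Gc_in x y : inT x -> inT y -> Gc T rho G x y = Gt G rho x y.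
Proof. by move=> xT yT; rewrite /Gc /cut2 xT yT !mul1r. Qed.

Let kGc : kern mu (Gc T rho G) := kern_Gc rho GK.

Lemma Gt_opE t f s : L2 mu (cutT f) -> inT s ->
  Gt_op T G rho t f s = Op mu (Gc T rho G) (fun x => ind (t <= x) * cutT f x) s.
Proof.
move=> Lf sT; apply: RInt_full.
  exact: measurable_funM (L2_measurable (kern_row s kGc)) (L2_measurable (L2_ind_le t Lf)).
by move=> x xT; rewrite Gc_in// cutTE// mulrA.
Qed.

Lemma Gt_adjE t f s : L2 mu (cutT f) -> inT s -> t <= s ->
  Gt_adj T G rho t f s =
  Op mu (fun x y => Gc T rho G y x) (fun x => ind (t <= x) * cutT f x) s.
Proof.
move=> Lf sT ts; apply: RInt_full.
  exact: measurable_funM (L2_measurable (kern_col s kGc)) (L2_measurable (L2_ind_le t Lf)).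
move=> x xT; rewrite cutTE// ts mulr1.
have [xs|sx] := leP x s; first by rewrite Gt_causal// Gc_causal// !mul0r.
by rewrite Gc_in// (le_trans ts (ltW sx)) mul1r.
Qed.

Lemma KopE f s : L2 mu f -> Op mu K f s = Op mu (Gc T rho G) f s
  + Op mu (fun x y => Gc T rho G y x) f s + 2 * phi * Op mu (mkern T) f s.
Proof.
move=> Lf; have Lk := kern_row s kGc; have Lc := kern_col s kGc.
have Lm := kern_row s (kern_mkern T).
by rewrite /Op -ipZl// -ipDl// -ipDl//; [exact: L2D|exact: L2Z].
Qed.

(** At arguments [s >= t] all the cutoffs may be moved onto [f]. For the adjoint of [G] this is
    causality: only [u > s >= t] contributes. *)
Lemma D_opE t f s : L2 mu (cutT f) -> inT s -> t <= s ->
  D_op T G rho lam phi t f s = D (fun x => ind (t <= x) * cutT f x) s.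
Proof.
move=> Lf sT ts; have Li := L2_ind_le t Lf.
rewrite /D_op /Dop KopE// Gt_opE// Gt_adjE// ts mul1r cutTE//.
have Lo := L2_one_op t Lf.
rewrite one_adjE; last exact: L2_cutT.
rewrite ts mul1r Op_mkern//; set a := Op mu le_k _ s; set b := ip mu _ _.
have -> : a = b.
  rewrite /a /b /Op ipC [RHS]ipC; apply: ip_ae.
  - exact: L2_measurable (L2_cutT Lo).
  - exact: (L2_measurable (L2_Op (kernT kle) Li)).
  - exact: (L2_measurable (kern_row s kle)).
  - by apply: filterS (cutT_ae T (one_op T t f)) => x ->; rewrite one_opE.
by ring.
Qed.

Lemma D_op_lt t f s : L2 mu (cutT f) -> inT s -> s < t ->
  D_op T G rho lam phi t f s = 2 * lam * f s.
Proof.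
move=> Lf sT st; rewrite /D_op Gt_opE// /Op.
have -> : ip mu (Gc T rho G s) (fun x => ind (t <= x) * cutT f x) = 0.
  rewrite /ip (@eq_Rintegral _ _ _ _ _ (fun=> 0)).
    by rewrite Rintegral_cst// mul0r.
  move=> x _; have [xt|tx] := ltP x t; first by rewrite mul0r mulr0.
  by rewrite Gc_causal ?mul0r// ltW// (lt_le_trans st).
have -> : Gt_adj T G rho t f s = 0.
  rewrite /Gt_adj /RInt (@eq_Rintegral _ _ _ _ _ (fun=> 0)).
    rewrite Rintegral_cst ?mul0r//; exact: measurable_Icc.
  by move=> x _; rewrite leNgt st mulr0 mul0r.
rewrite one_adjE; last by apply: L2_cutT; exact: L2_one_op.
by rewrite leNgt st mul0r mulr0 !addr0.
Qed.

Let kge0 f : L2 mu f -> 0 <= ip mu f (Op mu K f) := kap_ge0 rho0 phi0 GK (f := f).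
Let Dop_Di t f x := Dop_Dinv kK (kap_sym T rho phi G) lam0 (muT_set1 T) (muT_weight T0) kr r_supp r_eq
  (t := t) (f := f) (x := x).

Let L2_Di t f : L2 mu f -> L2 mu (Di t f).
Proof. exact: L2_Dinv. Qed.

(** [epsilon] gives a function once the equation is known to be solvable, and [Dinv_unique] then
    identifies it. The comparison is restricted to [[t, T]]: [Dinv] vanishes to the left, where
    [D_inv] in general does not. *)
Lemma D_invP t f : L2 mu (cutT f) ->
  sq_int T (D_inv T G rho lam phi t f) /\
  {ae mu, forall x, ind (t <= x) * cutT (D_inv T G rho lam phi t f) x = Di t (cutT f) x}.
Proof.
move=> Lf.
have l2 : 2 * lam != 0 by rewrite mulf_neq0// gt_eqF.
have ex : exists g, sq_int T g /\
    {ae leb, forall s, Icc 0 T s -> D_op T G rho lam phi t g s = f s}.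
  (* Left of [t] the operator [D_op t] is multiplication by [2 lam]. *)
  pose g0 x := ind (t <= x) * Di t (cutT f) x + ind (x < t) * ((2 * lam)^-1 * cutT f x).
  have Lg0 : L2 mu g0.
    apply: L2D; first by apply: L2_ind_le; exact: L2_Di.
    apply: (@L2_bndM _ _ _ _ 1); last exact: L2Z.
      by apply: measurable_ind; exact: measurable_fun_ltr.
    by move=> x; exact: norm_ind.
  suff h (s : R) : inT s -> D_op T G rho lam phi t g0 s = f s.
    by exists g0; split; [exact: L2_sq_int|apply: nearW => s; exact: h].
  move=> sT; have [st|ts] := ltP s t.
    rewrite D_op_lt//; last exact: L2_cutT.
    rewrite /g0 leNgt st /= mul0r mul1r add0r mulrA mulfV// mul1r.
    by rewrite (cutTE _ sT).
  rewrite D_opE//; last exact: L2_cutT.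
  rewrite -[RHS](cutTE f sT) -(Dop_Di Lf ts) /Dop; congr (_ + _).
    by rewrite ts mul1r (cutTE _ sT) /g0 ts mul1r ltNge ts /= mul0r addr0.
  rewrite /Op ipC [RHS]ipC; apply: ip_ae.
  - exact: L2_measurable (L2_ind_le t (L2_cutT Lg0)).
  - exact: L2_measurable (L2_Di t Lf).
  - exact: (L2_measurable (kern_row s kK)).
  - apply: filterS (cutT_ae T g0) => x ->; rewrite /g0.
    have [xt|tx] := ltP x t; first by rewrite mul0r Dinv_supp.
    by rewrite !mul1r mul0r addr0.
have [sg ag] := ClassicalEpsilon.epsilon_spec (inhabits (fun _ : R => 0)) _ ex.
split=> //; have [mg Lg] := (sq_int_L2 T _).1 sg.
apply: (Dinv_unique kK (kap_sym T rho phi G) lam0 kge0 (muT_set1 T) (muT_weight T0) kr r_supp r_eq Lf).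
- exact: L2_ind_le.
- by apply: nearW => x xt; rewrite leNgt xt mul0r.
- move: ag => /muT_ae; apply: filterS2 (muT_ae_in T) => x xT e tx.
  by rewrite (cutTE f xT) -e D_opE.
Qed.

Lemma DinvB t c f g x : L2 mu f -> L2 mu g ->
  Di t (fun y => f y - c * g y) x = Di t f x - c * Di t g x.
Proof.
move=> Lf Lg; have LZ := L2Z c Lg.
have LA := L2_ind_le t (L2_Aop kr Lf); have LB := L2_ind_le t (L2_Aop kr Lg).
rewrite /Dinv /Aadj.
have E s : ind (t <= s) * A (fun y => f y - c * g y) s =
   ind (t <= s) * A f s - c * (ind (t <= s) * A g s).
  by rewrite (AopB kr)// (AopZ kr)//; ring.
rewrite E (eq_ip mu (fun=> erefl) E) ipBr//; [|exact: L2Z|exact: kern_col].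
rewrite (ipZr _ LB (kern_col x kr)).
by move: (A f x) (A g x) (ip _ _ _) (ip _ _ _) (ind _) (_^-1) => a b e1 e2 i l; ring.
Qed.

Lemma Dinv_sym t f g : L2 mu f -> L2 mu g -> ip mu g (Di t f) = ip mu f (Di t g).
Proof.
move=> Lf Lg; rewrite (ip_Dinv lam kr t Lf Lg) (ip_Dinv lam kr t Lg Lf); congr (_ * _).
by apply: eq_Rintegral => s _; rewrite mulrCA [RHS]mulrCA (mulrC (A g s)).
Qed.

(** The resolvent equation read on [[t, T]] says that [r t] is [D_t^-1] of the row of [kap] at [t].
    This is how [r] emerges from [Gamma_t^-1 K_t]. *)
Lemma Dinv_resolvent t f : L2 mu f ->
  (forall x, inT x -> t <= x -> f x = K t x) -> {ae mu, forall x, r t x = Di t f x}.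
Proof.
move=> Lf fK.
apply: (Dinv_unique kK (kap_sym T rho phi G) lam0 kge0 (muT_set1 T) (muT_weight T0) kr r_supp r_eq Lf).
- exact: kern_row.
- by apply: nearW => x xt; exact: r_supp.
- apply: filterS (muT_ae_in T) => x xT tx.
  by rewrite fK// -r_eq.
Qed.

(* The function to which [D_t^-1] is effectively applied in [Gamma_t^-1 (f1, f2)]. *)
Definition gam t f1 f2 : R -> R := fun x => cutT f1 x - 2 * phi * cutT (one_adj T t f2) x.

Lemma L2_gam t f1 f2 : L2 mu (cutT f1) -> L2 mu (cutT f2) -> L2 mu (gam t f1 f2).
Proof.
by move=> L1 L2'; apply: L2B => //; apply: L2Z; apply: L2_cutT; exact: L2_one_adj.
Qed.

Lemma Ginv_ip t f1 f2 g1 g2 : L2 mu (cutT f1) -> L2 mu (cutT f2) ->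
  L2 mu (cutT g1) -> L2 mu (cutT g2) ->
  (forall x, inT x -> x < t -> g1 x = 0) ->
  ip2 T (Ginv1 T G rho lam phi t f1 f2) (Ginv2 T G rho lam phi t f1 f2) g1 g2 =
  ip mu (gam t g1 g2) (Di t (gam t f1 f2)) - 2 * phi * ip mu (cutT f2) (cutT g2).
Proof.
move=> Lf1 Lf2 Lg1 Lg2 g1t.
have Lo2 := L2_cutT (L2_one_adj t Lf2).
have [s1 ae1] := D_invP t Lf1; have [s2 ae2] := D_invP t Lo2.
have [_ Ls1] := (sq_int_L2 T _).1 s1; have [_ Ls2] := (sq_int_L2 T _).1 s2.
set d1 := D_inv T G rho lam phi t f1 in s1 ae1 Ls1.
set d2 := D_inv T G rho lam phi t (one_adj T t f2) in s2 ae2 Ls2.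
have Lv1 := L2_Di t Lf1; have Lv2 := L2_Di t Lo2.
pose v := Di t (gam t f1 f2).
have vE x : v x = Di t (cutT f1) x - 2 * phi * Di t (cutT (one_adj T t f2)) x.
  exact: DinvB.
have Lv : L2 mu v by apply: L2_Di; exact: L2_gam.
pose h1 s := cutT d1 s - 2 * phi * cutT d2 s.
pose h2 s := - 2 * phi * one_op T t d1 s
  + (- 2 * phi * cutT f2 s + 4 * phi ^+ 2 * one_op T t d2 s).
have Lh1 : L2 mu h1 by apply: L2B => //; exact: L2Z.
have opE d e : L2 mu (cutT d) -> L2 mu e ->
    {ae mu, forall x, ind (t <= x) * cutT d x = e x} ->
    forall u, one_op T t d u = Op mu leT e u.
  move=> Ld Le ae u; rewrite one_opE// /Op ipC [RHS]ipC; apply: ip_ae => //.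
  - exact: (L2_measurable (L2_ind_le t Ld)).
  - exact: (L2_measurable Le).
  - exact: (L2_measurable (kern_col u kle)).
have Lop := L2_Op (kernT kle) Lv.
have h2E u : h2 u = - 2 * phi * Op mu leT v u - 2 * phi * cutT f2 u.
  rewrite /h2 (opE _ _ Ls1 Lv1 ae1) (opE _ _ Ls2 Lv2 ae2).
  have Lu := kern_col u kle.
  have : Op mu leT v u = Op mu leT (Di t (cutT f1)) u
      - 2 * phi * Op mu leT (Di t (cutT (one_adj T t f2))) u.
    apply: etrans (eq_ip mu (fun=> erefl) vE) _.
    by apply: etrans (ipBr Lv1 (L2Z _ Lv2) Lu) _; rewrite (ipZr _ Lv2 Lu).
  generalize (Op mu leT v u) (Op mu leT (Di t (cutT f1)) u)
    (Op mu leT (Di t (cutT (one_adj T t f2))) u) (cutT f2 u) => z a b c ->.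
  by ring.
have Lh2 : L2 mu h2.
  have : L2 mu (fun u => - 2 * phi * Op mu leT v u - 2 * phi * cutT f2 u).
    by apply: L2B; exact: L2Z.
  by congr (L2 _ _); apply/funext => u; rewrite h2E.
transitivity (ip mu h1 (cutT g1) + ip mu h2 (cutT g2)).
  rewrite /ip -RintegralD//; [|exact: L2_mul|exact: L2_mul].
  apply: RInt_full.
    apply: measurable_funD; apply: measurable_funM; [exact: (L2_measurable Lh1)|
      exact: (L2_measurable Lg1)|exact: (L2_measurable Lh2)|exact: (L2_measurable Lg2)].
  move=> x xT; rewrite /Ginv1 /Ginv2 -/d1 -/d2 /h1 /h2.
  by rewrite !(cutTE _ xT).
have -> : ip mu h1 (cutT g1) = ip mu v (cutT g1).
  apply: ae_Rintegral.
  - by apply: measurable_funM; [exact: (L2_measurable Lh1)|exact: (L2_measurable Lg1)].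
  - by apply: measurable_funM; [exact: (L2_measurable Lv)|exact: (L2_measurable Lg1)].
  - apply: filterS3 ae1 ae2 (muT_ae_in T) => x e1 e2 xT.
    have [xt|tx] := ltP x t; first by rewrite (cutTE _ xT) g1t// !mulr0.
    by move: e1 e2; rewrite tx !mul1r vE /h1 => -> ->.
have -> : ip mu h2 (cutT g2) = - 2 * phi * ip mu (Op mu leT v) (cutT g2)
   - 2 * phi * ip mu (cutT f2) (cutT g2).
  rewrite (eq_ip mu h2E (fun=> erefl)) ipBl//; [|exact: L2Z|exact: L2Z].
  by rewrite !ipZl.
have -> : ip mu (Op mu leT v) (cutT g2) = ip mu (Op mu le_k (cutT g2)) v.
  by rewrite ipC (Op_adj (kernT kle)).
have Lo := L2_one_adj t Lg2; have Log := L2_Op kle Lg2.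
rewrite {1}/gam ipBl//; [|exact: L2Z (L2_cutT Lo)].
rewrite ipZl//; last exact: L2_cutT.
have -> : ip mu (cutT (one_adj T t g2)) v = ip mu (Op mu le_k (cutT g2)) v.
  apply: ae_Rintegral.
  - by apply: measurable_funM; [exact: (L2_measurable (L2_cutT Lo))|exact: (L2_measurable Lv)].
  - by apply: measurable_funM; [exact: (L2_measurable Log)|exact: (L2_measurable Lv)].
  - apply: filterS (muT_ae_in T) => x xT.
    have [xt|tx] := ltP x t; first by rewrite /v Dinv_supp// !mulr0.
    by rewrite (cutTE _ xT) one_adjE// tx mul1r.
rewrite (ipC mu v); move: (ip _ _ _) (ip _ _ _) (ip _ _ _).
by clear => a b c; ring.
Qed.

(** No integrability is required, since [fine] sends every infinite value to 0; [Theta_ip2] can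
    therefore be stated for an arbitrary [c]. *)
Lemma RInt_opp a b (f : R -> R) : RInt a b (fun s => - f s) = - RInt a b f.
Proof.
rewrite /RInt /Rintegral integralE [X in - fine X]integralE.
rewrite (_ : (fun x => (- f x)%:E) = \- (fun x => (f x)%:E))%E; last first.
  by apply/funext => x; rewrite EFinN.
rewrite funeposN funenegN.
have : (0 <= \int[leb]_(x in Icc a b) ((fun x => (f x)%:E)^\+ x))%E by exact: integral_ge0.
have : (0 <= \int[leb]_(x in Icc a b) ((fun x => (f x)%:E)^\- x))%E by exact: integral_ge0.
case: (\int[_]_(_ in _) _)%E => [u||] //= _; case: (\int[_]_(_ in _) _)%E => [v||] //= _;
  rewrite ?oppr0 ?opprB//.
Qed.

Lemma ip2C f1 f2 g1 g2 : ip2 T f1 f2 g1 g2 = ip2 T g1 g2 f1 f2.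
Proof. by apply: eq_Rintegral => s _; rewrite (mulrC (f1 s)) (mulrC (f2 s)). Qed.

Lemma Theta_ip2 t c g1 g2 :
  ip2 T (Theta1 T G rho lam phi t c) (Theta2 T G rho lam phi t c) g1 g2 =
  - ip2 T (Ginv1 T G rho lam phi t (fun x => ind (t <= x) * c x) (fun=> 0))
          (Ginv2 T G rho lam phi t (fun x => ind (t <= x) * c x) (fun=> 0)) g1 g2.
Proof.
rewrite /ip2 -RInt_opp; apply: eq_Rintegral => s _.
by rewrite /Theta1 /Theta2 !mulNr opprD.
Qed.

Lemma L2_cutT_cst c : L2 mu (cutT (fun=> c)).
Proof. by apply: L2_cutT; exact: L2_cst. Qed.

Lemma gam0 t c x : L2 mu (cutT c) ->
  gam t (fun x => ind (t <= x) * c x) (fun=> 0) x = ind (t <= x) * cutT c x.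
Proof.
move=> Lc; rewrite /gam {2}/cutT one_adjE; last exact: L2_cutT_cst.
rewrite /Op (eq_ip (g' := fun=> 0) mu (fun=> erefl)).
  by rewrite ip0r !mulr0 subr0 /cutT; ring.
by move=> y; rewrite /cutT mulr0.
Qed.

Section at_time.
Variable t : R.
Hypothesis tT : inT t.

Lemma L2_K1 : L2 mu (cutT (K1 G rho t)).
Proof.
have := kern_col t kGc; congr (L2 _ _); apply/funext => x.
by rewrite /Gc /cut2 /cutT /K1 tT mulr1.
Qed.

Lemma L2_K2 : L2 mu (cutT (@K2 R t)).
Proof.
apply: L2_cutT; apply: (@L2_bnd _ _ _ _ 1).
  apply: measurableT_comp => //; apply: measurable_ind; exact: measurable_fun_ler.
by move=> x; rewrite normrN; exact: norm_ind.
Qed.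

Lemma K1_lt x : inT x -> x < t -> K1 G rho t x = 0.
Proof. by move=> xT xt; apply: Gt_causal => //; exact: ltW. Qed.

Lemma cutT_K2 f : L2 mu f -> ip mu f (cutT (@K2 R t)) = - ip mu f (le_k t).
Proof.
move=> Lf; rewrite -mulN1r -ipZr//; last exact: (kern_row t kle).
rewrite ipC [RHS]ipC; apply: ip_ae.
- exact: (L2_measurable L2_K2).
- exact: (L2_measurable (L2Z (-1) (kern_row t kle))).
- exact: (L2_measurable Lf).
- by apply: filterS (cutT_ae T (@K2 R t)) => x ->; rewrite mulN1r.
Qed.

(** For [x >= t] causality kills [Gc t x], the first component supplies [Gc x t], and
    [- 2 phi 1_t^*] applied to [K2] supplies the [mkern] part of the row. *)
Lemma gam_K x : inT x -> t <= x -> gam t (K1 G rho t) (@K2 R t) x = K t x.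
Proof.
move=> xT tx; rewrite /gam !(cutTE _ xT) one_adjE; last exact: L2_K2.
rewrite tx mul1r /Op cutT_K2; last exact: (kern_row x kle).
rewrite /K /kap (Gc_causal tx) Gc_in// /K1 mkern_sym /mkern; ring.
Qed.

Lemma Dinv_gamK : {ae mu, forall x, r t x = Di t (gam t (K1 G rho t) (@K2 R t)) x}.
Proof. by apply: Dinv_resolvent; [exact: L2_gam L2_K1 L2_K2|exact: gam_K]. Qed.

Lemma ip_Dinv_gamK f : L2 mu f -> ip mu f (Di t (gam t (K1 G rho t) (@K2 R t))) = ip mu (r t) f.
Proof.
move=> Lf; rewrite ipC; apply: ip_ae.
- exact: (L2_measurable (L2_Di t (L2_gam t L2_K1 L2_K2))).
- exact: (L2_measurable (kern_row t kr)).
- exact: (L2_measurable Lf).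
- by apply: filterS Dinv_gamK => x ->.
Qed.

(** Symmetry moves the inverse onto [gam] of [K_t], where it yields [r t]. Consequently
    [c t + ThetaK t c] is the value at [t] of [A] applied to [c], the shape in which it is compared
    with [xi]. *)
Lemma ThetaKE c : L2 mu (cutT c) -> ThetaK T G rho lam phi t c = - ip mu (r t) (cutT c).
Proof.
move=> Lc; rewrite /ThetaK Theta_ip2; congr (- _).
have L1 : L2 mu (cutT (fun x => ind (t <= x) * c x)).
  have := L2_ind_le t Lc; congr (L2 _ _); apply/funext => x; rewrite /cutT; ring.
have L0 := L2_cutT_cst 0.
rewrite Ginv_ip//; [|exact: L2_K1|exact: L2_K2|exact: K1_lt].
have -> : ip mu (cutT (fun=> 0)) (cutT (@K2 R t)) = 0.
  rewrite (eq_ip (f' := fun=> 0) (g' := cutT (@K2 R t)) mu) ?ip0l//.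
  by move=> x; rewrite /cutT mulr0.
rewrite mulr0 subr0 Dinv_sym; [|exact: L2_gam|exact: (L2_gam t L2_K1 L2_K2)].
rewrite ip_Dinv_gamK; last exact: L2_gam.
apply: eq_Rintegral => x _; rewrite gam0//.
by have [xt|tx] := ltP x t; rewrite ?(r_supp xt) ?mul0r ?mul1r.
Qed.

Variables (g1 g2 : R -> R).
Hypothesis Lg1 : L2 mu (cutT g1).
Hypothesis Lg2 : L2 mu (cutT g2).
Hypothesis g1t : forall x, inT x -> x < t -> g1 x = 0.
Let gm := gam t g1 g2.
Let Lgm : L2 mu gm := L2_gam t Lg1 Lg2.

Lemma Ginv_K_ip :
  ip2 T (Ginv1 T G rho lam phi t (K1 G rho t) (@K2 R t))
        (Ginv2 T G rho lam phi t (K1 G rho t) (@K2 R t)) g1 g2 =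
  ip mu (r t) gm + 2 * phi * ip mu (cutT g2) (le_k t).
Proof.
rewrite Ginv_ip//; [|exact: L2_K1|exact: L2_K2].
rewrite ip_Dinv_gamK// (ipC mu (cutT (@K2 R t))) cutT_K2// -/gm; ring.
Qed.

Lemma Ginv_g_ip :
  ip2 T g1 g2 (Ginv1 T G rho lam phi t g1 g2) (Ginv2 T G rho lam phi t g1 g2) =
  (2 * lam)^-1 * ip mu (A gm) (fun s => ind (t <= s) * A gm s)
  - 2 * phi * ip mu (cutT g2) (cutT g2).
Proof. by rewrite ip2C Ginv_ip// ip_Dinv. Qed.

Lemma Theta_g_ip c : L2 mu (cutT c) ->
  ip2 T (Theta1 T G rho lam phi t c) (Theta2 T G rho lam phi t c) g1 g2 =
  - ((2 * lam)^-1 * ip mu (A gm) (fun s => ind (t <= s) * A (cutT c) s)).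
Proof.
move=> Lc; rewrite Theta_ip2; congr (- _).
have L1 : L2 mu (cutT (fun x => ind (t <= x) * c x)).
  have := L2_ind_le t Lc; congr (L2 _ _); apply/funext => x; rewrite /cutT; ring.
have L0 := L2_cutT_cst 0.
rewrite Ginv_ip//.
have -> : ip mu (cutT (fun=> 0)) (cutT g2) = 0.
  rewrite (eq_ip (f' := fun=> 0) (g' := cutT g2) mu) ?ip0l//.
  by move=> x; rewrite /cutT mulr0.
rewrite mulr0 subr0 (ip_Dinv lam kr t (L2_gam t L1 L0) Lgm).
congr (_ * _); apply: eq_Rintegral => s _; congr (_ * _).
have [st|ts] := ltP s t; first by rewrite !mul0r.
rewrite !mul1r /Aop gam0// ts mul1r; congr (_ - _).
apply: eq_Rintegral => x _; rewrite gam0//.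
have [xs|sx] := ltP x s; first by rewrite r_supp// !mul0r.
by rewrite (le_trans ts sx) mul1r.
Qed.

End at_time.

End operators.

(** * Square-integrable processes *)

Section processes.
Context (R : realType) d (Omega : measurableType d) (Pr : probability Omega R).
Variable mu : {finite_measure set R -> \bar R}.
Implicit Types X Y : R -> Omega -> R.

Definition L2P X := L2 (mu \x Pr)%E (fun p => X p.1 p.2).

Lemma L2P_path X : L2P X -> {ae Pr, forall w, L2 mu (X^~ w)}.
Proof. exact: L2_section2. Qed.

Lemma L2P_time X : L2P X -> {ae mu, forall s, L2 Pr (X s)}.
Proof. exact: L2_section. Qed.

Lemma L2PD X Y : L2P X -> L2P Y -> L2P (fun s w => X s w + Y s w).
Proof. exact: L2D. Qed.

Lemma L2PB X Y : L2P X -> L2P Y -> L2P (fun s w => X s w - Y s w).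
Proof. exact: L2B. Qed.

Lemma L2PZ c X : L2P X -> L2P (fun s w => c * X s w).
Proof. exact: L2Z. Qed.

Lemma L2P_bndM M X Y : measurable_fun setT (fun p : R * Omega => X p.1 p.2) ->
  (forall s w, `|X s w| <= M) -> L2P Y -> L2P (fun s w => X s w * Y s w).
Proof. by move=> mX XM; apply: L2_bndM => // -[s w]; exact: XM. Qed.

Lemma L2P_tensor (f : R -> R) (Z : Omega -> R) : L2 mu f -> L2 Pr Z ->
  L2P (fun s w => f s * Z w).
Proof. exact: L2_tensor. Qed.

Lemma L2P_det (f : R -> R) : L2 mu f -> L2P (fun s _ => f s).
Proof.
move=> Lf; have := L2P_tensor Lf (L2_cst Pr 1).
by congr L2P; apply/funext => s; apply/funext => w; rewrite mulr1.
Qed.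

Lemma L2P_rvM M (Z : Omega -> R) X : measurable_fun setT Z -> (forall w, `|Z w| <= M) ->
  L2P X -> L2P (fun s w => Z w * X s w).
Proof.
move=> mZ ZM; apply: L2P_bndM => //.
exact: (measurableT_comp mZ measurable_snd).
Qed.

Lemma L2P_intro X : measurable_fun setT (fun p : R * Omega => X p.1 p.2) ->
  (\int[Pr]_w \int[mu]_s ((X s w ^+ 2)%R)%:E < +oo)%E -> L2P X.
Proof.
move=> mX h; split=> //.
have m2 : measurable_fun setT (EFin \o (fun p : R * Omega => X p.1 p.2 ^+ 2)).
  by apply/measurable_EFinP; exact: measurable_funX.
apply/integrable21ltyP; first exact: m2.
apply: le_lt_trans h.
rewrite le_eqVlt; apply/orP; left; apply/eqP; apply: eq_integral => w _.
by apply: eq_integral => s _; rewrite gee0_abs ?lee_fin ?sqr_ge0.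
Qed.

Lemma L2P_finite X : L2P X -> (\int[Pr]_w \int[mu]_s ((X s w ^+ 2)%R)%:E < +oo)%E.
Proof.
move=> [mX X2].
have m2 : measurable_fun setT (EFin \o (fun p : R * Omega => X p.1 p.2 ^+ 2)).
  by apply/measurable_EFinP; exact: measurable_funX.
move/integrable21ltyP : X2 => /(_ m2); apply: le_lt_trans.
rewrite le_eqVlt; apply/orP; left; apply/eqP; apply: eq_integral => w _.
by apply: eq_integral => s _; rewrite gee0_abs ?lee_fin ?sqr_ge0.
Qed.

Lemma measurable_path_ip d' (S : measurableType d') (k : S -> R -> R)
    (X : R -> S -> R) :
  measurable_fun setT (fun p : S * R => k p.1 p.2) ->
  measurable_fun setT (fun p : R * S => X p.1 p.2) ->
  measurable_fun setT (fun z => ip mu (k z) (X^~ z)).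
Proof.
move=> mk mX; apply: (@measurable_Rint _ _ _ _ _ mu (fun p : S * R => k p.1 p.2 * X p.2 p.1)).
apply: measurable_funM => //.
apply: (measurableT_comp mX (g := fun p : S * R => (p.2, p.1))).
by apply: measurable_fun_pair; [exact: measurable_snd|exact: measurable_fst].
Qed.

Lemma measurable_Op_path d' (S : measurableType d') (k : R -> R -> R) (X : R -> S -> R) :
  measurable_fun setT (fun p : R * R => k p.1 p.2) ->
  measurable_fun setT (fun p : R * S => X p.1 p.2) ->
  measurable_fun setT (fun p : R * S => ip mu (k p.1) (X^~ p.2)).
Proof.
move=> mk mX.
apply: (@measurable_path_ip _ (R * S)%type (fun z => k z.1) (fun s z => X s z.2)).
- apply: (measurableT_comp mk (g := fun p : (R * S) * R => (p.1.1, p.2))).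
  apply: measurable_fun_pair; last exact: measurable_snd.
  exact: (measurableT_comp measurable_fst measurable_fst).
- apply: (measurableT_comp mX (g := fun p : R * (R * S) => (p.1, p.2.2))).
  apply: measurable_fun_pair; first exact: measurable_fst.
  exact: (measurableT_comp measurable_snd measurable_snd).
Qed.

Lemma L2P_Op k X : kern mu k -> L2P X -> L2P (fun s w => ip mu (k s) (X^~ w)).
Proof.
move=> kk LX; have [C kC] := kk.
have m : measurable_fun setT (fun p : R * Omega => ip mu (k p.1) (X^~ p.2)).
  by apply: measurable_Op_path; [exact: kern_measurable kk|exact: L2_measurable LX].
apply: L2P_intro => //.
have C0 := kern_le_ge0 (0 : R) kC.
have m0 : 0 <= fine (mu setT) by exact: fine_ge0.
have mI (Y : R -> Omega -> R) : measurable_fun setT (fun p : R * Omega => Y p.1 p.2) ->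
    measurable_fun setT (fun w => \int[mu]_s ((Y s w ^+ 2)%R)%:E)%E.
  move=> mY; apply: (@measurable_fun_fubini_tonelli_G _ _ _ _ _ mu
     (fun p => ((Y p.1 p.2 ^+ 2)%R)%:E)) => //.
  - by apply/measurable_EFinP; exact: measurable_funX.
  - by move=> p; rewrite lee_fin sqr_ge0.
have mX := L2_measurable LX.
apply: (@le_lt_trans _ _ (\int[Pr]_w ((C * fine (mu setT))%:E * \int[mu]_s ((X s w ^+ 2)%R)%:E))%E).
  apply: ae_ge0_le_integral => //.
  - by move=> w _; apply: integral_ge0 => s _; rewrite lee_fin sqr_ge0.
  - exact: mI.
  - move=> w _; apply: mule_ge0; first by rewrite lee_fin mulr_ge0.
    by apply: integral_ge0 => s _; rewrite lee_fin sqr_ge0.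
  - by apply: emeasurable_funM => //; exact: mI.
  - apply: filterS (L2P_path LX) => w Lw _.
    have LO := L2_Op kk Lw.
    have -> : (\int[mu]_s ((ip mu (k s) (X^~ w) ^+ 2)%R)%:E)%E =
        (ip mu (Op mu k (X^~ w)) (Op mu k (X^~ w)))%:E.
      by rewrite ip_sqr fineK//; exact: integrable_fin_num LO.2.
    have -> : (\int[mu]_s ((X s w ^+ 2)%R)%:E)%E = (ip mu (X^~ w) (X^~ w))%:E.
      by rewrite ip_sqr fineK//; exact: integrable_fin_num Lw.2.
    by rewrite -EFinM lee_fin (le_trans (ip_Op_le kC Lw))// mulrAC.
rewrite ge0_integralZl//.
- by apply: lte_mul_pinfty; rewrite ?lee_fin ?mulr_ge0//; exact: L2P_finite.
- exact: mI.
- by move=> w _; apply: integral_ge0 => s _; rewrite lee_fin sqr_ge0.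
- by rewrite lee_fin mulr_ge0.
Qed.

Lemma integrable_path_ip X Y : L2P X -> L2P Y ->
  Pr.-integrable setT (EFin \o (fun w => ip mu (X^~ w) (Y^~ w))).
Proof.
move=> LX LY; exact: (Rfubini_integrable (integrable_swap (L2_mul LX LY))).
Qed.

Lemma exp_path_ip X Y : L2P X -> L2P Y ->
  \int[Pr]_w ip mu (X^~ w) (Y^~ w) = \int[mu]_s ip Pr (X s) (Y s).
Proof. by move=> LX LY; rewrite -(Rfubini (L2_mul LX LY)). Qed.

Lemma L2_path_ip (k : R -> R) X : L2 mu k -> L2P X ->
  L2 Pr (fun w => ip mu k (X^~ w)).
Proof.
move=> Lk LX.
have m : measurable_fun setT (fun w => ip mu k (X^~ w)).
  apply: (@measurable_path_ip _ Omega (fun _ => k) X); last exact: L2_measurable LX.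
  exact: (measurableT_comp (L2_measurable Lk) measurable_snd).
split=> //.
have iX := integrable_path_ip LX LX.
have iZ := integrable_finZ (ip mu k k) iX.
apply/integrableP; split; first by apply/measurable_EFinP; exact: measurable_funX.
case/integrableP: iZ => mZ; apply: le_lt_trans; apply: ae_ge0_le_integral => //.
- by apply: measurableT_comp => //; apply/measurable_EFinP; exact: measurable_funX.
- exact: measurableT_comp.
- apply: filterS (L2P_path LX) => w Lw _ /=; rewrite lee_fin ger0_norm ?sqr_ge0//.
  by apply: (le_trans (cauchy_schwarz Lk Lw)); exact: ler_norm.
Qed.

(** The contraction property holds at almost every time and is then integrated in time. *)
Lemma L2P_condexp (G : R -> set (set Omega)) X Y : L2P X ->
  measurable_fun setT (fun p : R * Omega => Y p.1 p.2) ->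
  {ae mu, forall s, [/\ sigma_algebra setT (G s), G s `<=` measurable &
     is_condexp Pr (G s) (X s) (Y s)]} ->
  L2P Y.
Proof.
move=> LX mY cY; split=> //.
have m2 (Z : R -> Omega -> R) : measurable_fun setT (fun p : R * Omega => Z p.1 p.2) ->
    measurable_fun setT (EFin \o (fun p : R * Omega => Z p.1 p.2 ^+ 2)).
  by move=> mZ; apply/measurable_EFinP; exact: measurable_funX.
have mX := L2_measurable LX.
apply/integrable12ltyP; first exact: m2.
have /integrable12ltyP := LX.2; move=> /(_ (m2 _ mX)); apply: le_lt_trans.
have mI (Z : R -> Omega -> R) : measurable_fun setT (fun p : R * Omega => Z p.1 p.2) ->
    measurable_fun setT (fun s => \int[Pr]_w `|(EFin \o (fun p : R * Omega => (Z p.1 p.2 ^+ 2)%R)) (s, w)|)%E.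
  move=> mZ; apply: (@measurable_fun_fubini_tonelli_F _ _ _ _ _ Pr
     (fun p => `|(EFin \o (fun p : R * Omega => (Z p.1 p.2 ^+ 2)%R)) p|)%E) => //.
  by apply: measurableT_comp => //; exact: m2.
apply: ae_ge0_le_integral => //.
- by move=> s _; exact: integral_ge0.
- exact: mI.
- by move=> s _; exact: integral_ge0.
- exact: mI.
- apply: filterS2 cY (L2P_time LX) => s [sG GM cs] LXs _.
  have [LYs le] := condexp_L2 sG GM cs LXs.
  have E (Z : Omega -> R) : L2 Pr Z -> (\int[Pr]_w `|((Z w ^+ 2)%R)%:E| = (ip Pr Z Z)%:E)%E.
    move=> LZ; rewrite ip_sqr fineK; last exact: integrable_fin_num LZ.2.
    by apply: eq_integral => w _; rewrite gee0_abs ?lee_fin ?sqr_ge0.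
  by rewrite /= !E// lee_fin.
Qed.

End processes.

(** * Pathwise form of the criterion *)

Section paths.
Context (R : realType) d (Omega : measurableType d).
Variables (T rho phi lam q : R) (h0 : R -> R) (G : R -> R -> R).
Hypothesis T0 : 0 < T.
Hypothesis GK : kernel_class T G.
Hypothesis h0T : sq_int T h0.
Let mu := muT T.
Local Notation cutT := (cut_horizon T).
Local Notation inT := (in_horizon T).
Local Notation K := (kap T rho phi G).
Local Notation D := (Dop mu K lam).
Local Notation le_k := (@le_kernel R).
Local Notation leT := (fun x y : R => le_kernel y x).
Local Notation Gk := (Gc T rho G).
Let kle : kern mu le_k := kern_le_kernel T.
Let kGk : kern mu Gk := kern_Gc rho GK.
Let kG2 : kern mu (cut2 T G) := kern_cut2G GK.

(** On the horizon this is [T - s]. *)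
Definition tail (s : R) : R := ip mu (le_k s) (fun=> 1).
Definition h0t : R -> R := cutT (fun s => h0 s - 2 * rho * q).

Lemma L2_tail : L2 mu tail.
Proof. exact: (L2_Op kle (L2_cst mu 1)). Qed.

Lemma L2_h0t : L2 mu h0t.
Proof.
have [_ Lh] := (sq_int_L2 T h0).1 h0T.
have := L2B Lh (L2_cutT_cst T (2 * rho * q)); congr (L2 _ _).
by apply/funext => x; rewrite /h0t /cut_horizon mulrBr.
Qed.

(* The deterministic part of the gradient of the criterion at [u = 0]. *)
Definition gamma0 : R -> R := fun s => - h0t s + 2 * phi * q * tail s.

Lemma L2_gamma0 : L2 mu gamma0.
Proof. by apply: L2D; [exact: L2N L2_h0t|exact: L2Z L2_tail]. Qed.

Lemma mkern_tail s x : x <= s -> mkern T s x = tail s.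
Proof.
move=> xs; apply: eq_Rintegral => u _; rewrite /le_kernel.
have [su|us] := leP s u; last by rewrite !mul0r.
by rewrite (le_trans xs su).
Qed.

Section path.
Variables (v : R -> Omega -> R) (w : Omega).
Let f : R -> R := cutT (v^~ w).
Hypothesis Lf : L2 mu f.
Let mf : measurable_fun setT f := L2_measurable Lf.

Lemma Qu_E s : inT s -> Qu q v s w = q - ip mu (leT s) f.
Proof.
move=> sT; rewrite /Qu; congr (_ - _); have /andP[s0 sT'] := sT.
rewrite (@RInt_muT _ T _ _ _ f)//; last first.
  move=> x /andP[x0 xs]; rewrite /f cutTE//.
  by rewrite /in_horizon x0 (le_trans xs sT').
apply: ae_Rintegral.
- apply: measurable_funM => //; apply: measurable_ind; apply: measurable_and;
    exact: measurable_fun_ler.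
- exact: measurable_funM (L2_measurable (kern_col s kle)) mf.
- by apply: filterS (muT_ae_in T) => x /andP[x0 _]; rewrite x0.
Qed.

Lemma Zu_E s : inT s -> Zu h0 G v s w = h0 s + ip mu (cut2 T G s) f.
Proof.
move=> sT; rewrite /Zu; congr (_ + _); have /andP[s0 sT'] := sT.
have mg := measurable_funM (L2_measurable (kern_row s kG2)) mf.
rewrite (@RInt_muT _ T _ _ _ (fun x => cut2 T G s x * f x))//; last first.
  move=> x /andP[x0 xs]; have xT : inT x by rewrite /in_horizon x0 (le_trans xs sT').
  by rewrite /f cutTE// /cut2 sT xT !mul1r.
apply: ae_Rintegral => //.
- apply: measurable_funM => //; apply: measurable_ind; apply: measurable_and;
    exact: measurable_fun_ler.
- apply: filterS (muT_ae_in T) => x xT; have /andP[x0 _] := xT; rewrite x0 /=.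
  have [xs|sx] := leP x s; first by rewrite mul1r.
  have [_ [_ [G0 _]]] := GK.
  by rewrite mul0r /cut2 G0 ?mulr0 ?mul0r// ltW.
Qed.

Lemma Gk_ip (g : R -> R) s : L2 mu g -> inT s ->
  ip mu (Gk s) g = 2 * rho * ip mu (leT s) g + ip mu (cut2 T G s) g.
Proof.
move=> Lg sT; have Lc := kern_col s kle; have L2' := kern_row s kG2.
have Lk := kern_row s (kern_ltk T).
rewrite (eq_ip mu (GcE T rho G s) (fun=> erefl)) ipDl//; last exact: L2Z.
rewrite ipZl//; congr (_ * _ + _); apply: ip_ae.
- exact: (L2_measurable Lk).
- exact: (L2_measurable Lc).
- exact: (L2_measurable Lg).
- apply: filterS2 (muT_ae_neq T s) (muT_ae_in T) => x xs xT.
  rewrite /cut2 sT (_ : in_horizon T x = true)// !mul1r /le_kernel le_eqVlt.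
  by rewrite (_ : (x == s) = false)//; apply/eqP.
Qed.

Lemma Yu_E s : inT s -> Yu q rho h0 G v s w = (h0 s - 2 * rho * q) + ip mu (Gk s) f.
Proof.
by move=> sT; rewrite /Yu Zu_E// Qu_E// Gk_ip//; ring.
Qed.

Variable t : R.
Hypothesis tT : inT t.
Let f1 : R -> R := fun x => ind (x < t) * f x.
Let f2 : R -> R := fun x => ind (t <= x) * f x.
Let Lf1 : L2 mu f1.
Proof.
apply: (@L2_bndM _ _ _ _ 1) => // [|x]; last exact: norm_ind.
by apply: measurable_ind; exact: measurable_fun_ltr.
Qed.
Let Lf2 : L2 mu f2 := L2_ind_le t Lf.

Let f12 x : f x = f1 x + f2 x.
Proof. by rewrite /f1 /f2 /ind ltNge; case: (t <= x); rewrite ?mul0r ?mul1r ?addr0 ?add0r. Qed.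

Let ip_f12 g : L2 mu g -> ip mu g f = ip mu g f1 + ip mu g f2.
Proof. by move=> Lg; rewrite (eq_ip mu (fun=> erefl) f12) ipDr. Qed.

Let g1 : R -> R := g1u q rho h0 G v t w.
Let g2 : R -> R := g2u q v t w.
Let Q : R := Qu q v t w.

Lemma g1u_E s : inT s -> g1 s = ind (t <= s) * ((h0 s - 2 * rho * q) + ip mu (Gk s) f1).
Proof.
move=> sT; rewrite /g1 /g1u; congr (_ * (_ + _)).
have /andP[t0 tT'] := tT; have mg := measurable_funM (L2_measurable (kern_row s kGk)) mf.
rewrite (@RInt_muT _ T _ _ _ (fun x => Gk s x * f x))//; last first.
  move=> x /andP[x0 xs]; have xT : inT x by rewrite /in_horizon x0 (le_trans xs tT').
  by rewrite /f cutTE// /Gc /cut2 sT xT !mul1r.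
apply: ae_Rintegral.
- apply: measurable_funM => //; apply: measurable_ind; apply: measurable_and;
    exact: measurable_fun_ler.
- exact: measurable_funM (L2_measurable (kern_row s kGk)) (L2_measurable Lf1).
- apply: filterS2 (muT_ae_neq T t) (muT_ae_in T) => x xt /andP[x0 _].
  rewrite x0 /= le_eqVlt (_ : (x == t) = false); last exact/eqP.
  by rewrite /f1 /=; ring.
Qed.

Lemma Qt_E : Q = q - ip mu (fun=> 1) f1.
Proof.
rewrite /Q Qu_E//; congr (_ - _); apply: ae_Rintegral.
- exact: measurable_funM (L2_measurable (kern_col t kle)) mf.
- by apply: measurable_funM => //; exact: (L2_measurable Lf1).
- apply: filterS (muT_ae_neq T t) => x xt; rewrite mul1r /f1 /le_kernel le_eqVlt.
  by rewrite (_ : (x == t) = false)//; apply/eqP.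
Qed.

Lemma Q_split s : inT s -> t <= s -> Qu q v s w = Q - ip mu (leT s) f2.
Proof.
move=> sT ts; rewrite Qu_E// Qt_E (ip_f12 (kern_col s kle)).
rewrite (_ : ip mu (leT s) f1 = ip mu (fun=> 1) f1); first by ring.
apply: eq_Rintegral => x _; rewrite /f1 /le_kernel.
have [xt|tx] := ltP x t; last by rewrite !mul0r !mulr0.
by rewrite (le_trans (ltW xt) ts).
Qed.

Lemma Y_split s : inT s -> t <= s -> Yu q rho h0 G v s w = g1 s + ip mu (Gk s) f2.
Proof.
by move=> sT ts; rewrite Yu_E// g1u_E// ts mul1r (ip_f12 (kern_row s kGk)) addrA.
Qed.

Lemma cutT_g1 s : cutT g1 s = ind (t <= s) * (h0t s + ip mu (Gk s) f1).
Proof.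
rewrite /cut_horizon /h0t /cut_horizon; have [sT|sT] := boolP (inT s).
  by rewrite g1u_E// !mul1r.
rewrite !mul0r (_ : ip mu (Gk s) f1 = 0) ?addr0 ?mulr0//.
rewrite (eq_ip (f' := fun=> 0) (g' := f1) mu) ?ip0l//.
by move=> x; rewrite /Gc /cut2 (negbTE sT) !mul0r.
Qed.

Lemma L2_g1 : L2 mu (cutT g1).
Proof.
have := L2_ind_le t (L2D L2_h0t (L2_Op kGk Lf1)).
by congr (L2 _ _); apply/funext => s; rewrite cutT_g1.
Qed.

Lemma g1_lt x : inT x -> x < t -> g1 x = 0.
Proof. by move=> xT xt; rewrite /g1 /g1u leNgt xt mul0r. Qed.

Lemma L2_g2 : L2 mu (cutT g2).
Proof.
apply: L2_cutT; have := L2Z Q (kern_row t kle); congr (L2 _ _).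
by apply/funext => s; rewrite mulrC.
Qed.

Lemma cutT_g2_ae : {ae mu, forall x, cutT g2 x = Q * le_k t x}.
Proof.
by apply: filterS (cutT_ae T g2) => x ->; rewrite /g2 /g2u mulrC.
Qed.

Lemma ip_g2_le : ip mu (cutT g2) (le_k t) = Q * tail t.
Proof.
have Lk := kern_row t kle.
transitivity (ip mu (fun x => Q * le_k t x) (le_k t)).
  apply: ip_ae cutT_g2_ae.
  - exact: (L2_measurable L2_g2).
  - exact: (L2_measurable (L2Z Q Lk)).
  - exact: (L2_measurable Lk).
rewrite ipZl//; congr (_ * _); apply: eq_Rintegral => x _.
by rewrite /le_kernel ind_idem mulr1.
Qed.

Lemma ip_g2_g2 : ip mu (cutT g2) (cutT g2) = Q ^+ 2 * tail t.
Proof.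
have Lk := kern_row t kle.
transitivity (ip mu (fun x => Q * le_k t x) (cutT g2)).
  apply: ip_ae cutT_g2_ae.
  - exact: (L2_measurable L2_g2).
  - exact: (L2_measurable (L2Z Q Lk)).
  - exact: (L2_measurable L2_g2).
by rewrite ipZl ?(ipC mu (le_k t)) ?ip_g2_le ?mulrA ?expr2//; exact: L2_g2.
Qed.

Let gm : R -> R := gam T phi t g1 g2.

Lemma L2_gm : L2 mu gm.
Proof. exact: (L2_gam phi t L2_g1 L2_g2). Qed.

Lemma gm_E s : inT s -> t <= s -> gm s = h0t s + ip mu (Gk s) f1 - 2 * phi * (Q * tail s).
Proof.
move=> sT ts; rewrite /gm /gam cutT_g1 ts mul1r; congr (_ - _ * _).
rewrite cutTE// one_adjE ?ts ?mul1r; last exact: L2_g2.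
rewrite /Op; have Lk := kern_row t kle; have Ls := kern_row s kle.
transitivity (ip mu (le_k s) (fun x => Q * le_k t x)).
  rewrite ipC [RHS]ipC; apply: ip_ae cutT_g2_ae.
  - exact: (L2_measurable L2_g2).
  - exact: (L2_measurable (L2Z Q Lk)).
  - exact: (L2_measurable Ls).
by rewrite ipZr//; congr (_ * _); exact: (mkern_tail ts).
Qed.

Lemma gm_lt s : s < t -> gm s = 0.
Proof.
move=> st; rewrite /gm /gam cutT_g1 /cut_horizon one_adjE; last exact: L2_g2.
by rewrite leNgt st /= !mul0r !mulr0 subr0.
Qed.

(** Restarting at [t] leaves the deterministic part of the gradient unchanged on [[t, T]]. Causality
    removes the transposed kernel on the past, and [mkern s x = tail s] for [x <= s], so the
    inventory penalty depends on the past only through its integral, that is, through [Q]. *)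
Lemma Dop_split s : inT s -> t <= s -> - gm s - D f2 s = gamma0 s - D f s.
Proof.
move=> sT ts; rewrite gm_E// /Dop /gamma0.
have kK := kern_kap rho phi GK.
have -> : Op mu K f s = Op mu K f1 s + Op mu K f2 s.
  by rewrite /Op ip_f12//; exact: (kern_row s kK).
have -> : f2 s = f s by rewrite /f2 ts mul1r.
have -> : Op mu K f1 s = ip mu (Gk s) f1 + 2 * phi * (ip mu (fun=> 1) f1 * tail s).
  rewrite (KopE rho phi GK)// /Op.
  have -> : ip mu (fun y => Gk y s) f1 = 0.
    rewrite /ip (@eq_Rintegral _ _ _ _ _ (fun=> 0)).
      by rewrite Rintegral_cst// mul0r.
    move=> x _; rewrite /f1; have [xt|tx] := ltP x t; last by rewrite mul0r mulr0.
    by rewrite (Gc_causal rho GK) ?mul0r// (le_trans (ltW xt) ts).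
  rewrite addr0; congr (_ + _ * _).
  rewrite mulrC -ipZl//; last exact: L2_cst.
  apply: eq_Rintegral => x _; rewrite /f1 mulr1.
  have [xt|tx] := ltP x t; last by rewrite mul0r !mulr0.
  by rewrite mkern_tail// (le_trans (ltW xt) ts).
rewrite Qt_E; move: (ip _ _ _) (ip _ _ _) (tail s) (h0t s) (f s) (Op _ _ _ _).
by clear => a b c e x y; ring.
Qed.

Lemma ip_mkern g : L2 mu g -> ip mu g (Op mu (mkern T) g) = ip mu (Op mu leT g) (Op mu leT g).
Proof.
move=> Lg; have LT := L2_Op (kernT kle) Lg.
rewrite (eq_ip mu (fun=> erefl) (fun x => Op_mkern x Lg)).
exact: (Op_adj kle LT Lg).
Qed.

Lemma ip_Dop g : L2 mu g -> ip mu g (D g) = 2 * lam * ip mu g g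
  + 2 * ip mu g (Op mu Gk g) + 2 * phi * ip mu (Op mu leT g) (Op mu leT g).
Proof.
move=> Lg; have LG := L2_Op kGk Lg; have LGT := L2_Op (kernT kGk) Lg.
have Lm := L2_Op (kern_mkern T) Lg.
rewrite -ip_mkern//.
have E x : D g x = 2 * lam * g x + (Op mu Gk g x + Op mu (fun x y => Gk y x) g x
    + 2 * phi * Op mu (mkern T) g x).
  by rewrite /Dop (KopE rho phi GK).
rewrite (eq_ip mu (fun=> erefl) E).
have L3 := L2D LG LGT; have L4 := L2Z (2 * phi) Lm; have L5 := L2Z (2 * lam) Lg.
rewrite ipDr//; last exact: L2D.
rewrite ipDr// ipDr// !ipZr// (ip_OpT kGk Lg).
by move: (ip _ _ _) (ip _ _ _) (ip _ _ _); clear => a b c; ring.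
Qed.

Variable P : R -> Omega -> R.
Let p : R -> R := cutT (P^~ w).
Hypothesis Lp : L2 mu p.
Let b : R -> R := cutT (fun s => P s w - P T w).

Let f2_cut (c : R) x : cutT (fun=> c) x * f2 x = c * f2 x.
Proof. by rewrite /f2 /f /cut_horizon /ind; case: (in_horizon T x); rewrite ?mul1r// !mul0r !mulr0. Qed.

Lemma ip_b_f2 : ip mu b f2 = ip mu p f2 - P T w * ip mu (fun=> 1) f2.
Proof.
rewrite -ipZl//; last exact: L2_cst.
rewrite -ipBl//; last exact: (L2Z _ (L2_cst mu 1)).
apply: eq_Rintegral => x _; rewrite mulr1 mulrBl -(f2_cut (P T w)) -mulrBl.
by rewrite /b /p /cut_horizon mulrBr.
Qed.

Lemma ip_gm_f2 : ip mu gm f2 = ip mu (cutT g1) f2 - 2 * phi * (Q * ip mu tail f2).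
Proof.
have Lt := L2_tail; have L1 := L2_g1.
rewrite mulrA -ipZl// -ipBl//; last exact: L2Z.
apply: eq_Rintegral => x _; rewrite /f2.
have [xt|tx] := ltP x t; first by rewrite !mul0r !mulr0.
rewrite mul1r /f; have [xT|xT] := boolP (inT x).
  by rewrite gm_E// cutT_g1 tx mul1r mulrA.
by rewrite [X in _ * X]/cut_horizon [X in _ = _ * X]/cut_horizon (negbTE xT) !mul0r !mulr0.
Qed.

Lemma Op_leT_lt x : x < t -> Op mu leT f2 x = 0.
Proof.
move=> xt; rewrite /Op /ip (@eq_Rintegral _ _ _ _ _ (fun=> 0)).
  by rewrite Rintegral_cst// mul0r.
move=> y _; rewrite /f2 /le_kernel; have [yx|] := leP y x; last by rewrite mul0r.
by rewrite leNgt (le_lt_trans yx xt) /= mul0r mulr0.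
Qed.

Lemma ip_le_Op : ip mu (le_k t) (Op mu leT f2) = ip mu tail f2.
Proof.
have Lk := kern_row t kle.
rewrite (Op_adj (kernT kle) Lf2 Lk); apply: eq_Rintegral => x _.
rewrite /f2; have [xt|tx] := ltP x t; first by rewrite mul0r !mulr0.
by congr (_ * _); exact: mkern_tail.
Qed.

Lemma ip_leT_f2 : ip mu (leT T) f2 = ip mu (fun=> 1) f2.
Proof.
apply: eq_Rintegral => x _; rewrite /le_kernel /f2 /f /cut_horizon.
have [/andP[_ ->]//|_] := boolP (inT x).
by rewrite !mul0r !mulr0.
Qed.

(** After [t] the criterion is a quadratic polynomial in the future control, with Hessian [- D] and
    gradient [b - gm] at 0; [g_t] and [Q] are all that it retains of the past. *)
Lemma Jpath : Jt T q lam rho phi P h0 G v t w =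
  ip mu (fun s => b s - gm s) f2 - 2^-1 * ip mu f2 (D f2) + P T w * Q
  - phi * Q ^+ 2 * tail t.
Proof.
have /andP[t0 tT'] := tT.
have TT : inT T by rewrite /in_horizon (le_trans t0 tT') lexx.
have Lo := L2_Op (kernT kle) Lf2; have LO := L2_Op kGk Lf2; have L1 := L2_g1.
have Lk := kern_row t kle.
have Lb : L2 mu b.
  have := L2B Lp (L2_cutT_cst T (P T w)); congr (L2 _ _).
  by apply/funext => x; rewrite /b /p /cut_horizon mulrBr.
pose o := Op mu leT f2; pose O := Op mu Gk f2.
pose c x := p x - cutT g1 x - O x.
have Lc : L2 mu c by apply: L2B => //; exact: L2B.
(* The inventory after [t], extended by 0 to the left of [t], so that its integral over [[t, T]]
   becomes an inner product over the horizon. *)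
pose z x := Q * le_k t x - o x.
have Lz : L2 mu z by apply: L2B => //; exact: L2Z.
rewrite /Jt (@RInt_muT _ T _ _ _ (fun x => c x * f2 x - lam * (f2 x * f2 x) - phi * (z x * z x)))//; first last.
- move=> x /andP[tx xT]; have xT' : inT x by rewrite /in_horizon (le_trans t0 tx) xT.
  rewrite Y_split// Q_split// /c /z /le_kernel tx mulr1 -/o -/O /p !(cutTE _ xT').
  by rewrite /f2 /f tx mul1r cutTE// !expr2 opprD addrA.
- apply: measurable_funB; last first.
    by apply: measurable_funM => //; apply: measurable_funM; exact: (L2_measurable Lz).
  apply: measurable_funB.
    by apply: measurable_funM; [exact: (L2_measurable Lc)|exact: (L2_measurable Lf2)].
  by apply: measurable_funM => //; apply: measurable_funM; exact: (L2_measurable Lf2).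
have cE : ip mu c f2 = ip mu p f2 - ip mu (cutT g1) f2 - ip mu f2 O.
  by rewrite /c ipBl//; [rewrite ipBl// (ipC mu O)|exact: L2B].
have zE : ip mu z z = Q ^+ 2 * tail t - 2 * Q * ip mu tail f2 + ip mu o o.
  have kk : ip mu (le_k t) (le_k t) = tail t.
    by apply: eq_Rintegral => x _; rewrite /le_kernel ind_idem mulr1.
  have LQ := L2Z Q Lk.
  rewrite {1}/z ipBl// /z !ipBr// !ipZl// !ipZr// kk (ipC mu o (le_k t)) ip_le_Op.
  by move: (ip _ _ _) (ip _ _ _) (tail t); clear => x y z; ring.
have -> : \int[mu]_x (ind ((t <= x) && (x <= T)) *
    (c x * f2 x - lam * (f2 x * f2 x) - phi * (z x * z x))) =
    ip mu c f2 - lam * ip mu f2 f2 - phi * ip mu z z.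
  have i1 := L2_mul Lc Lf2; have i2 := L2_mul Lf2 Lf2; have i3 := L2_mul Lz Lz.
  rewrite -(ipZl lam Lf2 Lf2) -(ipZl phi Lz Lz).
  have i2' := L2_mul (L2Z lam Lf2) Lf2; have i3' := L2_mul (L2Z phi Lz) Lz.
  rewrite /ip -RintegralB// -RintegralB//; last exact: integrable_finB.
  apply: ae_Rintegral.
  - apply: measurable_funM.
      by apply: measurable_ind; apply: measurable_and; exact: measurable_fun_ler.
    apply: measurable_funB; last first.
      by apply: measurable_funM => //; apply: measurable_funM; exact: (L2_measurable Lz).
    apply: measurable_funB.
      by apply: measurable_funM; [exact: (L2_measurable Lc)|exact: (L2_measurable Lf2)].
    by apply: measurable_funM => //; apply: measurable_funM; exact: (L2_measurable Lf2).
  - apply: measurable_funB; last first.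
      by apply: measurable_funM; [exact: (L2_measurable (L2Z phi Lz))|exact: (L2_measurable Lz)].
    apply: measurable_funB.
      by apply: measurable_funM; [exact: (L2_measurable Lc)|exact: (L2_measurable Lf2)].
    by apply: measurable_funM; [exact: (L2_measurable (L2Z lam Lf2))|exact: (L2_measurable Lf2)].
  - apply: filterS (muT_ae_in T) => x /andP[_ ->]; rewrite andbT.
    have [xt|tx] := ltP x t; last by rewrite mul1r !mulrA.
    rewrite mul0r /z /o Op_leT_lt// /le_kernel /f2 leNgt xt /= !mul0r !mulr0.
    by rewrite !(subr0, mulr0, mul0r).
rewrite cE zE Q_split// ip_leT_f2 ipBl//; last exact: L2_gm.
rewrite ip_b_f2 ip_gm_f2 ip_Dop// -/o -/O -/Q.
move: (ip mu p f2) (ip mu (cutT g1) f2) (ip mu f2 O) (ip mu f2 f2) (ip mu tail f2) (ip mu o o)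
  (ip mu (fun=> 1) f2) (P T w) (tail t) (Q).
by move=> a1 a2 a3 a4 a5 a6 a7 a8 a9 a10; field.
Qed.

End path.
Section total.
Variables (v : R -> Omega -> R) (w : Omega) (P : R -> Omega -> R).
Let f : R -> R := cutT (v^~ w).
Hypothesis Lf : L2 mu f.
Let p : R -> R := cutT (P^~ w).
Hypothesis Lp : L2 mu p.

(** Since [Y = Z - 2 rho Q], passing from [Z] to [Y] adds [2 rho] times the integral of [Q u], which
    is [rho * (q ^+ 2 - Q_T ^+ 2)]: this absorbs the terminal penalty. The identity is [ip_le_sqr]
    for the running integral of the control. *)
Lemma Jtot_path : RInt 0 T (fun t => (P t w - Zu h0 G v t w) * v t w)
      - lam * RInt 0 T (fun t => (v t w) ^+ 2)
      + Qu q v T w * P T w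
      - phi * RInt 0 T (fun t => (Qu q v t w) ^+ 2)
      - rho * (Qu q v T w) ^+ 2 = Jt T q lam rho phi P h0 G v 0 w - rho * q ^+ 2.
Proof.
have TT : inT T by rewrite /in_horizon (ltW T0) lexx.
have Lo := L2_Op (kernT kle) Lf; have LO := L2_Op kG2 Lf.
have [_ Lh] := (sq_int_L2 T h0).1 h0T.
pose o := Op mu leT f; pose O := Op mu (cut2 T G) f.
pose a x := p x - cutT h0 x - O x.
have La : L2 mu a by apply: L2B => //; exact: L2B.
have L1 := L2_cst mu 1.
have Lq : L2 mu (fun=> q) by exact: L2_cst.
pose z x := q - o x.
have Lz : L2 mu z by exact: L2B.
have m1 := measurable_funM (L2_measurable La) (L2_measurable Lf).
have m2 := measurable_funM (L2_measurable Lf) (L2_measurable Lf).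
have m3 := measurable_funM (L2_measurable Lz) (L2_measurable Lz).
have m4 := measurable_funM (L2_measurable (L2Z (2 * rho) Lz)) (L2_measurable Lf).
have aE x : inT x -> (P x w - Zu h0 G v x w) * v x w = a x * f x.
  by move=> xT; rewrite Zu_E// /a /p /f /O !(cutTE _ xT) opprD addrA.
have fE x : inT x -> v x w = f x by move=> xT; rewrite /f (cutTE _ xT).
have zE x : inT x -> Qu q v x w = z x by move=> xT; rewrite Qu_E.
rewrite (RInt_full m1 aE).
rewrite (RInt_full (f := fun t => v t w ^+ 2) m2); last by move=> x xT; rewrite fE// expr2.
rewrite (RInt_full (f := fun t => Qu q v t w ^+ 2) m3); last by move=> x xT; rewrite zE// expr2.
rewrite /Jt (@RInt_full _ _ _ (fun x => (a x + 2 * rho * z x) * f x - lam * f x * f x - phi * z x * z x)); first last.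
- move=> x xT; rewrite /Yu [in RHS]mulrDl -aE// -zE// -fE//.
  by move: (Zu _ _ _ _ _) (Qu _ _ _ _) (v _ _) (P _ _) => z1 z2 z3 z4; ring.
- apply: measurable_funB; last first.
    exact: measurable_funM (L2_measurable (L2Z phi Lz)) (L2_measurable Lz).
  apply: measurable_funB; last first.
    exact: measurable_funM (L2_measurable (L2Z lam Lf)) (L2_measurable Lf).
  exact: measurable_funM (L2_measurable (L2D La (L2Z (2 * rho) Lz))) (L2_measurable Lf).
have Lz2 := L2Z (2 * rho) Lz.
have i1 := L2_mul (L2D La Lz2) Lf.
have i2 := L2_mul (L2Z lam Lf) Lf; have i3 := L2_mul (L2Z phi Lz) Lz.
rewrite RintegralB//; last exact: integrable_finB.
rewrite RintegralB//.
rewrite -!/(ip mu _ _) (ipDl La Lz2 Lf) (ipZl (2 * rho) Lz Lf) (ipZl lam Lf Lf) (ipZl phi Lz Lz).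
have -> : ip mu z f = ip mu (fun=> q) f - ip mu (Op mu leT f) f by exact: ipBl.
have eo : ip mu (Op mu leT f) f = 2^-1 * (\int[mu]_x f x) ^+ 2.
  by rewrite -ip_le_sqr// ipC; field.
have eq1 : ip mu (fun=> q) f = q * \int[mu]_x f x.
  rewrite -RintegralZl//; exact: L2_integrable.
have -> : Qu q v T w = q - \int[mu]_x f x.
  rewrite Qu_E//; congr (_ - _); apply: eq_Rintegral => x _.
  rewrite /le_kernel /f /cut_horizon; have [/andP[_ ->]|_] := boolP (inT x).
    by rewrite mul1r.
  by rewrite !mul0r mulr0.
rewrite eo eq1.
move: (ip _ _ _) (ip _ _ _) (ip _ _ _) (\int[mu]_x f x).
by move=> x y z' m; field.
Qed.
End total.
End paths.

(** * Processes on a filtered space *)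

Definition adapted_ae (R : realType) d (Omega : measurableType d) (F : R -> set (set Omega))
    (mu : {finite_measure set R -> \bar R}) (Z : R -> Omega -> R) :=
  {ae mu, forall s, measurable_fun setT (Z s : g_sigma_algebraType (F s) -> R)}.

Section filtered_processes.
Context (R : realType) d (Omega : measurableType d) (Pr : probability Omega R).
Variables (T : R) (F : R -> set (set Omega)).
Hypothesis T0 : 0 < T.
Hypothesis uF : usual_filtration Pr T F.
Let mu := muT T.
Local Notation Om t := (g_sigma_algebraType (F t)).
Local Notation inT := (in_horizon T).
Implicit Types X Y : R -> Omega -> R.

(** The null sets of [F 0] allow a version to be changed almost surely: the preimages under [f] and
    [g] differ only inside a null set, all of whose subsets lie in [F 0]. *)
Lemma ae_complete_measurable (H : set (set Omega)) (f g : Omega -> R) :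
  sigma_algebra setT H -> F 0 `<=` H ->
  measurable_fun setT (f : g_sigma_algebraType H -> R) -> {ae Pr, forall w, f w = g w} ->
  measurable_fun setT (g : g_sigma_algebraType H -> R).
Proof.
move=> sH FH mf [N [mN N0 sN]]; have [_ [_ [null _]]] := uF.
have Hnull A : A `<=` N -> measurable (A : set (g_sigma_algebraType H)).
  by move=> AN; apply/(sub_measurableE sH)/FH; exact: null AN.
move=> _ B mB; rewrite setTI.
have -> : g @^-1` B = (f @^-1` B `\` N) `|` (g @^-1` B `&` N).
  apply/seteqP; split=> w /=.
    have [Nw|Nw] := pselect (N w); first by right.
    move=> gB; left; split=> //.
    by have -> : f w = g w by apply: contrapT => h; apply: Nw; exact: sN.
  move=> [[fB Nw]|[]//].
  by have <- : f w = g w by apply: contrapT => h; apply: Nw; exact: sN.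
apply: measurableU; last by apply: Hnull => w [].
apply: measurableD; last exact: Hnull.
by rewrite -[X in measurable X]setTI; exact: mf.
Qed.

Lemma ae_sub_measurable t (f g : Omega -> R) : Icc 0 T t ->
  measurable_fun setT (f : Om t -> R) -> {ae Pr, forall w, f w = g w} ->
  measurable_fun setT (g : Om t -> R).
Proof.
move=> tT; have I0 : Icc 0 T 0 by rewrite /Icc/= lexx ltW.
apply: ae_complete_measurable; first exact: filtration_sigma uF _ tT.
by have /andP[t0 _] := tT; exact: (filtration_mono uF I0 tT t0).
Qed.

Lemma ae_measurable (f g : Omega -> R) :
  measurable_fun setT f -> {ae Pr, forall w, f w = g w} -> measurable_fun setT g.
Proof.
have I0 : Icc 0 T 0 by rewrite /Icc/= lexx ltW.
have sM : sigma_algebra setT (measurable : set (set Omega)) by exact: sigma_algebra_measurable.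
move=> mf fg; apply: (sub_measurable_fun sM (fun=> id)).
apply: ae_complete_measurable fg => //; first exact: filtration_sub uF _ I0.
by apply/(sub_measurable_funP sM) => B mB; rewrite -[X in measurable X]setTI; exact: mf.
Qed.

Lemma progressive_eq X Y : (forall s w, Icc 0 T s -> X s w = Y s w) ->
  progressive T F X -> progressive T F Y.
Proof.
move=> XY pX t tT B mB; have := pX t tT B mB; congr (<<s _, _ >> _).
have /andP[_ tT'] := tT.
have E p : Icc 0 t p.1 -> X p.1 p.2 = Y p.1 p.2.
  by move=> /andP[p0 pt]; apply: XY; rewrite /Icc/= p0 (le_trans pt tT').
by apply/seteqP; split=> p /= [h]; [rewrite E|rewrite -E].
Qed.

Lemma L2P_cut X : progressive T F X -> sq_int_proc Pr T X ->
  L2P Pr mu (fun s w => cut_horizon T (X^~ w) s).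
Proof.
move=> pX sX; have mX := progressive_measurable T0 uF pX.
apply: L2P_intro => //; move: sX; congr (_ < _)%E; apply: eq_integral => w _.
rewrite integral_muT; first by apply: eq_integral => s /set_mem h; rewrite cutTE.
by apply/measurable_EFinP; apply: measurable_funX; exact: measurable_fun_pair1 mX.
Qed.

Lemma L2P_sq_int X : L2P Pr mu X -> sq_int_proc Pr T X.
Proof.
move=> LX; rewrite /sq_int_proc; have := L2P_finite LX; congr (_ < _)%E.
apply: eq_integral => w _; rewrite integral_muT//.
apply/measurable_EFinP; apply: measurable_funX.
exact: measurable_fun_pair1 (L2_measurable LX).
Qed.

Lemma ip_path_rv (k : R -> R) (h : R -> Omega -> R) (Z : Omega -> R) :
  L2 mu k -> L2P Pr mu h -> L2 Pr Z ->
  ip Pr (fun w => ip mu k (h^~ w)) Z = \int[mu]_x (k x * ip Pr (h x) Z).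
Proof.
move=> Lk Lh LZ; have Lt := L2P_tensor Lk LZ.
transitivity (\int[Pr]_w ip mu (fun x => k x * Z w) (h^~ w)).
  have mL : measurable_fun setT (fun w => ip mu (fun x => k x * Z w) (h^~ w)).
    apply: (@measurable_path_ip _ mu _ _ (fun w x => k x * Z w)); last exact: (L2_measurable Lh).
    apply: measurable_funM.
      exact: (measurableT_comp (L2_measurable Lk) measurable_snd).
    exact: (measurableT_comp (L2_measurable LZ) measurable_fst).
  apply: ae_Rintegral => //.
    apply: measurable_funM (L2_measurable LZ).
    exact: (L2_measurable (L2_path_ip Lk Lh)).
  apply: filterS (L2P_path Lh) => w Lw; rewrite mulrC -ipZl//.
  by apply: eq_ip => // x; rewrite mulrC.
rewrite (exp_path_ip Lt Lh).
have m1 : measurable_fun setT (fun x => ip Pr (h x) Z).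
  apply: (@measurable_Rint _ _ _ _ _ Pr (fun p : R * Omega => h p.1 p.2 * Z p.2)).
  apply: measurable_funM; first exact: (L2_measurable Lh).
  exact: (measurableT_comp (L2_measurable LZ) measurable_snd).
apply: ae_Rintegral.
- apply: (@measurable_Rint _ _ _ _ _ Pr (fun p : R * Omega => k p.1 * Z p.2 * h p.1 p.2)).
  by apply: measurable_funM; [exact: (L2_measurable Lt)|exact: (L2_measurable Lh)].
- by apply: measurable_funM => //; exact: (L2_measurable Lk).
- apply: filterS (L2P_time Lh) => x Lx.
  by rewrite (ipC _ (h x)) -ipZl.
Qed.

Lemma condexp_ip_L2 t (X Y Z : Omega -> R) : Icc 0 T t -> is_condexp Pr (F t) X Y ->
  measurable_fun setT (Z : Om t -> R) -> L2 Pr X -> L2 Pr Z -> ip Pr X Z = ip Pr Y Z.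
Proof.
move=> tT cXY mZ LX LZ; have sF := filtration_sigma uF tT; have FM := filtration_sub uF tT.
have [LY _] := condexp_L2 sF FM cXY LX.
by apply: (condexp_test sF FM cXY mZ); exact: L2_mul.
Qed.

(** [X] is viewed as a field constant in time. The horizon has positive measure, so a version good
    for almost every [s] is good for some [s]. *)
Lemma condexp_exists t (X : Omega -> R) : Icc 0 T t ->
  Pr.-integrable setT (EFin \o X) -> exists Y : Omega -> R, is_condexp Pr (F t) X Y.
Proof.
move=> tT iX; have mX := integrable_measurable iX.
have iX' : {ae muT T, forall s : R, Pr.-integrable setT (EFin \o X)} by exact: nearW.
have [Y [_ [N [mN N0 sN]]]] := @fixed_projection _ _ _ _ _ _ uF t (fun _ => X) tT
  (measurableT_comp mX measurable_snd) iX'.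
apply: contrapT => nY.
have p0 : (0 < muT T setT)%E by rewrite muTE setTI leb_Icc ?ltW// lte_fin subr0.
suff : (muT T setT <= 0)%E by rewrite leNgt p0.
rewrite -N0 le_measure// ?inE// => s _; apply: sN => /= h.
by apply: nY; exists (Y s).
Qed.

Lemma condexp_tower s t (X Y Z : Omega -> R) : Icc 0 T s -> Icc 0 T t -> t <= s ->
  is_condexp Pr (F s) X Y -> is_condexp Pr (F t) X Z -> is_condexp Pr (F t) Y Z.
Proof.
move=> sT tT ts [_ [_ [iY YX]]] [_ [mZ [iZ ZX]]]; split=> //; split=> //; split=> // A FA.
by rewrite ZX// YX//; exact: (filtration_mono uF tT sT ts).
Qed.

Lemma condexpM_L2 t (X Y Z : Omega -> R) : Icc 0 T t -> is_condexp Pr (F t) X Y ->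
  measurable_fun setT (Z : Om t -> R) -> L2 Pr X -> L2 Pr Z ->
  is_condexp Pr (F t) (fun w => X w * Z w) (fun w => Y w * Z w).
Proof.
move=> tT cXY mZ LX LZ; have sF := filtration_sigma uF tT; have FM := filtration_sub uF tT.
have [LY _] := condexp_L2 sF FM cXY LX; have mY := condexp_sub sF cXY.
apply: condexp_intro => //; [exact: L2_mul|exact: measurable_funM|exact: L2_mul|].
move=> A FA; have mA := sub_measurable_indic (R := R) sF FA.
have LZA : L2 Pr (fun w => Z w * \1_A w).
  have := L2_bndM (sub_measurable_fun sF FM mA) (@indic_norm R _ _ A) LZ.
  by congr L2; apply/funext => w; rewrite mulrC.
have := condexp_ip_L2 tT cXY (measurable_funM mZ mA) LX LZA.
rewrite /ip => e; rewrite (@eq_Rintegral _ _ _ _ _ (fun w => Y w * (Z w * \1_A w))).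
  by rewrite -e; apply: eq_Rintegral => w _; rewrite mulrA.
by move=> w _; rewrite mulrA.
Qed.

(** Conditional Fubini. Measurability of [Y] for the Borel sets times [F t] makes its time integral
    [F t]-measurable; on each event of [F t] the two integrals are exchanged. *)
Lemma condexp_time_integral t X Y : Icc 0 T t ->
  (mu \x Pr)%E.-integrable setT (EFin \o (fun p => X p.1 p.2)) ->
  (mu \x Pr)%E.-integrable setT (EFin \o (fun p => Y p.1 p.2)) ->
  measurable_fun setT (fun p : R * Om t => Y p.1 p.2) ->
  {ae mu, forall s, is_condexp Pr (F t) (X s) (Y s)} ->
  is_condexp Pr (F t) (fun w => \int[mu]_s X s w) (fun w => \int[mu]_s Y s w).
Proof.
move=> tT iX iY mY cXY; have sF := filtration_sigma uF tT; have FM := filtration_sub uF tT.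
apply: (condexp_intro sF FM).
- exact: (Rfubini_integrable (integrable_swap iX)).
- apply: (@measurable_Rint _ _ _ _ _ mu (fun p : Om t * R => Y p.2 p.1)).
  apply: (measurableT_comp mY (g := fun p : Om t * R => (p.2, p.1))).
  by apply: measurable_fun_pair; [exact: measurable_snd|exact: measurable_fst].
- exact: (Rfubini_integrable (integrable_swap iY)).
move=> A FA; have mA := sub_measurable_fun sF FM (sub_measurable_indic (R := R) sF FA).
have E (Z : R -> Omega -> R) : (mu \x Pr)%E.-integrable setT (EFin \o (fun p => Z p.1 p.2)) ->
    \int[Pr]_w (\int[mu]_s Z s w * \1_A w) = \int[mu]_s \int[Pr]_w (Z s w * \1_A w).
  move=> iZ; rewrite (@Rfubini _ _ _ _ _ mu Pr (fun p => Z p.1 p.2 * \1_A p.2)).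
    apply: eq_Rintegral => w _; rewrite indicE; case: (w \in A).
      by rewrite mulr1; apply: eq_Rintegral => s _; rewrite mulr1.
    rewrite mulr0; symmetry; rewrite (@eq_Rintegral _ _ _ _ _ (fun=> 0)).
      by rewrite Rintegral_cst// mul0r.
    by move=> s _; rewrite mulr0.
  have mZ : measurable_fun setT (fun p : R * Omega => Z p.1 p.2).
    by apply/measurable_EFinP; case/integrableP: iZ.
  have iN : (mu \x Pr)%E.-integrable setT (EFin \o (fun p : R * Omega => `|Z p.1 p.2|)).
    exact: (integrable_norm iZ).
  apply: (integrable_fin_le _ _ iN).
    by apply: measurable_funM => //; exact: (measurableT_comp mA measurable_snd).
  by move=> p; rewrite normrM ler_piMr// indic_norm.
rewrite (E _ iX) (E _ iY); apply: ae_Rintegral.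
- apply: (@measurable_Rint _ _ _ _ _ Pr (fun p : R * Omega => Y p.1 p.2 * \1_A p.2)).
  apply: measurable_funM; last exact: (measurableT_comp mA measurable_snd).
  by apply/measurable_EFinP; case/integrableP: iY.
- apply: (@measurable_Rint _ _ _ _ _ Pr (fun p : R * Omega => X p.1 p.2 * \1_A p.2)).
  apply: measurable_funM; last exact: (measurableT_comp mA measurable_snd).
  by apply/measurable_EFinP; case/integrableP: iX.
- by apply: filterS cXY => s cs; rewrite (condexp_indicM sF FM cs FA).
Qed.

(** Nonnegativity passes to [Y s] almost surely, so its mean absolute value is its mean, which
    equals that of [X s]. *)
Lemma condexp_prod_integrable t X Y : Icc 0 T t ->
  (mu \x Pr)%E.-integrable setT (EFin \o (fun p => X p.1 p.2)) ->
  (forall s w, 0 <= X s w) ->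
  measurable_fun setT (fun p : R * Omega => Y p.1 p.2) ->
  {ae mu, forall s, is_condexp Pr (F t) (X s) (Y s)} ->
  (mu \x Pr)%E.-integrable setT (EFin \o (fun p => Y p.1 p.2)).
Proof.
move=> tT iX X0 mY cXY; have sF := filtration_sigma uF tT; have FM := filtration_sub uF tT.
have mX : measurable_fun setT (EFin \o (fun p : R * Omega => X p.1 p.2)) by case/integrableP: iX.
have mY' : measurable_fun setT (EFin \o (fun p : R * Omega => Y p.1 p.2)).
  exact/measurable_EFinP.
apply/integrable12ltyP => //; have /integrable12ltyP := iX; move=> /(_ mX).
apply: le_lt_trans.
have mI (Z : R -> Omega -> R) : measurable_fun setT (EFin \o (fun p : R * Omega => Z p.1 p.2)) ->
    measurable_fun setT (fun s => \int[Pr]_w `|(EFin \o (fun p : R * Omega => Z p.1 p.2)) (s, w)|)%E.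
  move=> mZ; apply: (@measurable_fun_fubini_tonelli_F _ _ _ _ _ Pr
     (fun p => `|(EFin \o (fun p : R * Omega => Z p.1 p.2)) p|)%E) => //.
  exact: measurableT_comp.
apply: ae_ge0_le_integral => //.
- by move=> s _; exact: integral_ge0.
- exact: mI.
- by move=> s _; exact: integral_ge0.
- exact: mI.
apply: filterS cXY => s cs _.
have c0 : is_condexp Pr (F t) (fun=> 0) (fun=> 0).
  by apply: condexp_self => //; exact: (L2_integrable (L2_0 Pr)).
have ae0 : {ae Pr, forall w, 0 <= X s w} by exact: nearW.
have Y0 := condexp_le sF FM c0 cs ae0.
have [iXs [_ [iYs YX]]] := cs.
rewrite le_eqVlt; apply/orP; left; apply/eqP.
transitivity (\int[Pr]_w (Y s w)%:E)%E.
  apply: ae_eq_integral => //.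
  - by apply: measurableT_comp => //; case/integrableP: iYs.
  - by case/integrableP: iYs.
  - by apply: filterS Y0 => w h _ /=; rewrite ger0_norm.
rewrite YX; last by have [_ /(_ set0) hC _] := sF; rewrite -(setD0 setT); apply: hC; case: sF.
by apply: eq_integral => w _; rewrite /= ger0_norm.
Qed.

End filtered_processes.

(** * State variables and criterion along a control *)

Section state_processes.
Context (R : realType) d (Omega : measurableType d) (Pr : probability Omega R).
Variables (T : R) (F : R -> set (set Omega)).
Variables (q : R) (h0 : R -> R) (G : R -> R -> R) (rho phi : R).
Hypothesis T0 : 0 < T.
Hypothesis uF : usual_filtration Pr T F.
Hypothesis h0T : sq_int T h0.
Hypothesis GK : kernel_class T G.
Let mu := muT T.
Local Notation Om t := (g_sigma_algebraType (F t)).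
Local Notation inT := (in_horizon T).
Local Notation cutT := (cut_horizon T).
Local Notation L2P := (L2P Pr mu).
Local Notation Gk := (Gc T rho G).
Local Notation tail := (tail T).
Local Notation h0t := (h0t T rho q h0).
Let kGk : kern mu Gk := kern_Gc rho GK.

Variables (t : R) (v : R -> Omega -> R).
Hypothesis tT : Icc 0 T t.
Hypothesis av : admissible Pr T F v.
Let pv : progressive T F v. Proof. by case: av. Qed.

Definition past (s : R) (w : Omega) : R := ind (s < t) * cutT (v^~ w) s.
Definition future (s : R) (w : Omega) : R := ind (t <= s) * cutT (v^~ w) s.
Definition Qpast (w : Omega) : R := q - ip mu (fun=> 1) (past^~ w).
(** The function [gam] of the pair [g_t], rewritten from the control before [t]; see [gam_past]. In
    this form [F t]-measurability and square integrability can be read off. *)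
Definition gpast (s : R) (w : Omega) : R := ind (inT s) * (ind (t <= s) *
  (h0t s + ip mu (Gk s) (past^~ w) - 2 * phi * (Qpast w * tail s))).

Lemma L2P_v : L2P (fun s w => cutT (v^~ w) s).
Proof. by have [] := av; exact: (L2P_cut T0 uF). Qed.

Lemma L2P_past : L2P past.
Proof.
apply: (@L2P_bndM _ _ _ _ _ 1) => [|s w|]; [|exact: norm_ind|exact: L2P_v].
apply: measurable_ind; apply: measurable_fun_ltr => //; exact: measurable_fst.
Qed.

Lemma L2P_ind_le Y : L2P Y -> L2P (fun s w => ind (t <= s) * Y s w).
Proof.
move=> LY; apply: (@L2P_bndM _ _ _ _ _ 1) => [|s w|//]; last exact: norm_ind.
apply: measurable_ind; apply: measurable_fun_ler => //; exact: measurable_fst.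
Qed.

Lemma L2P_future : L2P future.
Proof. by apply: L2P_ind_le; exact: L2P_v. Qed.

Lemma L2_Qpast : L2 Pr Qpast.
Proof.
apply: L2B; first exact: L2_cst.
exact: (L2_path_ip (L2_cst mu 1) L2P_past).
Qed.

Lemma L2P_gpast : L2P gpast.
Proof.
apply: (@L2P_bndM _ _ _ _ _ 1) => [|s w|]; [|exact: norm_ind|].
  exact: (measurable_inT T measurable_fst).
apply: L2P_ind_le; apply: L2PB.
  apply: L2PD; first exact: (L2P_det Pr (L2_h0t rho q h0T)).
  exact: L2P_Op kGk L2P_past.
apply: L2PZ; have := L2P_tensor (L2_tail T) L2_Qpast.
by congr (L2P _); apply/funext => s; apply/funext => w; rewrite mulrC.
Qed.

Lemma past_sub : measurable_fun setT (fun p : R * Om t => past p.1 p.2).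
Proof.
have mi : measurable_fun setT (fun p : R * Om t => ind (p.1 < t) : R).
  apply: measurable_ind; apply: measurable_fun_ltr => //; exact: measurable_fst.
have := measurable_funM mi (progressive_cut uF tT pv); congr (measurable_fun _ _).
apply/funext => -[s w] /=; rewrite /past /cut_horizon /in_horizon.
have /andP[_ tT'] := tT.
by have [st|_] := ltP s t; rewrite ?mul0r// (ltW st) (le_trans (ltW st) tT').
Qed.

Lemma Qpast_sub : measurable_fun setT (Qpast : Om t -> R).
Proof.
apply: measurable_funB => //.
apply: (@measurable_path_ip _ mu _ (Om t) (fun _ _ => 1)) => //.
exact: past_sub.
Qed.

Lemma gpast_sub : measurable_fun setT (fun p : R * Om t => gpast p.1 p.2).
Proof.
have mQ := measurableT_comp Qpast_sub (@measurable_snd _ _ R (Om t)).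
have m1 (f : R -> R) : measurable_fun setT f ->
    measurable_fun setT (fun p : R * Om t => f p.1).
  by move=> mf; exact: (measurableT_comp mf measurable_fst).
apply: measurable_funM; first exact: (measurable_inT T measurable_fst).
apply: measurable_funM.
  by apply: measurable_ind; apply: measurable_fun_ler => //; exact: measurable_fst.
apply: measurable_funB; last first.
  apply: measurable_funM => //; apply: measurable_funM => //.
  apply: m1; exact: (L2_measurable (L2_tail T)).
apply: measurable_funD; first by apply: m1; exact: (L2_measurable (L2_h0t rho q h0T)).
exact: (@measurable_Op_path _ mu _ (Om t) _ past (kern_measurable kGk) past_sub).
Qed.

Lemma Qu_past w : L2 mu (cutT (v^~ w)) -> Qu q v t w = Qpast w.
Proof. by move=> Lw; exact: Qt_E. Qed.

Lemma gam_past w s : L2 mu (cutT (v^~ w)) ->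
  gam T phi t (g1u q rho h0 G v t w) (g2u q v t w) s = gpast s w.
Proof.
move=> Lw; rewrite /gpast; have [sT|sT] := boolP (inT s); last first.
  by rewrite /gam /cut_horizon (negbTE sT) !mul0r mulr0 subr0.
rewrite mul1r; have [st|ts] := ltP s t; last by rewrite gm_E// Qu_past// mul1r.
by rewrite gm_lt// mul0r.
Qed.

Lemma adapted_future : adapted_ae F mu future.
Proof.
apply: filterS (muT_ae_in T) => s sT; have [st|ts] := ltP s t.
  rewrite (_ : future s = fun=> 0); first exact: measurable_cst.
  by apply/funext => w; rewrite /future leNgt st mul0r.
have := progressive_adapted uF sT pv; congr (measurable_fun _ _).
by apply/funext => w; rewrite /future ts mul1r (cutTE _ sT).
Qed.

Section payoff.
Variables (P : R -> Omega -> R) (lam : R).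
Hypothesis pP : progressive T F P.
Hypothesis sP : sq_int_proc Pr T P.
Hypothesis LPT : L2 Pr (P T).
Local Notation K := (kap T rho phi G).
Let kK : kern mu K := kern_kap rho phi GK.
Local Notation D := (Dop mu K lam).
Let pb (s : R) (w : Omega) : R := cutT (fun s => P s w - P T w) s.
Hypothesis Lpb : L2P pb.

(* [Jt] as a quadratic function of the future control, given the past one. *)
Definition Jx (w : Omega) : R :=
  ip mu (fun s => pb s w - gpast s w) (future^~ w)
  - 2^-1 * ip mu (future^~ w) (D (future^~ w))
  + P T w * Qpast w - phi * Qpast w ^+ 2 * tail t.

Lemma Jt_Jx : {ae Pr, forall w, Jt T q lam rho phi P h0 G v t w = Jx w}.
Proof.
apply: filterS2 (L2P_path L2P_v) (L2P_path (L2P_cut T0 uF pP sP)) => w Lw LPw.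
rewrite Jpath// /Jx -Qu_past//; congr (_ - _ * _ + _ - _).
by apply: eq_ip => // s; rewrite gam_past.
Qed.

Lemma integrable_Jx : Pr.-integrable setT (EFin \o Jx).
Proof.
have Lf := L2P_future; have LQ := L2_Qpast.
have LD : L2P (fun s w => D (future^~ w) s).
  by apply: L2PD; [exact: L2PZ|exact: L2P_Op kK Lf].
apply: integrable_finB; last first.
  have := integrable_finZ (phi * tail t) (L2_mul LQ LQ).
  by congr (_.-integrable _ _); apply/funext => w /=; rewrite expr2; congr EFin; ring.
apply: integrable_finD; last exact: L2_mul.
apply: integrable_finB; last by apply: integrable_finZ; exact: integrable_path_ip Lf LD.
exact: (integrable_path_ip (L2PB Lpb L2P_gpast) Lf).
Qed.

Lemma integrable_Jt : Pr.-integrable setT (EFin \o Jt T q lam rho phi P h0 G v t).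
Proof.
have aeJ : {ae Pr, forall w, Jx w = Jt T q lam rho phi P h0 G v t w}.
  by apply: filterS Jt_Jx => w.
apply: (ae_integrable integrable_Jx _ aeJ).
exact: (ae_measurable T0 uF (integrable_measurable integrable_Jx) aeJ).
Qed.

End payoff.
End state_processes.

(** * The optimal control *)

Section control.
Context (R : realType) d (Omega : measurableType d) (Pr : probability Omega R).
Variables (T : R) (F : R -> set (set Omega)) (P : R -> Omega -> R).
Variables (q : R) (h0 : R -> R) (G : R -> R -> R) (lam rho phi : R).
Hypothesis T0 : 0 < T.
Hypothesis uF : usual_filtration Pr T F.
Hypothesis pP : progressive T F P.
Hypothesis sP : sq_int_proc Pr T P.
Hypothesis sPT : (\int[Pr]_w ((P T w) ^+ 2)%:E < +oo)%E.
Hypothesis h0T : sq_int T h0.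
Hypothesis GK : kernel_class T G.
Hypothesis lam0 : 0 < lam.
Hypothesis rho0 : 0 <= rho.
Hypothesis phi0 : 0 <= phi.
Let mu := muT T.
Let K := kap T rho phi G.
Let kK : kern mu K := kern_kap rho phi GK.
Let Ksym : forall x y, K x y = K y x := kap_sym T rho phi G.
Variable r : R -> R -> R.
Hypothesis kr : kern mu r.
Hypothesis r_supp : forall s x, x < s -> r s x = 0.
Hypothesis r_eq : forall s x, s <= x ->
  2 * lam * r s x + ip mu (K x) (r s) = K s x.

Local Notation Om t := (g_sigma_algebraType (F t)).
Local Notation inT := (in_horizon T).
Local Notation cutT := (cut_horizon T).
Local Notation A := (Aop mu r).
Local Notation As := (Aadj mu r).
Local Notation D := (Dop mu K lam).
Local Notation L2P := (L2P Pr mu).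
Local Notation gamma0 := (gamma0 T rho phi q h0).
Local Notation X := (Xk mu K r lam).
Let kX : kern mu X := kern_Xk lam kK kr.
Let l2 : 2 * lam != 0. Proof. by rewrite mulf_neq0// gt_eqF. Qed.

Let TT : Icc 0 T T. Proof. by rewrite /Icc/= lexx ltW. Qed.

Lemma L2_PT : L2 Pr (P T).
Proof.
have mP : measurable_fun setT (P T).
  apply: (sub_measurable_fun (filtration_sigma uF TT) (filtration_sub uF TT)).
  exact: progressive_adapted uF _ _ TT pP.
split=> //; apply/integrableP; split.
  by apply/measurable_EFinP; exact: measurable_funX.
by under eq_integral do rewrite /= ger0_norm ?sqr_ge0//.
Qed.

Definition pb (s : R) (w : Omega) : R := cutT (fun s => P s w - P T w) s.

Lemma pbE s w : pb s w = cutT (P^~ w) s - ind (inT s) * P T w.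
Proof. by rewrite /pb /cut_horizon mulrBr. Qed.

Lemma L2P_pb : L2P pb.
Proof.
have Lc : L2 mu (fun s => ind (inT s)).
  by apply: (@L2_bnd _ _ _ _ 1) => [|x]; [exact: measurable_inT_id|exact: norm_ind].
have := L2PB (L2P_cut T0 uF pP sP) (L2P_tensor Lc L2_PT).
by congr (L2P _); apply/funext => s; apply/funext => w; rewrite pbE.
Qed.

Definition beta0 (s : R) (w : Omega) : R := pb s w + gamma0 s.

Lemma L2P_beta0 : L2P beta0.
Proof. by apply: L2PD L2P_pb _; apply: L2P_det; exact: L2_gamma0. Qed.

Lemma L2P_A Y : L2P Y -> L2P (fun s w => A (Y^~ w) s).
Proof. by move=> LY; apply: L2PB => //; exact: L2P_Op kr LY. Qed.

Definition zeta (s : R) (w : Omega) : R := A (beta0^~ w) s.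

Lemma L2P_zeta : L2P zeta.
Proof. exact: L2P_A L2P_beta0. Qed.

Lemma xi_exists : exists xi : R -> Omega -> R, [/\ progressive T F xi,
  forall s w, ~~ inT s -> xi s w = 0, L2P xi &
  {ae mu, forall s, is_condexp Pr (F s) (zeta s) (xi s)}].
Proof.
have iz : {ae muT T, forall s, Pr.-integrable setT (EFin \o zeta s)}.
  by apply: filterS (L2P_time L2P_zeta) => s; exact: L2_integrable.
have [Y [pY cY]] := optional_projection T0 uF (L2_measurable L2P_zeta) iz.
pose xi s w := cutT (Y^~ w) s.
have cx : {ae mu, forall s, is_condexp Pr (F s) (zeta s) (xi s)}.
  apply: filterS2 (muT_ae_in T) cY => s sT.
  by congr is_condexp; apply/funext => w; rewrite /xi (cutTE _ sT).
have px : progressive T F xi.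
  by apply: progressive_eq pY => s w sT; rewrite /xi (cutTE _ sT).
exists xi; split=> //.
- by move=> s w sT; rewrite /xi /cut_horizon (negbTE sT) mul0r.
- apply: (L2P_condexp L2P_zeta (G := F)).
    exact: (progressive_measurable T0 uF pY).
  apply: filterS2 (muT_ae_in T) cx => s sT cs; split=> //.
    exact: (filtration_sigma uF sT).
  exact: (filtration_sub uF sT).
Qed.

Variable xi : R -> Omega -> R.
Hypothesis xi_prog : progressive T F xi.
Hypothesis xi_cut : forall s w, ~~ inT s -> xi s w = 0.
Hypothesis Lxi : L2P xi.
Hypothesis cxi : {ae mu, forall s, is_condexp Pr (F s) (zeta s) (xi s)}.

(* Since [A D A^* = 2 lam], this is the process with [A D u = xi]; it is progressive because
   [A^*] only looks at the past. *)
Definition ust (s : R) (w : Omega) : R := (2 * lam)^-1 * As (xi^~ w) s.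

Lemma L2P_ust : L2P ust.
Proof. by apply: L2PZ; apply: L2PB => //; exact: L2P_Op (kernT kr) Lxi. Qed.

Lemma progressive_ust : progressive T F ust.
Proof.
apply/(progressive_strip uF) => t tT.
have mx := progressive_cut uF tT xi_prog.
have mr : measurable_fun setT (fun p : R * R => r p.2 p.1).
  exact: (kern_measurable (kernT kr)).
have mi : measurable_fun setT (fun p : R * Om t =>
    ip mu (fun x => r x p.1) (fun x => ind ((0 <= x) && (x <= t)) * xi x p.2)).
  exact: (@measurable_Op_path _ mu _ (Om t) (fun s x => r x s)
    (fun x w => ind ((0 <= x) && (x <= t)) * xi x w) mr mx).
have m := measurable_funM (@measurable_cst _ _ (R * Om t)%type R setT (2 * lam)^-1) (measurable_funB mx mi).
apply: (eq_measurable_fun _ _ (measurable_funS measurableT (@subsetT _ _) m)).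
move=> [s w] /set_mem /= sI; have /andP[s0 st] := sI; rewrite /ust /Aadj.
rewrite /cst /= s0 st mul1r; congr (_ * (_ - _)); apply: eq_Rintegral => x _ /=.
have [xt|tx] := leP x t; last by rewrite r_supp ?mul0r// (le_lt_trans st tx).
have [x0|x0] := leP 0 x; first by rewrite mul1r.
by rewrite mul0r xi_cut// /in_horizon leNgt x0.
Qed.

Lemma admissible_ust : admissible Pr T F ust.
Proof. by split; [exact: progressive_ust|exact: L2P_sq_int L2P_ust]. Qed.

Definition eta (s : R) (w : Omega) : R := xi s w - zeta s w.
(* The gradient of the criterion at [ust], up to sign ([D_ust]); being an upper triangular
   transform of [xi - zeta] it is orthogonal to adapted processes ([res_orth]). *)
Definition res (s : R) (w : Omega) : R := eta s w + (2 * lam)^-1 * ip mu (X s) (eta^~ w).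

Lemma L2P_eta : L2P eta. Proof. exact: L2PB L2P_zeta. Qed.
Lemma L2P_res : L2P res.
Proof. by apply: L2PD L2P_eta _; apply: L2PZ; exact: L2P_Op kX L2P_eta. Qed.

Let Dop_AA f x (Lf : L2 mu f) := Dop_Aadj_Aop kK Ksym (muT_set1 T) (muT_weight T0)
  kr r_supp r_eq x Lf.

(** [D A^*] is [2 lam] plus the kernel [X], and [beta0] is [(2 lam)^-1 D A^*] of [zeta]; the
    remainder is the same operator applied to [xi - zeta]. *)
Lemma D_ust w s : L2 mu (xi^~ w) -> L2 mu (beta0^~ w) ->
  D (ust^~ w) s = beta0 s w + res s w.
Proof.
move=> Lx Lb; have Lz : L2 mu (zeta^~ w) := L2_Aop kr Lb.
have Lr := kern_row s kX.
have -> : D (ust^~ w) s = xi s w + (2 * lam)^-1 * ip mu (X s) (xi^~ w).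
  have := Dop_Aadj lam kK kr s Lx.
  have LA := L2_Aadj kr Lx.
  rewrite /Dop /ust /Op ipZr//; last exact: (kern_row s kK).
  rewrite mulrCA -mulrDr => ->; rewrite mulrDr mulrA mulVf// mul1r//.
have E : ip mu (X s) (eta^~ w) = ip mu (X s) (xi^~ w) - ip mu (X s) (zeta^~ w).
  exact: ipBr.
have : D (As (zeta^~ w)) s = 2 * lam * beta0 s w := Dop_AA s Lb.
rewrite (Dop_Aadj lam kK kr)// => e.
have -> : beta0 s w = (2 * lam)^-1 * (2 * lam * zeta s w + ip mu (X s) (zeta^~ w)).
  by rewrite e mulrA mulVf// mul1r.
rewrite /res E /eta (mulrDr _ (2 * lam * _)) (mulrA _ (2 * lam)) mulVf// mul1r.
by move: (zeta s w) (ip _ _ _) (ip _ _ _) => a b c; ring.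
Qed.

Lemma A_D_ust w s : L2 mu (xi^~ w) -> A (D (ust^~ w)) s = xi s w.
Proof.
move=> Lx; have LA := L2_Aadj kr Lx; have LD := L2_Dop lam kK LA.
have E x : D (ust^~ w) x = (2 * lam)^-1 * D (As (xi^~ w)) x.
  by rewrite /Dop /ust /Op ipZr//; [ring|exact: (kern_row x kK)].
have -> : A (D (ust^~ w)) s = A (fun x => (2 * lam)^-1 * D (As (xi^~ w)) x) s.
  by congr (A _ _); apply/funext.
rewrite (AopZ kr)// (Aop_Dop_Aadj kK Ksym (muT_set1 T) kr r_supp r_eq)//.
by rewrite mulrA mulVf// mul1r.
Qed.

Lemma eta_test : {ae mu, forall s, forall Z : Omega -> R,
  measurable_fun setT (Z : Om s -> R) -> L2 Pr Z -> ip Pr (eta s) Z = 0}.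
Proof.
apply: filterS3 (muT_ae_in T) cxi (L2P_time L2P_zeta) => s sT cs Ls Z mZ LZ.
have [Lx _] := condexp_L2 (filtration_sigma uF sT) (filtration_sub uF sT) cs Ls.
by rewrite /eta ipBl// (condexp_ip_L2 uF sT cs mZ)// subrr.
Qed.

(** [res s] involves [eta x] for [x >= s] only, and [eta x] is orthogonal to the variables
    measurable for [F x], which contains [F s]. *)
Lemma res_test : {ae mu, forall s, forall Z : Omega -> R,
  measurable_fun setT (Z : Om s -> R) -> L2 Pr Z -> ip Pr (res s) Z = 0}.
Proof.
have Le := L2P_eta; have LX := L2P_Op kX Le.
have ae2 : {ae mu, forall s, L2 Pr (eta s) /\ L2 Pr (fun w => ip mu (X s) (eta^~ w))}.
  by apply: filterS2 (L2P_time Le) (L2P_time LX) => s.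
apply: filterS3 (muT_ae_in T) eta_test ae2 => s sT es [Les LXs] Z mZ LZ; rewrite /res ipDl//; last exact: L2Z.
rewrite es// add0r ipZl// (ip_path_rv (kern_row s kX) Le LZ).
rewrite (@ae_Rintegral _ _ _ _ _ (fun=> 0)).
- by rewrite Rintegral_cst// mul0r mulr0.
- apply: measurable_funM; first exact: (L2_measurable (kern_row s kX)).
  apply: (@measurable_Rint _ _ _ _ _ Pr (fun p : R * Omega => eta p.1 p.2 * Z p.2)).
  apply: measurable_funM; first exact: (L2_measurable Le).
  exact: (measurableT_comp (L2_measurable LZ) measurable_snd).
- by [].
- apply: filterS2 (muT_ae_in T) eta_test => x xT ex.
  have [xs|sx] := leP x s; first by rewrite (Xk_causal Ksym r_eq)// mul0r.
  rewrite ex ?mulr0//; apply: (sub_measurable_mono _ _ _ mZ).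
  + exact: (filtration_sigma uF sT).
  + exact: (filtration_sigma uF xT).
  + exact: (filtration_mono uF sT xT (ltW sx)).
Qed.

Lemma res_orth (Z : R -> Omega -> R) : L2P Z -> adapted_ae F mu Z ->
  \int[Pr]_w ip mu (res^~ w) (Z^~ w) = 0.
Proof.
move=> LZ aZ; rewrite (exp_path_ip L2P_res LZ).
rewrite (@ae_Rintegral _ _ _ _ _ (fun=> 0)).
- by rewrite Rintegral_cst// mul0r.
- apply: (@measurable_Rint _ _ _ _ _ Pr (fun p : R * Omega => res p.1 p.2 * Z p.1 p.2)).
  by apply: measurable_funM; [exact: (L2_measurable L2P_res)|exact: (L2_measurable LZ)].
- by [].
- by apply: filterS3 res_test (L2P_time LZ) aZ => s h L m; exact: h.
Qed.

(** For an event [B] of [F t] the process [Z] times the indicator of [B] is still adapted, because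
    [Z] vanishes before [t]; orthogonality on every such [B] is the conditional statement. *)
Lemma res_condexp t (Z : R -> Omega -> R) : Icc 0 T t -> L2P Z -> adapted_ae F mu Z ->
  (forall s w, s < t -> Z s w = 0) ->
  is_condexp Pr (F t) (fun w => ip mu (res^~ w) (Z^~ w)) (fun=> 0).
Proof.
move=> tT LZ aZ Zt; have sF := filtration_sigma uF tT; have FM := filtration_sub uF tT.
apply: condexp_intro => //.
- exact: integrable_path_ip L2P_res LZ.
- exact: (L2_integrable (L2_0 Pr)).
move=> B FB.
rewrite (@eq_Rintegral _ _ _ _ _ (fun=> 0)); last by move=> w _; rewrite mul0r.
rewrite Rintegral_cst// mul0r.
have mB : measurable_fun setT (\1_B : Omega -> R) by apply: measurable_indic; exact: FM.
have LZB : L2P (fun s w => \1_B w * Z s w).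
  by apply: (L2P_rvM (M := 1)) => // w; exact: indic_norm.
symmetry; transitivity (\int[Pr]_w ip mu (res^~ w) (fun s => \1_B w * Z s w)).
  apply: ae_Rintegral.
  - apply: measurable_funM => //; apply: integrable_measurable.
    exact: integrable_path_ip L2P_res LZ.
  - by apply: integrable_measurable; exact: integrable_path_ip L2P_res LZB.
  - by apply: filterS2 (L2P_path L2P_res) (L2P_path LZ) => w Lr LZw; rewrite ipZr// mulrC.
apply: (res_orth LZB); apply: filterS2 (muT_ae_in T) aZ => s sT mZ.
have [st|ts] := ltP s t.
  rewrite (_ : (fun w => _) = (fun=> 0)); first exact: measurable_cst.
  by apply/funext => w; rewrite Zt// mulr0.
apply: measurable_funM => //; apply: (sub_measurable_indic (filtration_sigma uF sT)).
exact: (filtration_mono uF tT sT ts).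
Qed.


Lemma L2_ust w : L2 mu (xi^~ w) -> L2 mu (cutT (ust^~ w)).
Proof. by move=> Lx; apply: L2_cutT; apply: L2Z; exact: L2_Aadj. Qed.

Lemma D_cut f s : L2 mu f -> inT s -> D (cutT f) s = D f s.
Proof.
move=> Lf sT; rewrite /Dop cutTE//; congr (_ + _); rewrite /Op ipC [RHS]ipC.
apply: ip_ae (cutT_ae T f).
- exact: (L2_measurable (L2_cutT Lf)).
- exact: (L2_measurable Lf).
- exact: (L2_measurable (kern_row s kK)).
Qed.

(** The price part of [xi], its deterministic part being removed. It is a version of
    [P_s - M_s + <Theta_s, K_s>]; see [xib_E]. *)
Definition xib (s : R) (w : Omega) : R := xi s w - A gamma0 s.

Let Lg0 : L2 mu gamma0 := L2_gamma0 rho phi q h0T.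

Lemma L2P_xib : L2P xib.
Proof. by apply: L2PB => //; apply: L2P_det; exact: L2_Aop. Qed.

Section at_time.
Variable t : R.
Hypothesis tT : Icc 0 T t.
Local Notation u2 := (future T t ust).
Local Notation gu := (gpast T q h0 G rho phi t ust).
Local Notation Qt := (Qpast T q t ust).
Let Lu2 : L2P u2 := L2P_future T0 uF t admissible_ust.
Let Lgu : L2P gu := L2P_gpast q rho phi T0 uF h0T GK t admissible_ust.

Section path.
Variable w : Omega.
Hypothesis Lx : L2 mu (xi^~ w).
Hypothesis Lb : L2 mu (beta0^~ w).
Hypothesis Lg : L2 mu (gu^~ w).
Let Lu : L2 mu (ust^~ w). Proof. by apply: L2Z; exact: L2_Aadj. Qed.
Let Luc := L2_ust Lx.
Let Lf : L2 mu (u2^~ w) := L2_ind_le t Luc.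
Let LD : L2 mu (D (u2^~ w)) := L2_Dop lam kK Lf.

Lemma D_future s : inT s -> t <= s ->
  D (u2^~ w) s = D (ust^~ w) s - gamma0 s - gu s w.
Proof.
move=> sT ts; rewrite -(gam_past q h0 rho phi GK tT s Luc).
have := Dop_split rho phi lam q h0 GK Luc tT sT ts.
rewrite -(D_cut Lu sT).
move: (Dop _ _ _ _ s) (Dop _ _ _ _ s) => a b; lra.
Qed.

Lemma foc_path s : inT s -> t <= s -> pb s w - gu s w - D (u2^~ w) s = - res s w.
Proof.
move=> sT ts; rewrite D_future// D_ust// /beta0.
by move: (pb s w) (gu s w) (gamma0 s) (res s w) => a b c e; ring.
Qed.

(** At [s >= t] the operator [A] only looks at [x >= s], where [D_future] describes the gradient. *)
Lemma A_D_future s : inT s -> t <= s -> A (D (u2^~ w)) s = xib s w - A (gu^~ w) s.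
Proof.
move=> sT ts; have LDu := L2_Dop lam kK Lu.
have -> : A (D (u2^~ w)) s = A (fun x => (D (ust^~ w) x - gamma0 x) - gu x w) s.
  rewrite /Aop D_future//; congr (_ - _); apply: ae_Rintegral.
  - exact: measurable_funM (L2_measurable (kern_row s kr)) (L2_measurable LD).
  - apply: measurable_funM (L2_measurable (kern_row s kr)) _.
    exact: (L2_measurable (L2B (L2B LDu Lg0) Lg)).
  - apply: filterS (muT_ae_in T) => x xT.
    have [xs|sx] := ltP x s; first by rewrite r_supp// !mul0r.
    by rewrite D_future// (le_trans ts sx).
rewrite (AopB kr)//; last exact: L2B.
by rewrite (AopB kr)// A_D_ust.
Qed.

Let kge0 f : L2 mu f -> 0 <= ip mu f (Op mu K f) := kap_ge0 rho0 phi0 GK (f := f).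

Lemma future_Dinv : {ae mu, forall x, u2 x w = Dinv mu r lam t (D (u2^~ w)) x}.
Proof.
apply: (Dinv_unique kK Ksym lam0 kge0 (muT_set1 T) (muT_weight T0) kr r_supp r_eq LD Lf).
- by apply: nearW => x xt; rewrite /future leNgt xt mul0r.
- exact: nearW.
Qed.

Let y s := xib s w - A (gu^~ w) s.
Let Ly : L2 mu y.
Proof.
apply: L2B; last exact: L2_Aop.
by apply: L2B => //; exact: L2_Aop.
Qed.

(** The future control is recovered from its gradient by [D_t^-1], and [ip_Dinv] diagonalizes the
    resulting quadratic form. *)
Lemma ip_future_D : ip mu (u2^~ w) (D (u2^~ w)) =
  (2 * lam)^-1 * ip mu y (fun s => ind (t <= s) * y s).
Proof.
have LA := L2_Aop kr LD.
transitivity (ip mu (D (u2^~ w)) (Dinv mu r lam t (D (u2^~ w)))).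
  rewrite [RHS]ipC; apply: ip_ae future_Dinv.
  - exact: (L2_measurable Lf).
  - exact: (L2_measurable (L2_Dinv lam kr t LD)).
  - exact: (L2_measurable LD).
rewrite (ip_Dinv lam kr t LD LD); congr (_ * _); apply: ae_Rintegral.
- exact: measurable_funM (L2_measurable LA) (L2_measurable (L2_ind_le t LA)).
- exact: measurable_funM (L2_measurable Ly) (L2_measurable (L2_ind_le t Ly)).
- apply: filterS (muT_ae_in T) => s sT.
  have [st|ts] := ltP s t; first by rewrite !mul0r !mulr0.
  by rewrite A_D_future.
Qed.

(** At [s = t] the integral term of [A D] disappears: its kernel [X^~ t] lives on [x < t], where the
    future control vanishes. *)
Lemma feedback_path : 2 * lam * ust t w = xib t w - A (gu^~ w) t.
Proof.
rewrite -A_D_future// (Aop_Dop lam kK Ksym kr)// /future lexx mul1r cutTE//.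
rewrite [X in _ + X](_ : _ = 0) ?addr0// /ip (@eq_Rintegral _ _ _ _ _ (fun=> 0)).
  by rewrite Rintegral_cst// mul0r.
move=> x _; have [xt|tx] := ltP x t; first by rewrite mul0r mulr0.
by rewrite (Xk_causal Ksym r_eq)// mul0r.
Qed.

Hypothesis Lp : L2 mu (pb^~ w).
Hypothesis Lr : L2 mu (res^~ w).

(** On [[t, T]] the first-order condition replaces [pb - gu] by [D u2 - res]. Half of the quadratic
    form survives, whence [4 lam] in place of [2 lam]. *)
Lemma Jx_path : Jx T q h0 G rho phi t ust P lam w =
  (4 * lam)^-1 * ip mu y (fun s => ind (t <= s) * y s) - ip mu (res^~ w) (u2^~ w)
  + P T w * Qt w - phi * Qt w ^+ 2 * tail T t.
Proof.
rewrite /Jx; congr (_ + _ - _).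
have -> : ip mu (fun s => pb s w - gu s w) (u2^~ w) =
    ip mu (D (u2^~ w)) (u2^~ w) - ip mu (res^~ w) (u2^~ w).
  rewrite -ipBl//; apply: ae_Rintegral.
  - exact: measurable_funM (L2_measurable (L2B Lp Lg)) (L2_measurable Lf).
  - exact: measurable_funM (L2_measurable (L2B LD Lr)) (L2_measurable Lf).
  - apply: filterS (muT_ae_in T) => s sT.
    have [st|ts] := ltP s t.
      have -> : u2 s w = 0 by rewrite /future leNgt st mul0r.
      by rewrite !mulr0.
    congr (_ * _); have := foc_path sT ts.
    by move: (Dop _ _ _ _ _) (pb s w) (gu s w) (res s w) => a b c e; lra.
rewrite (ipC mu (D _)) ip_future_D.
move: (ip _ _ _) (ip _ _ _) => a b; field.
by rewrite gt_eqF.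
Qed.

End path.
End at_time.

Lemma xib_condexp : {ae mu, forall s, is_condexp Pr (F s) (fun w => A (pb^~ w) s) (xib s)}.
Proof.
have LA := L2P_A L2P_pb.
apply: filterS2 (muT_ae_in T) cxi => s sT cs.
have sF := filtration_sigma uF sT; have FM := filtration_sub uF sT.
have c0 : is_condexp Pr (F s) (fun=> A gamma0 s) (fun=> A gamma0 s).
  by apply: condexp_self => //; exact: (L2_integrable (L2_cst Pr _)).
have cB := condexpB sF FM cs c0.
apply: (condexp_ae sF FM cB).
- exact: measurable_fun_pair2 s (L2_measurable LA).
- exact: (condexp_sub sF cB).
- by apply: filterS (L2P_path L2P_pb) => w Lw; rewrite /zeta (AopD kr)// addrK.
- exact: nearW.
Qed.

Let kge0 f : L2 mu f -> 0 <= ip mu f (Op mu K f) := kap_ge0 rho0 phi0 GK (f := f).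

Lemma Dop_sym f g : L2 mu f -> L2 mu g -> ip mu f (D g) = ip mu g (D f).
Proof.
move=> Lf Lg; have LO := L2_Op kK Lf; have LO' := L2_Op kK Lg.
have e : ip mu f (Op mu K g) = ip mu g (Op mu K f).
  apply: etrans (Op_adj kK Lg Lf) _; apply: etrans (ipC mu _ _) _.
  apply: eq_ip => [x|x]; first by [].
  by apply: eq_ip => [y|y]; [exact: Ksym|].
rewrite /Dop (ipDr (L2Z _ Lg) LO' Lf) (ipDr (L2Z _ Lf) LO Lg) (ipZr _ Lg Lf) (ipZr _ Lf Lg).
by rewrite e (ipC mu g f).
Qed.

(** * Comparison with other controls *)

Section optimality.
Variables (t : R) (v : R -> Omega -> R).
Hypothesis tT : Icc 0 T t.
Hypothesis av : admissible Pr T F v.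
Hypothesis vu : forall s w, 0 <= s < t -> v s w = ust s w.
Local Notation u2 := (future T t ust).
Local Notation v2 := (future T t v).

Definition deviation (s : R) (w : Omega) : R := v2 s w - u2 s w.

Let past_eq : past T t v = past T t ust.
Proof.
apply/funext => s; apply/funext => w; rewrite /past; have [st|ts] := ltP s t; last by rewrite !mul0r.
congr (_ * _); rewrite /cut_horizon; have [/andP[s0 _]|_] := boolP (inT s); last by rewrite !mul0r.
by rewrite vu// s0.
Qed.

Lemma L2P_deviation : L2P deviation.
Proof.
by apply: L2PB; [exact: (L2P_future T0 uF t av)|exact: (L2P_future T0 uF t admissible_ust)].
Qed.

Lemma deviation_condexp :
  is_condexp Pr (F t) (fun w => ip mu (res^~ w) (deviation^~ w)) (fun=> 0).
Proof.
apply: (res_condexp tT L2P_deviation).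
  apply: filterS2 (adapted_future uF t av) (adapted_future uF t admissible_ust) => s h1 h2.
  exact: measurable_funB.
by move=> s w st; rewrite /deviation /future leNgt st /= !mul0r subrr.
Qed.

(** For a quadratic criterion the first-order expansion is exact: the gap also contains minus half
    of the form of [D] at the deviation, which coercivity makes nonpositive. Both controls share the
    same [gpast] and [Qpast]. *)
Lemma Jx_le : {ae Pr, forall w, Jx T q h0 G rho phi t v P lam w <=
  Jx T q h0 G rho phi t ust P lam w - ip mu (res^~ w) (deviation^~ w)}.
Proof.
have Lgu := L2P_gpast q rho phi T0 uF h0T GK t admissible_ust.
have ae1 : {ae Pr, forall w, L2 mu (xi^~ w) /\ L2 mu (beta0^~ w)}.
  by apply: filterS2 (L2P_path Lxi) (L2P_path L2P_beta0) => w.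
have ae2 : {ae Pr, forall w, [/\ L2 mu (pb^~ w), L2 mu (res^~ w) &
    L2 mu (gpast T q h0 G rho phi t ust ^~ w)]}.
  by apply: filterS3 (L2P_path L2P_pb) (L2P_path L2P_res) (L2P_path Lgu) => w.
apply: filterS3 ae1 ae2 (L2P_path (L2P_future T0 uF t av)) => w [Lx Lb] [Lp Lr Lg] Lv.
have Lu : L2 mu (u2^~ w) := L2_ind_le t (L2_ust Lx).
have LDu := L2_Dop lam kK Lu; have LDv := L2_Dop lam kK Lv.
rewrite /Jx /gpast /Qpast past_eq -/(Qpast T q t ust w).
set c := fun s => _ - _; have Lc : L2 mu c by exact: L2B.
have Ld : L2 mu (deviation^~ w) by exact: L2B.
have e1 : ip mu c (v2^~ w) = ip mu c (u2^~ w) + ip mu (D (u2^~ w)) (v2^~ w)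
   - ip mu (D (u2^~ w)) (u2^~ w) - ip mu (res^~ w) (deviation^~ w).
  have -> : ip mu c (v2^~ w) = ip mu c (u2^~ w) + ip mu c (deviation^~ w).
    by rewrite -ipDr//; apply: eq_ip => // s; rewrite /deviation addrC subrK.
  rewrite -!addrA; congr (_ + _); rewrite addrA -ipBr//.
  rewrite -/(deviation^~ w) -ipBl//; apply: ae_Rintegral.
  - exact: measurable_funM (L2_measurable Lc) (L2_measurable Ld).
  - exact: measurable_funM (L2_measurable (L2B LDu Lr)) (L2_measurable Ld).
  - apply: filterS (muT_ae_in T) => s sT; have [st|ts] := ltP s t.
      have -> : deviation s w = 0 by rewrite /deviation /future leNgt st /= !mul0r subrr.
      by rewrite !mulr0.
    congr (_ * _); have := foc_path tT Lx Lb sT ts; rewrite -[pb s w - _]/(c s).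
    by move: (Dop _ _ _ _ _) (c s) (res s w) => a b e; lra.
have pos : 0 <= ip mu (v2^~ w) (D (v2^~ w)) - 2 * ip mu (D (u2^~ w)) (v2^~ w)
    + ip mu (D (u2^~ w)) (u2^~ w).
  have h := Dop_coercive lam kK kge0 Ld; apply: (@le_trans _ _ (ip mu (deviation^~ w) (D (deviation^~ w)))).
    by apply: (le_trans _ h); rewrite mulr_ge0 ?ip_ge0// mulr_ge0// ltW.
  have -> : ip mu (deviation^~ w) (D (deviation^~ w)) =
      ip mu (deviation^~ w) (fun s => D (v2^~ w) s - D (u2^~ w) s).
    by apply: eq_ip => // s; exact: (DopB lam kK).
  rewrite ipBr// [X in X - _]ipBl// [X in _ - X]ipBl//.
  rewrite (Dop_sym Lu Lv) (ipC mu (v2^~ w) (D (u2^~ w))) (ipC mu (u2^~ w) (D (u2^~ w))).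
  by move: (ip _ _ _) (ip _ _ _) (ip _ _ _) => a b e; lra.
rewrite e1 (ipC mu (u2^~ w) (D (u2^~ w))); move: pos.
move: (ip _ _ _) (ip _ _ _) (ip _ _ _) (ip _ _ _) (ip _ _ _) (_ * Qpast _ _ _ _ _) (_ * tail _ _).
by move=> a1 a2 a3 a4 a5 a6 a7; lra.
Qed.

End optimality.

Lemma ip_ind_sqrB t (a b : R -> R) : L2 mu a -> L2 mu b ->
  ip mu (fun s => a s - b s) (fun s => ind (t <= s) * (a s - b s)) =
  ip mu a (fun s => ind (t <= s) * a s) - 2 * ip mu (fun s => ind (t <= s) * a s) b
  + ip mu b (fun s => ind (t <= s) * b s).
Proof.
move=> La Lb; have La1 := L2_ind_le t La; have Lb1 := L2_ind_le t Lb.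
rewrite (eq_ip (g' := fun s => ind (t <= s) * a s - ind (t <= s) * b s) mu
  (fun=> erefl)); last by move=> s; rewrite mulrBr.
rewrite ipBl//; last exact: L2B.
rewrite !ipBr// (ipC mu b (fun s => ind (t <= s) * a s)).
have -> : ip mu a (fun s => ind (t <= s) * b s) = ip mu (fun s => ind (t <= s) * a s) b.
  by apply: eq_Rintegral => s _; rewrite mulrCA mulrA.
by move: (ip _ _ _) (ip _ _ _) (ip _ _ _) => x y z; ring.
Qed.

(** * Feedback form and optimal value *)

Section versions.
Variables (M : R -> Omega -> R) (C : R -> R -> Omega -> R).
Hypothesis cM : forall t, Icc 0 T t -> is_condexp Pr (F t) (P T) (M t).
Hypothesis mC : forall t, Icc 0 T t -> measurable_fun setT (fun p : R * Om t => C t p.1 p.2).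
Hypothesis cC : forall t, Icc 0 T t -> {ae mu, forall s, is_condexp Pr (F t) (pb s) (C t s)}.

Definition Cc (t s : R) (w : Omega) : R := cutT (fun x => C t x w) s.

Lemma Cc_sub t : Icc 0 T t -> measurable_fun setT (fun p : R * Om t => Cc t p.1 p.2).
Proof.
move=> tT; apply: measurable_funM; last exact: mC.
exact: (measurable_inT T measurable_fst).
Qed.

Lemma Cc_condexp t : Icc 0 T t -> {ae mu, forall s, is_condexp Pr (F t) (pb s) (Cc t s)}.
Proof.
move=> tT; apply: filterS2 (muT_ae_in T) (cC tT) => s sT.
by congr is_condexp; apply/funext => w; rewrite /Cc (cutTE _ sT).
Qed.

Lemma L2P_Cc t : Icc 0 T t -> L2P (Cc t).
Proof.
move=> tT; apply: (L2P_condexp L2P_pb (G := fun=> F t)).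
  exact: (measurable_prod_from_sub uF tT (Cc_sub tT)).
apply: filterS (Cc_condexp tT) => s cs; split=> //.
  exact: (filtration_sigma uF tT).
exact: (filtration_sub uF tT).
Qed.

Lemma condexp_ip_C t (k : R -> R) : Icc 0 T t -> L2 mu k ->
  is_condexp Pr (F t) (fun w => ip mu k (pb^~ w)) (fun w => ip mu k (Cc t ^~ w)).
Proof.
move=> tT Lk; have sF := filtration_sigma uF tT; have FM := filtration_sub uF tT.
apply: (condexp_time_integral uF (X := fun s w => k s * pb s w)
  (Y := fun s w => k s * Cc t s w) tT).
- exact: (L2_mul (L2P_det Pr Lk) L2P_pb).
- exact: (L2_mul (L2P_det Pr Lk) (L2P_Cc tT)).
- apply: measurable_funM; last exact: Cc_sub.
  exact: (measurableT_comp (L2_measurable Lk) measurable_fst).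
- by apply: filterS (Cc_condexp tT) => s cs; exact: condexpZ.
Qed.

Lemma condexp_A_C t : Icc 0 T t -> {ae mu, forall s,
  is_condexp Pr (F t) (fun w => A (pb^~ w) s) (fun w => A (Cc t ^~ w) s)}.
Proof.
move=> tT; have sF := filtration_sigma uF tT; have FM := filtration_sub uF tT.
apply: filterS (Cc_condexp tT) => s cs; apply: (condexpB sF FM cs).
exact: (condexp_ip_C tT (kern_row s kr)).
Qed.

Lemma pb_condexp : {ae mu, forall s, is_condexp Pr (F s) (pb s) (fun w => P s w - M s w)}.
Proof.
apply: filterS2 (muT_ae_in T) (L2P_time (L2P_cut T0 uF pP sP)) => s sT LPs.
have sF := filtration_sigma uF sT; have FM := filtration_sub uF sT.
have iP : Pr.-integrable setT (EFin \o P s).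
  have := L2_integrable LPs; congr (_.-integrable _ (_ \o _)).
  by apply/funext => w; rewrite (cutTE _ sT).
have cP : is_condexp Pr (F s) (P s) (P s).
  by apply: condexp_self => //; exact: (progressive_adapted uF sT pP).
have := condexpB sF FM cP (cM sT).
by congr is_condexp; apply/funext => w; rewrite /pb (cutTE _ sT).
Qed.

(** Both sides are versions of the conditional expectation given [F s] of [A] applied to [pb], at
    [s]: its local term becomes [P s - M s], and its integral against [r s] becomes [- ThetaK] by
    [ThetaKE]. *)
Lemma xib_E : {ae mu, forall s, {ae Pr, forall w,
  xib s w = P s w - M s w + ThetaK T G rho lam phi s (fun x => C s x w)}}.
Proof.
apply: filterS3 (muT_ae_in T) xib_condexp pb_condexp => s sT cs cp.
have sF := filtration_sigma uF sT; have FM := filtration_sub uF sT.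
have := condexp_unique sF FM cs (condexpB sF FM cp (condexp_ip_C sT (kern_row s kr))).
apply: filterS2 (L2P_path (L2P_Cc sT)) => w Lw ->; congr (_ + _).
by rewrite (ThetaKE T0 rho0 phi0 lam0 GK kr r_supp r_eq sT).
Qed.

Lemma feedback_ust (E0 : R -> Omega -> R) :
  {ae mu, forall t, is_condexp Pr (F t) (fun w => P t w - P T w) (E0 t)} ->
  {ae mu, forall t, {ae Pr, forall w,
     ust t w = feedback T q lam rho phi h0 G E0 C ust t w}}.
Proof.
move=> cE; have ae2 : {ae mu, forall s, is_condexp Pr (F s) (pb s) (fun w => P s w - M s w) /\
    is_condexp Pr (F s) (fun w => P s w - P T w) (E0 s)}.
  by apply: filterS2 pb_condexp cE => s.
apply: filterS3 (muT_ae_in T) xib_E ae2 => t tT xE [c1 c2].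
have sF := filtration_sigma uF tT; have FM := filtration_sub uF tT.
have c2' : is_condexp Pr (F t) (pb t) (E0 t).
  by move: c2; congr is_condexp; apply/funext => w; rewrite /pb (cutTE _ tT).
have Lgu := L2P_gpast q rho phi T0 uF h0T GK t admissible_ust.
have aeE : {ae Pr, forall w, E0 t w = P t w - M t w}.
  exact: (condexp_unique sF FM c2' c1).
have aeX : {ae Pr, forall w, xib t w = E0 t w + ThetaK T G rho lam phi t (fun x => C t x w)}.
  by apply: filterS2 xE aeE => w -> ->.
apply: filterS3 (L2P_path Lxi) (L2P_path Lgu) aeX => w Lx Lg eX.
have Luc := L2_ust Lx.
have := feedback_path tT Lx Lg; rewrite eX => e.
rewrite /feedback (Ginv_K_ip T0 rho0 phi0 lam0 GK kr r_supp r_eq tT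
  (L2_g1 rho q GK h0T Luc tT) (L2_g2 T q ust w t)); last by move=> x xT; exact: (@g1_lt _ _ _ T).
rewrite ip_g2_le (eq_ip mu (fun=> erefl) (fun s => gam_past q h0 rho phi GK tT s Luc)).
(* The inventory term appearing here cancels the one produced by [Gamma_t^-1 K_t] in [Ginv_K_ip]. *)
have eY : Yu q rho h0 G ust t w = gpast T q h0 G rho phi t ust t w
    + 2 * phi * (Qu q ust t w * tail T t).
  rewrite -(gam_past q h0 rho phi GK tT t Luc) (gm_E _ _ _ _ GK Luc tT tT (lexx t)) subrK.
  rewrite (Y_split _ _ _ GK Luc tT tT (lexx t)) -(cutTE (g1u q rho h0 G ust t w) tT).
  rewrite (cutT_g1 _ _ _ GK Luc tT) lexx mul1r -[RHS]addr0; congr (_ + _).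
  rewrite /ip (@eq_Rintegral _ _ _ _ _ (fun=> 0)).
    by rewrite Rintegral_cst// mul0r.
  move=> x _; have [xt|tx] := ltP x t; first by rewrite mul0r mulr0.
  by rewrite (Gc_causal rho GK)// mul0r.
rewrite eY; apply: (mulfI l2); rewrite e mulVKf// /Aop.
move: (ThetaK _ _ _ _ _ _ _) (gpast _ _ _ _ _ _ _ _ _ _) (ip _ _ _) (Qu _ _ _ _) (tail _ _).
by move=> a b c e' f; ring.
Qed.

Section value.
Variable t : R.
Hypothesis tT : Icc 0 T t.
Variable Dc : R -> Omega -> R.
Hypothesis mDc : measurable_fun setT (fun p : R * Om t => Dc p.1 p.2).
Hypothesis cDc : {ae mu, forall s, is_condexp Pr (F t) (fun w => xib s w ^+ 2) (Dc s)}.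
Local Notation u2 := (future T t ust).
Local Notation gu := (gpast T q h0 G rho phi t ust).
Local Notation Qt := (Qpast T q t ust).
Let Lgu : L2P gu := L2P_gpast q rho phi T0 uF h0T GK t admissible_ust.
Let sF := filtration_sigma uF tT.
Let FM : F t `<=` measurable := filtration_sub uF tT.
Let Ag s w := A (gu^~ w) s.
Let LAg : L2P Ag := L2P_A Lgu.
Let mQ : measurable_fun setT (Qt : Om t -> R) := Qpast_sub q uF tT admissible_ust.
Let LQ : L2 Pr Qt := L2_Qpast q T0 uF t admissible_ust.

Let A_sub Y : measurable_fun setT (fun p : R * Om t => Y p.1 p.2) ->
  measurable_fun setT (fun p : R * Om t => A (Y^~ p.2) p.1).
Proof.
move=> mY; apply: measurable_funB => //.
exact: (@measurable_Op_path _ mu _ (Om t) _ Y (kern_measurable kr) mY).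
Qed.

Let mAg : measurable_fun setT (fun p : R * Om t => Ag p.1 p.2).
Proof. by apply: A_sub; exact: (gpast_sub q rho phi uF h0T GK tT admissible_ust). Qed.

Let ind_sub (Y : R -> Om t -> R) : measurable_fun setT (fun p : R * Om t => Y p.1 p.2) ->
  measurable_fun setT (fun p : R * Om t => ind (t <= p.1) * Y p.1 p.2).
Proof.
move=> mY; apply: measurable_funM => //.
by apply: measurable_ind; apply: measurable_fun_ler => //; exact: measurable_fst.
Qed.

Let ip_sub (Y Z : R -> Om t -> R) : measurable_fun setT (fun p : R * Om t => Y p.1 p.2) ->
  measurable_fun setT (fun p : R * Om t => Z p.1 p.2) ->
  measurable_fun setT (fun w : Om t => ip mu (Y^~ w) (Z^~ w)).
Proof.
move=> mY; apply: (@measurable_path_ip _ mu _ (Om t) (fun w s => Y s w)).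
apply: (measurableT_comp mY (g := fun p : Om t * R => (p.2, p.1))).
by apply: measurable_fun_pair; [exact: measurable_snd|exact: measurable_fst].
Qed.

(** The conditional expectation of [Jx_path] term by term, after expansion of the square of
    [xib - Ag]. The [- 0] stands for the term in [res]; the grouping follows the sums formed in
    [value_condexp]. *)
Definition value (w : Omega) : R :=
  2^-1 * (\int[mu]_s (ind (t <= s) * ((2 * lam)^-1 * Dc s w)))
  - (2 * lam)^-1 * ip mu (fun s => ind (t <= s) * A (Cc t ^~ w) s) (Ag^~ w)
  + ((4 * lam)^-1 * ip mu (Ag^~ w) (fun s => ind (t <= s) * Ag s w)
     - phi * tail T t * (Qt w * Qt w)) - 0 + M t w * Qt w.

Let xi2_condexp : is_condexp Pr (F t)
  (fun w => \int[mu]_s (ind (t <= s) * ((2 * lam)^-1 * xib s w ^+ 2)))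
  (fun w => \int[mu]_s (ind (t <= s) * ((2 * lam)^-1 * Dc s w))).
Proof.
pose X1 s w := ind (t <= s) * ((2 * lam)^-1 * xib s w ^+ 2).
pose Y1 s w := ind (t <= s) * ((2 * lam)^-1 * Dc s w).
have iX : (mu \x Pr)%E.-integrable setT (EFin \o (fun p => X1 p.1 p.2)).
  have := integrable_finZ (2 * lam)^-1 (L2_mul (L2P_ind_le t L2P_xib) L2P_xib).
  congr (_.-integrable _ _); apply/funext => p /=; rewrite /X1 expr2; congr EFin.
  by move: (ind _) (_^-1) (xib _ _) => a b c; ring.
have mY1 : measurable_fun setT (fun p : R * Om t => Y1 p.1 p.2).
  by apply: (ind_sub (Y := fun s w => (2 * lam)^-1 * Dc s w)); exact: measurable_funM.
have c1 : {ae mu, forall s, is_condexp Pr (F t) (X1 s) (Y1 s)}.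
  by apply: filterS cDc => s cs; apply: condexpZ => //; exact: condexpZ.
apply: (condexp_time_integral uF (X := X1) (Y := Y1) tT) => //.
apply: (condexp_prod_integrable uF tT iX _ _ c1).
  move=> s w; rewrite /X1 mulr_ge0//; first by rewrite /ind; case: ifP.
  by rewrite mulr_ge0 ?sqr_ge0// invr_ge0 mulr_ge0// ltW.
exact: (measurable_prod_from_sub uF tT mY1).
Qed.

(** For [s >= t] the tower property brings [xib s] from [F s] down to [F t], giving [A] of [Cc t];
    the factor [Ag s] is already [F t]-measurable. *)
Let xiA_condexp : is_condexp Pr (F t)
  (fun w => ip mu (fun s => ind (t <= s) * xib s w) (Ag^~ w))
  (fun w => ip mu (fun s => ind (t <= s) * A (Cc t ^~ w) s) (Ag^~ w)).
Proof.
have LC := L2P_A (L2P_Cc tT).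
apply: (condexp_time_integral uF (X := fun s w => ind (t <= s) * xib s w * Ag s w)
  (Y := fun s w => ind (t <= s) * A (Cc t ^~ w) s * Ag s w) tT).
- exact: (L2_mul (L2P_ind_le t L2P_xib) LAg).
- exact: (L2_mul (L2P_ind_le t LC) LAg).
- apply: measurable_funM mAg.
  by apply: (ind_sub (Y := fun s w => A (Cc t ^~ w) s)); apply: A_sub; exact: Cc_sub.
have ae1 : {ae mu, forall s, L2 Pr (xib s) /\ L2 Pr (Ag s)}.
  by apply: filterS2 (L2P_time L2P_xib) (L2P_time LAg) => s.
have ae2 : {ae mu, forall s, Icc 0 T s /\ is_condexp Pr (F t) (fun w => A (pb^~ w) s)
    (fun w => A (Cc t ^~ w) s)}.
  by apply: filterS2 (muT_ae_in T) (condexp_A_C tT) => s.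
apply: filterS3 ae1 ae2 xib_condexp => s [Lx LA] [sT cC'] cx.
have c1 : is_condexp Pr (F t) (fun w => ind (t <= s) * xib s w)
    (fun w => ind (t <= s) * A (Cc t ^~ w) s).
  have [st|ts] := ltP s t.
    have c0 : is_condexp Pr (F t) (fun=> 0) (fun=> 0).
      by apply: condexp_self => //; exact: (L2_integrable (L2_0 Pr)).
    by move: c0; congr is_condexp; apply/funext => w; rewrite mul0r.
  exact: (condexpZ sF FM _ (condexp_tower uF sT tT ts cx cC')).
exact: (condexpM_L2 uF tT c1 (measurable_fun_pair2 s mAg) (L2Z _ Lx) LA).
Qed.

Let self_condexp : is_condexp Pr (F t)
  (fun w => (4 * lam)^-1 * ip mu (Ag^~ w) (fun s => ind (t <= s) * Ag s w)
     - phi * tail T t * (Qt w * Qt w))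
  (fun w => (4 * lam)^-1 * ip mu (Ag^~ w) (fun s => ind (t <= s) * Ag s w)
     - phi * tail T t * (Qt w * Qt w)).
Proof.
apply: (condexp_self sF FM).
  apply: measurable_funB; last by apply: measurable_funM => //; exact: measurable_funM.
  apply: measurable_funM => //; apply: (ip_sub (Y := Ag)) => //.
  exact: (ind_sub (Y := Ag)).
apply: integrable_finB; last by apply: integrable_finZ; exact: L2_mul.
apply: integrable_finZ; exact: (integrable_path_ip LAg (L2P_ind_le t LAg)).
Qed.

(** Each part of the expanded square is conditioned by one of the three preceding facts, and
    [res_condexp] removes the term in [res]. *)
Lemma value_condexp : is_condexp Pr (F t) (Jx T q h0 G rho phi t ust P lam) value.
Proof.
have Lu2 := L2P_future T0 uF t admissible_ust.
have cr := res_condexp tT Lu2 (adapted_future uF t admissible_ust)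
  (fun s w (st : s < t) => ltac:(by rewrite /future leNgt st mul0r)).
have c2 := condexpB sF FM (condexpZ sF FM 2^-1 xi2_condexp)
  (condexpZ sF FM (2 * lam)^-1 xiA_condexp).
have cJ := condexpD sF FM (condexpB sF FM (condexpD sF FM c2 self_condexp) cr)
  (condexpM_L2 uF tT (cM tT) mQ L2_PT LQ).
apply: (condexp_ae sF FM cJ).
- apply: integrable_measurable.
  exact: (integrable_Jx q rho phi T0 uF h0T GK t admissible_ust lam L2_PT L2P_pb).
- exact: (condexp_sub sF cJ).
- have ae1 : {ae Pr, forall w, L2 mu (xi^~ w) /\ L2 mu (beta0^~ w)}.
    by apply: filterS2 (L2P_path Lxi) (L2P_path L2P_beta0) => w.
  have ae2 : {ae Pr, forall w, L2 mu (pb^~ w) /\ L2 mu (res^~ w)}.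
    by apply: filterS2 (L2P_path L2P_pb) (L2P_path L2P_res) => w.
  apply: filterS3 ae1 ae2 (L2P_path Lgu) => w [Lx Lb] [Lp Lr] Lg.
  rewrite (Jx_path tT Lx Lb Lg Lp Lr).
  have LA : L2 mu (Ag^~ w) := L2_Aop kr Lg.
  have Lxb : L2 mu (xib^~ w) by apply: L2B => //; exact: L2_Aop.
  have Lxi1 := L2_ind_le t Lxb; have LA1 := L2_ind_le t LA.
  have e1 : \int[mu]_s (ind (t <= s) * ((2 * lam)^-1 * xib s w ^+ 2)) =
      (2 * lam)^-1 * ip mu (xib^~ w) (fun s => ind (t <= s) * xib s w).
    rewrite -ipZl//; apply: eq_Rintegral => s _; rewrite expr2.
    by move: (ind _) (_^-1) (xib _ _) => a b c; ring.
  rewrite e1 (ip_ind_sqrB t Lxb LA : ip mu (fun s => xib s w - Ag s w) _ = _).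
  move: (ip _ _ _) (ip _ _ _) (ip _ _ _) (ip _ _ _) (P T w) (Qt w) (tail T t).
  move=> a b c e' f g h; field; by rewrite gt_eqF.
- exact: nearW.
Qed.

(** Half of the constant [- 2 rho q ^+ 2] in [chi] is compensated by the added [rho q ^+ 2]; the
    remaining terms are the quadratic forms of [Gamma_t^-1] written through [A]. *)
Lemma Vu_value (DC : R -> R -> Omega -> R) : DC t = Dc ->
  {ae Pr, forall w, Vu T q lam rho phi h0 G M C DC ust t w + rho * q ^+ 2 = value w}.
Proof.
move=> DE; apply: filterS3 (L2P_path Lxi) (L2P_path Lgu) (L2P_path (L2P_Cc tT)).
move=> w Lx Lg LC; have Luc := L2_ust Lx; have /andP[t0 _] := tT.
have Lg1 := L2_g1 rho q GK h0T Luc tT; have Lg2 := L2_g2 T q ust w t.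
have gE : gam T phi t (g1u q rho h0 G ust t w) (g2u q ust t w) = gu^~ w.
  by apply/funext => s; exact: gam_past.
have g1t x : inT x -> x < t -> g1u q rho h0 G ust t w x = 0 by exact: g1_lt.
rewrite /Vu (Ginv_g_ip T0 rho0 phi0 lam0 GK kr r_supp r_eq Lg1 Lg2 g1t).
rewrite (Theta_g_ip T0 rho0 phi0 lam0 GK kr r_supp r_eq Lg1 Lg2 g1t LC).
rewrite gE ip_g2_g2 (Qu_past q tT Luc) DE.
have -> : RInt t T (fun s => (2 * lam)^-1 * Dc s w) =
    \int[mu]_s (ind (t <= s) * ((2 * lam)^-1 * Dc s w)).
  have mw : measurable_fun setT (fun s => (2 * lam)^-1 * Dc s w).
    apply: measurable_funM => //.
    exact: (measurable_fun_pair1 w (measurable_prod_from_sub uF tT mDc)).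
  rewrite (@RInt_muT _ T _ _ _ (fun s => (2 * lam)^-1 * Dc s w))//.
  apply: ae_Rintegral.
  - apply: measurable_funM => //; apply: measurable_ind; apply: measurable_and;
      exact: measurable_fun_ler.
  - by apply: measurable_funM => //; apply: measurable_ind; exact: measurable_fun_ler.
  - by apply: filterS (muT_ae_in T) => s /andP[_ ->]; rewrite andbT.
rewrite /value (ipC mu (fun s => ind (t <= s) * A (Cc t ^~ w) s)) -!/(Ag _ w).
move: (ip _ _ _) (ip _ _ _) (Rintegral _ _ _) (M t w) (Qt w) (tail T t).
by move=> a b c e f g; field; rewrite gt_eqF.
Qed.

End value.

Variable DC : R -> R -> Omega -> R.
Hypothesis mDC : forall t, Icc 0 T t -> measurable_fun setT (fun p : R * Om t => DC t p.1 p.2).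
Hypothesis cDC : forall t, Icc 0 T t ->
  {ae mu, forall s, is_condexp Pr (F t) (fun w => xib s w ^+ 2) (DC t s)}.

Lemma DC_family : condexp_family Pr T F
  (fun s w => (P s w - M s w + ThetaK T G rho lam phi s (fun x => C s x w)) ^+ 2) DC.
Proof.
move=> t tT; split; first exact: (measurable_prod_from_sub uF tT (mDC tT)).
have sF := filtration_sigma uF tT; have FM := filtration_sub uF tT.
suff /muT_ae : {ae mu, forall s, is_condexp Pr (F t)
    (fun w => (P s w - M s w + ThetaK T G rho lam phi s (fun x => C s x w)) ^+ 2) (DC t s)}.
  move=> [N [mN N0 sN]]; exists N; split=> // s hs; apply: sN => h; apply: hs.
  move=> /andP[ts sT]; apply: h; have /andP[t0 _] := tT.
  by rewrite /Icc/= (le_trans t0 ts) sT.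
apply: filterS2 (cDC tT) xib_E => s cs es.
have ae2 : {ae Pr, forall w, xib s w ^+ 2 =
    (P s w - M s w + ThetaK T G rho lam phi s (fun x => C s x w)) ^+ 2}.
  by apply: filterS es => w ->.
apply: (condexp_ae sF FM cs _ _ ae2).
- exact: (ae_measurable T0 uF (integrable_measurable (condexp_intX cs)) ae2).
- exact: (condexp_sub sF cs).
- exact: nearW.
Qed.

Lemma Jt_value_condexp t : Icc 0 T t ->
  is_condexp Pr (F t) (Jt T q lam rho phi P h0 G ust t)
    (fun w => Vu T q lam rho phi h0 G M C DC ust t w + rho * q ^+ 2).
Proof.
move=> tT; have sF := filtration_sigma uF tT; have FM := filtration_sub uF tT.
have cv := value_condexp tT (mDC tT) (cDC tT).
have aeV : {ae Pr, forall w, value t (DC t) w =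
    Vu T q lam rho phi h0 G M C DC ust t w + rho * q ^+ 2}.
  by apply: filterS (Vu_value tT (mDC tT) (erefl (DC t))) => w.
have aeJ : {ae Pr, forall w, Jx T q h0 G rho phi t ust P lam w =
    Jt T q lam rho phi P h0 G ust t w}.
  by apply: filterS (Jt_Jx q rho phi T0 uF h0T GK tT admissible_ust lam pP sP) => w.
apply: (condexp_ae sF FM cv _ _ aeJ aeV).
- exact: (ae_measurable T0 uF (integrable_measurable (condexp_intX cv)) aeJ).
- exact: (ae_sub_measurable T0 uF tT (condexp_sub sF cv) aeV).
Qed.

Lemma Jt_le t v : Icc 0 T t -> admissible Pr T F v ->
  (forall s w, 0 <= s < t -> v s w = ust s w) ->
  {ae Pr, forall w, Jt T q lam rho phi P h0 G v t w <=
    Jt T q lam rho phi P h0 G ust t w - ip mu (res^~ w) (deviation t v ^~ w)}.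
Proof.
move=> tT av vu.
apply: filterS3 (Jx_le tT av vu) (Jt_Jx q rho phi T0 uF h0T GK tT av lam pP sP)
  (Jt_Jx q rho phi T0 uF h0T GK tT admissible_ust lam pP sP).
by move=> w h -> ->.
Qed.

(** The upper bound is [Jt_le], whose [res] term has conditional expectation 0. [ust] itself is a
    competitor, so the bound is attained and minimality is immediate. *)
Lemma value_esssup t (cj : (R -> Omega -> R) -> Omega -> R) : Icc 0 T t ->
  (forall u, admissible Pr T F u -> (forall s w, Icc 0 t s -> u s w = ust s w) ->
     is_condexp Pr (F t) (Jt T q lam rho phi P h0 G u t) (cj u)) ->
  is_esssup Pr
    [set cj u | u in [set u | admissible Pr T F u /\
                     (forall s w, Icc 0 t s -> u s w = ust s w)]]
    (fun w => Vu T q lam rho phi h0 G M C DC ust t w + rho * q ^+ 2).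
Proof.
move=> tT cjP; have sF := filtration_sigma uF tT; have FM := filtration_sub uF tT.
have cV := Jt_value_condexp tT.
split; first exact: (integrable_measurable (condexp_intY cV)).
split.
  move=> _ [v [av vu] <-].
  have vu' s w : 0 <= s < t -> v s w = ust s w.
    by move=> /andP[s0 st]; apply: vu; rewrite /Icc/= s0 ltW.
  have cd := condexpB sF FM cV (deviation_condexp tT av).
  have := condexp_le sF FM (cjP v av vu) cd (Jt_le tT av vu').
  by apply: filterS => w; rewrite subr0.
move=> Z mZ ZP.
have cu := cjP ust admissible_ust (fun _ _ _ => erefl).
have uZ : {ae Pr, forall w, cj ust w <= Z w}.
  by apply: ZP; exists ust => //; split; [exact: admissible_ust|].
by apply: filterS2 (condexp_unique sF FM cu cV) uZ => w <-.
Qed.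

Lemma ae_integralE (f g : Omega -> R) : Pr.-integrable setT (EFin \o g) ->
  {ae Pr, forall w, g w = f w} -> (\int[Pr]_w (f w)%:E = (\int[Pr]_w g w)%:E)%E.
Proof.
move=> ig gf; rewrite /Rintegral fineK; last exact: integrable_fin_num.
have mg := integrable_measurable ig.
apply: ae_eq_integral => //.
- apply/measurable_EFinP; exact: (ae_measurable T0 uF mg gf).
- exact/measurable_EFinP.
- by apply: filterS gf => w ->.
Qed.

Let integrable_c (c : R) : Pr.-integrable setT (EFin \o (fun=> c)).
Proof. exact: (L2_integrable (L2_cst Pr c)). Qed.

Lemma value_sup :
  (\int[Pr]_w (Vu T q lam rho phi h0 G M C DC ust 0 w)%:E
    = ereal_sup [set Jtot T q lam rho phi P h0 G Pr u | u in admissible Pr T F])%E.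
Proof.
have I0 : Icc 0 T 0 by rewrite /Icc/= lexx ltW.
have sF := filtration_sigma uF I0; have FM := filtration_sub uF I0.
have FT : F 0 setT by have [h0' hC _] := sF; rewrite -(setD0 setT); exact: hC.
have int_condexp (Y Z : Omega -> R) : is_condexp Pr (F 0) Y Z ->
    \int[Pr]_w Z w = \int[Pr]_w Y w.
  by move=> [_ [_ [_ /(_ setT FT)]]] e; rewrite /Rintegral e.
pose J v := Jt T q lam rho phi P h0 G v 0; pose c := rho * q ^+ 2.
have iJ v : admissible Pr T F v -> Pr.-integrable setT (EFin \o J v).
  move=> av.
  exact: (integrable_Jt q rho phi T0 uF h0T GK I0 av lam pP sP L2_PT L2P_pb).
have iu := iJ _ admissible_ust; have ic := integrable_c c.
have JtotE v : admissible Pr T F v ->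
    Jtot T q lam rho phi P h0 G Pr v = (\int[Pr]_w (J v w - c))%:E.
  move=> av; apply: ae_integralE.
    by apply: integrable_finB; [exact: iJ|exact: integrable_c].
  apply: filterS2 (L2P_path (L2P_v T0 uF av)) (L2P_path (L2P_cut T0 uF pP sP)) => w Lv Lp.
  by rewrite (Jtot_path rho phi lam q T0 GK h0T Lv Lp).
have cV := Jt_value_condexp I0; have iV := condexp_intY cV.
have VE : (\int[Pr]_w (Vu T q lam rho phi h0 G M C DC ust 0 w)%:E =
    (\int[Pr]_w (J ust w - c))%:E)%E.
  rewrite RintegralB// -(int_condexp _ _ cV) -RintegralB//.
  apply: ae_integralE; first exact: integrable_finB.
  by apply: nearW => w; rewrite addrK.
rewrite VE; apply/eqP; rewrite eq_le; apply/andP; split.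
  by apply: ereal_sup_ubound; exists ust; [exact: admissible_ust|exact: JtotE admissible_ust].
apply: ge_ereal_sup => _ [v av <-]; rewrite JtotE// lee_fin.
(* No time of the horizon precedes 0, so every admissible control competes with [ust]. *)
have vu s w : 0 <= s < 0 -> v s w = ust s w.
  by move=> /andP[s0 s1]; have := le_lt_trans s0 s1; rewrite ltxx.
have cd := deviation_condexp I0 av.
have id := condexp_intX cd.
have iv := iJ _ av.
rewrite RintegralB// RintegralB// lerD2r -[leRHS]subr0.
have <- : \int[Pr]_w ip mu (res^~ w) (deviation 0 v ^~ w) = 0.
  by rewrite -(int_condexp _ _ cd) Rintegral_cst// mul0r.
rewrite -RintegralB//; apply: ae_le_Rintegral => //; first exact: integrable_finB.
exact: Jt_le.
Qed.

End versions.
End control.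

(** The time-integrated bound on [P] does not control the single variable [P T], whence its own
    moment condition. [E0], [M], [C] and [Dc] are versions of the conditional expectations, whereas
    [cj] is an arbitrary selection of versions of the conditional payoffs; the constant [rho q ^+ 2]
    is moved to the side of the value. *)
Theorem theorem4p4 (R : realType) (d : measure_display) (Omega : measurableType d)
  (Pr : probability Omega R) (F : R -> set (set Omega)) (T : R)
  (P : R -> Omega -> R) (q : R) (h0 : R -> R) (G : R -> R -> R)
  (lam rho phi : R) :
  0 < T ->
  usual_filtration Pr T F ->
  progressive T F P ->
  sq_int_proc Pr T P ->
  (\int[Pr]_w ((P T w) ^+ 2)%:E < +oo)%E ->
  0 < q ->
  sq_int T h0 ->
  kernel_class T G ->
  0 < lam -> 0 <= rho -> 0 <= phi ->
  exists ustar : R -> Omega -> R,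
    admissible Pr T F ustar /\
    exists (E0 M : R -> Omega -> R) (C Dc : R -> R -> Omega -> R),
      (* E0 t = E[P_t - P_T | F_t] (for almost every t), M t = E[P_T | F_t] *)
      measurable_fun setT (fun p : R * Omega => E0 p.1 p.2) /\
      ({ae leb, forall t, Icc 0 T t ->
         is_condexp Pr (F t) (fun w => P t w - P T w) (E0 t)}) /\
      (forall t, Icc 0 T t -> is_condexp Pr (F t) (P T) (M t)) /\
      (* C t s = E[P_s - P_T | F_t] *)
      condexp_family Pr T F (fun s w => P s w - P T w) C /\
      (* Dc t s = E[(P_s - M_s + <Theta_s, K_s>)^2 | F_t] *)
      condexp_family Pr T F
        (fun s w => (P s w - M s w
                     + ThetaK T G rho lam phi s (fun r => C s r w)) ^+ 2) Dc /\
      (* feedback form of ustar *)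
      ({ae leb, forall t, Icc 0 T t ->
         {ae Pr, forall w,
            ustar t w = feedback T q lam rho phi h0 G E0 C ustar t w}}) /\
      (* optimality: V_t = esssup_{u in A_t(ustar)} E[J_t(u) | F_t] - rho q^2 *)
      (forall t, Icc 0 T t ->
        forall cj : (R -> Omega -> R) -> Omega -> R,
          (forall u, admissible Pr T F u ->
             (forall s w, Icc 0 t s -> u s w = ustar s w) ->
             is_condexp Pr (F t) (Jt T q lam rho phi P h0 G u t) (cj u)) ->
          is_esssup Pr
            [set cj u | u in [set u | admissible Pr T F u /\
                             (forall s w, Icc 0 t s -> u s w = ustar s w)]]
            (fun w => Vu T q lam rho phi h0 G M C Dc ustar t w + rho * q ^+ 2)) /\
      (* in particular: E[V_0] = sup_u J(u) *)
      (\int[Pr]_w (Vu T q lam rho phi h0 G M C Dc ustar 0 w)%:E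
         = ereal_sup [set Jtot T q lam rho phi P h0 G Pr u
                     | u in admissible Pr T F])%E.
Proof.
move=> T0 uF pP sP sPT q0 h0T GK lam0 rho0 phi0.
have [r [kr r_supp r_eq]] := resolvent_exists (kern_kap rho phi GK) lam0
  (kap_ge0 rho0 phi0 GK).
have [xi [xi_prog xi_cut Lxi cxi]] := xi_exists q rho phi T0 uF pP sP sPT h0T kr.
have Lpb := L2P_pb T0 uF pP sP sPT.
have LPT := L2_PT T0 uF pP sPT.
pose p := pb T P; pose y := xib T q h0 rho phi r xi.
have Ly : L2P Pr (muT T) y := L2P_xib q rho phi h0T kr Lxi.
have ip : {ae muT T, forall s, Pr.-integrable setT (EFin \o p s)}.
  by apply: filterS (L2P_time Lpb) => s; exact: L2_integrable.
have iy : {ae muT T, forall s, Pr.-integrable setT (EFin \o (fun w => y s w ^+ 2))}.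
  by apply: filterS (L2P_time Ly) => s [].
have my : measurable_fun setT (fun p : R * Omega => y p.1 p.2 ^+ 2).
  by apply: measurable_funX; exact: (L2_measurable Ly).
have /choice[M MP] : forall t, exists Mt : Omega -> R,
    Icc 0 T t -> is_condexp Pr (F t) (P T) Mt.
  move=> t; have [tT|tT] := pselect (Icc 0 T t); last by exists (fun=> 0).
  by have [Y cY] := condexp_exists T0 uF tT (L2_integrable LPT); exists Y.
have versions (X : R -> Omega -> R) : measurable_fun setT (fun p : R * Omega => X p.1 p.2) ->
    {ae muT T, forall s, Pr.-integrable setT (EFin \o X s)} ->
    exists C : R -> R -> Omega -> R, forall t, Icc 0 T t ->
      measurable_fun setT (fun p : R * g_sigma_algebraType (F t) => C t p.1 p.2) /\
      {ae muT T, forall s, is_condexp Pr (F t) (X s) (C t s)}.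
  move=> mX iX; have /choice[C CP] : forall t, exists Ct : R -> Omega -> R, Icc 0 T t ->
      measurable_fun setT (fun p : R * g_sigma_algebraType (F t) => Ct p.1 p.2) /\
      {ae muT T, forall s, is_condexp Pr (F t) (X s) (Ct s)}.
    move=> t; have [tT|tT] := pselect (Icc 0 T t); last by exists (fun _ _ => 0).
    by have [Y cY] := fixed_projection uF tT mX iX; exists Y.
  by exists C.
have [C CP] := versions p (L2_measurable Lpb) ip.
have [Dc DP] := versions _ my iy.
have mC t (tT : Icc 0 T t) := (CP t tT).1; have cC t (tT : Icc 0 T t) := (CP t tT).2.
have mD t (tT : Icc 0 T t) := (DP t tT).1; have cD t (tT : Icc 0 T t) := (DP t tT).2.
have [Y [pY cY]] := optional_projection T0 uF (L2_measurable Lpb) ip.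
have pE s w : Icc 0 T s -> p s w = P s w - P T w by move=> sT; rewrite /p /pb cutTE.
(* Being progressive constrains [Y] on the horizon only; the cut makes it jointly measurable over
   all times. *)
pose E0 s w := ind ((0 <= s) && (s <= T)) * Y s w.
have cE0 : {ae muT T, forall t, is_condexp Pr (F t) (fun w => P t w - P T w) (E0 t)}.
  apply: filterS2 (muT_ae_in T) cY => s sT.
  congr is_condexp; apply/funext => w; first exact: pE.
  by rewrite /E0 (_ : (_ && _) = true)// mul1r.
exists (ust T lam r xi); split; first exact: (admissible_ust lam uF kr r_supp xi_prog xi_cut Lxi).
exists E0, M, C, Dc; split; first exact: (progressive_measurable T0 uF pY).
split; first exact/muT_ae.
split=> //.
split.
  move=> t tT; split; first exact: (measurable_prod_from_sub uF tT (mC t tT)).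
  have /muT_ae [N [mN N0 sN]] := cC t tT; exists N; split=> // s hs; apply: sN => h.
  apply: hs => /andP[ts sT]; have /andP[t0 _] := tT.
  have sT' : Icc 0 T s by rewrite /Icc/= (le_trans t0 ts) sT.
  by move: (h sT'); congr is_condexp; apply/funext => w; exact: pE.
split; first exact: (DC_family T0 uF pP sP sPT h0T GK lam0 rho0 phi0 kr r_supp r_eq cxi MP mC cC mD cD).
split.
  apply/muT_ae.
  exact: (feedback_ust T0 uF pP sP sPT h0T GK lam0 rho0 phi0 kr r_supp r_eq xi_prog xi_cut Lxi cxi MP mC cC cE0).
split.
  move=> t tT cj cjP.
  exact: (value_esssup T0 uF pP sP sPT h0T GK lam0 rho0 phi0 kr r_supp r_eq xi_prog xi_cut Lxi cxi MP mC cC mD cD tT cjP).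
exact: (value_sup T0 uF pP sP sPT h0T GK lam0 rho0 phi0 kr r_supp r_eq xi_prog xi_cut Lxi cxi MP mC cC mD cD).
Qed.
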